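(* Let $I\ge 1$ be an integer and consider two families of continuous real-valued functions $(a_i)_{1\le i\le I}$ and $(r_i)_{1\le i\le I}$, where for every $i$ the function $a_i$ is defined on $\overline{Q_T}\times\mathbb{R}^{I-i}$ and $r_i$ is defined on $\mathbb{R}^I$. Assume that each $a_i$ is bounded from above and bounded from below by a positive constant, that each $r_i$ is bounded from above, and that each $|r_i|$ is sub-affine, i.e. there is a constant $C$ such that $|r_i(x_1,\dots,x_I)|\le C(1+|x_1|+\cdots+|x_I|)$ for all $(x_1,\dots,x_I)\in\mathbb{R}^I$. Let $(\rho_i)_{1\le i\le I}$ be a family of non-negative smooth functions on $\mathbb{T}^N$ with integral $1$, and let $(u_i^{in})_{1\le i\le I}$ be a family of non-negative functions in $\mathrm{L}^2(\mathbb{T}^N)$. Then there exists a family $(u_i)_{1\le i\le I}$ of non-negative functions in $\mathrm{L}^2(Q_T)$ solving on $Q_T$ the Cauchy problem $$\left\{\begin{array}{l}\partial_t u_1-\Delta[a_1(\,\cdot\,,u_2\star\rho_2,u_3\star\rho_3,\dots,u_I\star\rho_I)\,u_1]=r_1(u_1\star\rho_1,\dots,u_I\star\rho_I)\,u_1,\\ \partial_t u_2-\Delta[a_2(\,\cdot\,,u_3\star\rho_3,\dots,u_I\star\rho_I)\,u_2]=r_2(u_1\star\rho_1,\dots,u_I\star\rho_I)\,u_2,\\ \quad\vdots\\ \partial_t u_I-\Delta[a_I\,u_I]=r_I(u_1\star\rho_1,\dots,u_I\star\rho_I)\,u_I,\end{array}\right.$$ with initial condition $u_i(0,\cdot)=u_i^{in}$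 for all $1\le i\le I$.
   Context: $T>0$ and an integer $N\ge 1$ are fixed, $\mathbb{T}^N$ is the flat torus, $Q_T:=[0,T)\times\mathbb{T}^N$, $\overline{Q_T}=[0,T]\times\mathbb{T}^N$. The convolution $\star$ acts on the space variable $x\in\mathbb{T}^N$ only. The dot in $a_i(\,\cdot\,,\dots)$ stands for the variable $(t,x)\in\overline{Q_T}$; in particular $a_I$ is a function of $(t,x)$ only. $\mathscr{D}(Q_T)$ denotes the smooth functions with compact support in $[0,T)\times\mathbb{T}^N$ (they may be non-zero at $t=0$). Notion of solution: each equation is of the form $\partial_t z-\Delta(\mu z)=G$, $z(0,\cdot)=z^0$, and is understood as follows. For $G\in\mathrm{L}^1(Q_T)$, $z^0\in\mathrm{L}^1(\mathbb{T}^N)$ and $\mu$ measurable on $Q_T$, a function $z\in\mathrm{L}^1(Q_T)$ is a (distributional) solution if $z\mu\in\mathrm{L}^1(Q_T)$ and $$\forall\varphi\in\mathscr{D}(Q_T),\qquad -\int_{Q_T}z(\partial_t\varphi+\mu\Delta\varphi)=\int_{\mathbb{T}^N}z^0\varphi(0,\cdot)+\int_{Q_T}G\varphi.$$ *)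

(* Defs.v *)
From HB Require Import structures.
From mathcomp Require Import all_boot all_order all_algebra.
From mathcomp Require Import all_classical all_reals all_analysis.

Set Implicit Arguments.
Unset Strict Implicit.
Unset Printing Implicit Defensive.

Import Order.TTheory GRing.Theory Num.Theory.
Import numFieldNormedType.Exports.

Local Open Scope classical_set_scope.
Local Open Scope ring_scope.

(* The sigma-algebra generated by the coordinates, as the library does for
   tuples; it is the Borel sigma-algebra of R^n. *)
Section measurable_rV.
Context {R : realType} (n : nat).

Let coord (i : 'I_n) (v : 'rV[R]_n) : R := v 0 i.

Let rV_set0 : g_sigma_preimage coord set0.
Proof. exact: sigma_algebra0. Qed.

Let rV_setC A : g_sigma_preimage coord A -> g_sigma_preimage coord (~` A).
Proof. exact: sigma_algebraC. Qed.

Let rV_bigcup (F : (set 'rV[R]_n)^nat) :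
  (forall i, g_sigma_preimage coord (F i)) ->
  g_sigma_preimage coord (\bigcup_i (F i)).
Proof. exact: sigma_algebra_bigcup. Qed.

HB.instance Definition _ :=
  @isMeasurable.Build (measure_tuple_display default_measure_display)
    'rV[R]_n (g_sigma_preimage coord) rV_set0 rV_setC rV_bigcup.

End measurable_rV.

Section measurable_rV_lemmas.
Context {R : realType}.

Lemma measurable_coord n (i : 'I_n) :
  measurable_fun [set: 'rV[R]_n] (fun v => v 0 i).
Proof.
move=> _ Y mY; rewrite setTI; apply: sub_sigma_algebra => /=.
rewrite -bigcup_seq/=; exists i => /=; first by rewrite mem_index_enum.
by exists Y => //; rewrite setTI.
Qed.

Lemma measurable_fun_coordP d (T : measurableType d) n (f : T -> 'rV[R]_n) :
  (forall i, measurable_fun [set: T] (fun x => f x 0 i)) ->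
  measurable_fun [set: T] f.
Proof.
move=> mf; apply: (@measurability _ _ _ _ setT f
  (\big[setU/set0]_(i < n) preimage_set_system setT
     (fun v : 'rV[R]_n => v 0 i) measurable)).
  by [].
move=> _ [A + <-]; rewrite -bigcup_seq/= => -[i _ [B mB <-]].
have := mf i measurableT _ mB.
by rewrite !setTI.
Qed.

Definition cons_rV n (p : measurableTypeR R * 'rV[R]_n) : 'rV[R]_n.+1 :=
  \row_i if unlift ord0 i is Some j then p.2 0 j else p.1.

Definition uncons_rV n (v : 'rV[R]_n.+1) : measurableTypeR R * 'rV[R]_n :=
  (v 0 ord0, \row_j v 0 (lift ord0 j)).

Lemma cons_rVK n : cancel (@cons_rV n) (@uncons_rV n).
Proof.
move=> [x v]; rewrite /uncons_rV /cons_rV mxE unlift_none /=; congr pair.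
by apply/rowP => j; rewrite !mxE liftK.
Qed.

Lemma measurable_cons_rV n :
  measurable_fun [set: measurableTypeR R * 'rV[R]_n] (@cons_rV n).
Proof.
apply: measurable_fun_coordP => i.
under eq_fun do rewrite mxE.
case: (unlift ord0 i) => [j|]; last exact: measurable_fst.
exact: (measurableT_comp (measurable_coord j) measurable_snd).
Qed.

Lemma measurable_uncons_rV n :
  measurable_fun [set: 'rV[R]_n.+1] (@uncons_rV n).
Proof.
apply/measurable_fun_pairP; split; first exact: measurable_coord.
apply: measurable_fun_coordP => i /=.
under eq_fun do rewrite mxE.
exact: measurable_coord.
Qed.

End measurable_rV_lemmas.

Section lebesgue_rV.
Context {R : realType}.

Section step.
Variables (n : nat) (m : {sigma_finite_measure set 'rV[R]_n -> \bar R}).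

Definition lebesgue_rV_step : set 'rV[R]_n.+1 -> \bar R :=
  pushforward (lebesgue_measure \x m)%E (@cons_rV R n).

Let mcons := @measurable_cons_rV R n.

Let step0 : lebesgue_rV_step set0 = 0%E.
Proof. by rewrite /lebesgue_rV_step /pushforward preimage_set0 measure0. Qed.

Let step_ge0 A : (0 <= lebesgue_rV_step A)%E.
Proof. exact: measure_ge0. Qed.

Let step_sigma_additive : semi_sigma_additive lebesgue_rV_step.
Proof.
move=> F mF tF mUF; rewrite /lebesgue_rV_step /pushforward preimage_bigcup.
apply: measure_semi_sigma_additive.
- by move=> k; rewrite -[X in measurable X]setTI; exact: mcons.
- apply/trivIsetP => /= i j _ _ ij; rewrite -preimage_setI.
  by move/trivIsetP : tF => /(_ _ _ _ _ ij) ->//; rewrite preimage_set0.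
- by rewrite -preimage_bigcup -[X in measurable X]setTI; exact: mcons.
Qed.

HB.instance Definition _ := isMeasure.Build _ _ _ lebesgue_rV_step
  step0 step_ge0 step_sigma_additive.

Lemma lebesgue_rV_step_sigma_finite : sigma_finite setT lebesgue_rV_step.
Proof.
have /sigma_finiteP[F [TF ndF Foo]] := sigma_finiteT (@lebesgue_measure R).
have /sigma_finiteP[G [TG ndG Goo]] := sigma_finiteT m.
exists (fun k => @uncons_rV R n @^-1` (F k `*` G k)).
  rewrite -preimage_bigcup -[LHS](preimage_setT (@uncons_rV R n)).
  congr (_ @^-1` _); rewrite -setXTT TF TG predeqE => -[x y]; split.
    move=> [/= [k _ Fkx] [l _ Gly]]; exists (maxn k l) => //; split.
    - by move: x Fkx; exact/subsetPset/ndF/leq_maxl.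
    - by move: y Gly; exact/subsetPset/ndG/leq_maxr.
  by move=> [k _ []/= ? ?]; split; exists k.
move=> k; have [mFk Fkoo] := Foo k; have [mGk Gkoo] := Goo k; split.
  rewrite -[X in measurable X]setTI.
  by apply: measurable_uncons_rV => //; exact: measurableX.
rewrite /lebesgue_rV_step /pushforward -comp_preimage.
rewrite (_ : _ \o _ = id) ?preimage_id; last first.
  by apply/funext => p; rewrite /comp cons_rVK.
by rewrite product_measure1E// lte_mul_pinfty// ge0_fin_numE.
Qed.

HB.instance Definition _ :=
  @Measure_isSigmaFinite.Build _ _ _ lebesgue_rV_step
    lebesgue_rV_step_sigma_finite.

End step.

Fixpoint lebesgue_rV n : {sigma_finite_measure set 'rV[R]_n -> \bar R} :=
  match n with
  | 0 => \d_(0 : 'rV[R]_0)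
  | n'.+1 => lebesgue_rV_step (lebesgue_rV n')
  end.

Lemma measurable_box n (A : 'I_n -> set R) :
  (forall i, measurable (A i)) ->
  measurable [set v : 'rV[R]_n | forall i, A i (v 0 i)].
Proof.
move=> mA; rewrite (_ : mkset _ =
    \bigcap_(i in [set: 'I_n]) ((fun v : 'rV[R]_n => v 0 i) @^-1` A i)).
  apply: fin_bigcap_measurable => // i _.
  by rewrite -[X in measurable X]setTI; exact: measurable_coord.
by apply/seteqP; split => v /= Av i; [move=> _; exact: Av|exact: Av].
Qed.

Lemma lebesgue_rV_box n (A : 'I_n -> set R) :
  (forall i, measurable (A i)) ->
  lebesgue_rV n [set v : 'rV[R]_n | forall i, A i (v 0 i)] =
  (\prod_(i < n) lebesgue_measure (A i))%E.
Proof.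
elim: n A => [A _|n IHn A mA] /=.
  by rewrite big_ord0 diracE mem_set// => -[].
rewrite big_ord_recl -IHn; last by move=> i; exact: mA.
rewrite -product_measure1E//; [|exact: mA|].
  rewrite /lebesgue_rV_step /pushforward; congr (product_measure1 _ _ _).
  apply/seteqP; split => -[x v] /=.
    move=> Av; split=> [|i].
      by have := Av ord0; rewrite mxE unlift_none.
    by have := Av (lift ord0 i); rewrite mxE liftK.
  by move=> [Ax Av] i; rewrite mxE; case: unliftP => [j ->|->].
by apply: (@measurable_box n (A \o lift ord0)) => i; exact: mA.
Qed.

End lebesgue_rV.

Section torus.
Context {R : realType}.

(* The flat torus is R^N / Z^N: a function on it is a function on R^N that is
   1-periodic in each coordinate, and it is integrated over the unit cube. *)
Definition torus_periodic N (f : 'rV[R]_N -> R) : Prop :=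
  forall (i : 'I_N) x, f (x + delta_mx 0 i) = f x.

Definition torus_cell N : set 'rV[R]_N := [set x | forall i, 0 <= x 0 i < 1].

Arguments torus_cell : clear implicits.

Lemma lebesgue_torus_cell N : lebesgue_rV N (torus_cell N) = 1%E.
Proof.
rewrite [LHS](_ : _ = (\prod_(i < N) lebesgue_measure `[0%R, 1%R[%classic)%E).
  rewrite big1// => i _.
  by rewrite lebesgue_measure_itv/= lte_fin ltr01 oppr0 adde0.
by rewrite -(@lebesgue_rV_box R N (fun=> `[0, 1[%classic)).
Qed.

Definition QT N (T : R) : set (measurableTypeR R * 'rV[R]_N) :=
  `[0, T[%classic `*` torus_cell N.

Definition QT_closure N (T : R) : set (R * 'rV[R]_N) :=
  `[0, T]%classic `*` [set: 'rV[R]_N].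

Arguments QT : clear implicits.
Arguments QT_closure : clear implicits.

Definition QT_measure N :
    {measure set (measurableTypeR R * 'rV[R]_N) -> \bar R} :=
  (lebesgue_measure \x lebesgue_rV N)%E.

(* f \_ D is f extended by 0 outside D: the values of f outside D are
   irrelevant. *)
Definition Lp_on d (X : measurableType d) (mu : {measure set X -> \bar R})
    (D : set X) (p : R) (f : X -> R) : Prop :=
  f \_ D \in Lfun mu p%:E.

Definition Lp_torus N (p : R) (f : 'rV[R]_N -> R) : Prop :=
  Lp_on (lebesgue_rV N) (torus_cell N) p f.

Definition Lp_QT N (T p : R) (f : R * 'rV[R]_N -> R) : Prop :=
  Lp_on (QT_measure N) (QT N T) p f.

Definition integral_torus N (f : 'rV[R]_N -> R) : R :=
  \int[lebesgue_rV N]_(x in torus_cell N) f x.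

Definition integral_QT N (T : R) (f : R * 'rV[R]_N -> R) : R :=
  \int[QT_measure N]_(p in QT N T) f p.

(* convolution in the space variable only *)
Definition space_conv N (u : R * 'rV[R]_N -> R) (rho : 'rV[R]_N -> R)
    (p : R * 'rV[R]_N) : R :=
  integral_torus (fun y => u (p.1, y) * rho (p.2 - y)).

Definition iter_derive (V : normedModType R) (f : V -> R) (vs : seq V) :
  V -> R := foldr (fun v g => 'D_v g) f vs.

Definition smooth (V : normedModType R) (f : V -> R) : Prop :=
  forall (vs : seq V) (x : V), differentiable (iter_derive f vs) x.

Definition time_derive N (phi : R * 'rV[R]_N -> R) : R * 'rV[R]_N -> R :=
  'D_(1, 0) phi.

Definition laplacian N (phi : R * 'rV[R]_N -> R) (p : R * 'rV[R]_N) : R :=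
  \sum_(i < N) iter_derive phi [:: (0, delta_mx 0 i); (0, delta_mx 0 i)] p.

(* The restrictions to [0, T) x torus of these functions are the smooth
   functions with compact support in [0, T) x torus: smoothness up to t = 0
   means that phi extends smoothly to negative times, and, the torus being
   compact, the support is compact iff it avoids some [s, T) with s < T. *)
Definition test_function N (T : R) (phi : R * 'rV[R]_N -> R) : Prop :=
  [/\ smooth phi,
      (forall t, torus_periodic (fun x => phi (t, x))) &
      exists2 s, s < T & forall t x, s <= t -> phi (t, x) = 0].

(* z is a distributional solution on Q_T of d_t z - Delta (mu z) = G with
   z(0, .) = z0; the first three clauses are the conditions on the data under
   which this notion is defined. *)
Definition weak_solution N (T : R) (mu G : R * 'rV[R]_N -> R)
    (z0 : 'rV[R]_N -> R) (z : R * 'rV[R]_N -> R) : Prop :=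
  [/\ Lp_QT T 1 G, Lp_torus 1 z0 &
      measurable_fun (QT N T) (mu : measurableTypeR R * 'rV[R]_N -> R)] /\
  [/\ Lp_QT T 1 z, Lp_QT T 1 (fun p => z p * mu p) &
      forall phi, test_function T phi ->
        - integral_QT T (fun p => z p * (time_derive phi p + mu p * laplacian phi p)) =
        integral_torus (fun x => z0 x * phi (0, x)) +
        integral_QT T (fun p => G p * phi p)].

End torus.

Arguments torus_cell {R} N.
Arguments QT {R} N T.
Arguments QT_closure {R} N T.
Arguments QT_measure {R} N.

Lemma tail_ord_proof (n : nat) (i : 'I_n) (j : 'I_(n - i.+1)) : (i.+1 + j < n)%N.
Proof. by rewrite -ltn_subRL; exact: ltn_ord. Qed.

Definition tail_ord (n : nat) (i : 'I_n) (j : 'I_(n - i.+1)) : 'I_n :=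
  Ordinal (tail_ord_proof j).
Arguments tail_ord {n} i j.

(* Main.v *)
(* The system is discretised by an explicit Euler scheme in time, the Laplacian
   being replaced by the difference operator [lap h] acting on functions of a
   continuous space variable.  Under a CFL condition the scheme preserves
   non-negativity and controls the masses by Gronwall; since the kernels are
   smooth, the convolutions [u_j * rho_j] are then bounded and equi-Lipschitz.
   A discrete duality estimate bounds [u_i] in [L^2(Q_T)] in terms of the
   [L^2] norm of the initial datum only.

   The coefficients depend on the solution only through the convolutions, which
   have a uniform cluster point [w].  With [w] fixed the limit problem is
   linear, so convex combinations of the approximations remain approximate
   solutions; chosen to be Cauchy in [L^2(Q_T)], they converge strongly to a
   solution [z] of the linear problem with coefficients frozen at [w].  Strong
   convergence yields [z_j * rho_j = w_j] at almost every time, and resetting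
   [z] to zero at the other times gives a solution of the nonlinear system. *)
Require Import Defs.
From mathcomp Require Import all_boot all_order all_algebra.
From mathcomp Require Import all_classical all_reals all_analysis.
From mathcomp Require Import measurable_realfun ring lra.

Set Implicit Arguments.
Unset Strict Implicit.
Unset Printing Implicit Defensive.

Import Order.TTheory GRing.Theory Num.Theory.
Import numFieldNormedType.Exports.

Local Open Scope classical_set_scope.
Local Open Scope ring_scope.

(** * Tonelli on restricted domains and shifts on the torus *)

(** The unknown stands under the Laplacian together with a coefficient that is merely continuous, so
    no gradient estimate is at hand and the [u_i] come with nothing better than an L^2 bound. Every
    nonlinearity, however, sees them through smooth convolutions, whose bounds and moduli of
    continuity depend on the masses alone; hence compactness is sought for these, at every time and
    point. The a priori bounds look circular: the rates are bounded because the masses are, the mass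
    estimate uses non-negativity, and non-negativity of an explicit step uses bounded rates. Taking
    the coefficients from the previous step turns the circle into an induction. The upper bound of
    [r_i] drives the growth of the mass and of the L^2 norm; its sub-affine growth enters the step
    restriction and the Lipschitz constant in time. The duality estimate tests the scheme with the
    time integral of the flux, and has no use for smoothness of the coefficients. The system
    involves convolutions computed slice by slice, while a slice of an L^2 function is controlled
    only at almost every time; this is what the final resetting repairs. *)

Section restricted_tonelli.
Context d1 d2 (T1 : measurableType d1) (T2 : measurableType d2) (R : realType).
Variables (m1 : {sigma_finite_measure set T1 -> \bar R}).
Variables (m2 : {sigma_finite_measure set T2 -> \bar R}).
Variables (D1 : set T1) (D2 : set T2) (f : T1 * T2 -> \bar R).
Hypotheses (mD1 : measurable D1) (mD2 : measurable D2).
Hypothesis mf : measurable_fun [set: T1 * T2] f.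
Hypothesis f0 : forall p, (0 <= f p)%E.

Let fD := f \_ (D1 `*` D2).

Let mfD : measurable_fun [set: T1 * T2] fD.
Proof.
apply/(measurable_restrictT _ _).1; first exact: measurableX.
exact: measurable_funS mf.
Qed.

Let fD0 p : (0 <= fD p)%E.
Proof. by rewrite /fD patchE; case: ifPn. Qed.

Let fDE x y : fD (x, y) = ((fun x => ((fun y => f (x, y)) \_ D2) y) \_ D1) x.
Proof.
by rewrite /fD !patchE/= in_setX/=; case: (x \in D1).
Qed.

Lemma restricted_tonelli1 :
  (\int[m1 \x m2]_(p in D1 `*` D2) f p =
   \int[m1]_(x in D1) \int[m2]_(y in D2) f (x, y))%E.
Proof.
rewrite integral_mkcond -/fD (fubini_tonelli1 _ mfD fD0) [RHS]integral_mkcond.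
apply: eq_integral => x _; rewrite /fubini_F/= patchE.
under eq_integral do rewrite fDE patchE.
by case: ifPn => xD1; [rewrite [RHS]integral_mkcond|rewrite integral0].
Qed.

Lemma restricted_tonelli2 :
  (\int[m1 \x m2]_(p in D1 `*` D2) f p =
   \int[m2]_(y in D2) \int[m1]_(x in D1) f (x, y))%E.
Proof.
rewrite integral_mkcond -/fD (fubini_tonelli2 _ mfD fD0) [RHS]integral_mkcond.
apply: eq_integral => y _; rewrite /fubini_G/= patchE.
case: ifPn => yD2; last first.
  rewrite integral0_eq// => x _; rewrite fDE patchE; case: ifPn => // _.
  by rewrite patchE (negbTE yD2).
rewrite [RHS]integral_mkcond; apply: eq_integral => x _.
by rewrite fDE !patchE yD2.
Qed.

End restricted_tonelli.

Section shift_invariance.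
Context {R : realType}.

Lemma lebesgue_shift (h : R) (A : set R) : measurable A ->
  pushforward lebesgue_measure
    ((fun t => t + h) : R -> measurableTypeR R) A = lebesgue_measure A.
Proof.
have mh : measurable_fun [set: R] ((fun t => t + h) : R -> measurableTypeR R).
  by apply: measurable_funD => //; exact: measurable_id.
move=> mA; apply/esym/lebesgue_measure_unique => //= _ [[a b] _ <-].
rewrite /pushforward [X in _ = lebesgue_measure X](_ : _ = `]a - h, b - h]%classic).
  rewrite !lebesgue_measure_itv/= !lte_fin ltrD2r.
  by case: ifPn => // _; rewrite -!EFinD; congr EFin; lra.
by apply/seteqP; split => t /=; rewrite !in_itv/= => /andP[? ?]; apply/andP; split; lra.
Qed.

(** The translate of the unit interval is cut at [1]; by periodicity the overhang [[1, 1 + h[]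
    carries the same integral as the missing piece [[0, h[]. *)
Lemma ge0_integral_periodic_shift (f : R -> \bar R) (h : R) :
  measurable_fun [set: R] f -> (forall t, 0 <= f t)%E ->
  (forall t, f (t + 1) = f t) -> 0 <= h <= 1 ->
  (\int[lebesgue_measure]_(t in `[0%R, 1%R[) f (t + h)%R =
   \int[lebesgue_measure]_(t in `[0%R, 1%R[) f t)%E.
Proof.
move=> mf f0 fp /andP[h0 h1].
have shift c (a b : R) :
    (\int[lebesgue_measure]_(t in `[a, b[) f (t + c)%R =
     \int[lebesgue_measure]_(t in `[(a + c)%R, (b + c)%R[) f t)%E.
  have -> : `[a, b[%classic =
      (fun t : R => t + c) @^-1` `[a + c, b + c[%classic.
    by apply/seteqP; split => t /=; rewrite !in_itv/= => /andP[? ?]; apply/andP; split; lra.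
  have mc : measurable_fun [set: measurableTypeR R]
      ((fun t => t + c) : measurableTypeR R -> measurableTypeR R).
    by apply: measurable_funD => //; exact: measurable_id.
  rewrite -(@ge0_integral_pushforward _ _ (measurableTypeR R)
    (measurableTypeR R) R _ mc lebesgue_measure `[a + c, b + c[%classic f) //.
  - apply: eq_measure_integral => A mA _; exact: lebesgue_shift.
  - exact: measurable_funS mf.
rewrite shift add0r.
have split (a b c : R) : a <= b -> b <= c ->
   (\int[lebesgue_measure]_(t in `[a, c[) f t =
    \int[lebesgue_measure]_(t in `[a, b[) f t +
    \int[lebesgue_measure]_(t in `[b, c[) f t)%E.
  move=> ab bc; rewrite -ge0_integral_setU//.
  - congr integral; apply/seteqP; split => t /=; rewrite !in_itv/=.
      by move=> /andP[-> ->]; case: (ltrP t b); [left|right].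
    by move=> [|] /andP[? ?]; apply/andP; split; lra.
  - exact: measurable_funS mf.
  - apply/disj_setPS => t /= [] /=; rewrite !in_itv/= => /andP[_ tb] /andP[].
    by rewrite leNgt tb.
rewrite (split h 1)//; last by lra.
rewrite (split 0 h 1)// addeC; congr (_ + _)%E.
have := shift 1 0 h; rewrite add0r (addrC h) => <-.
by apply: eq_integral => t _; rewrite fp.
Qed.

End shift_invariance.

Section torus_integral.
Context {R : realType}.

Lemma measurable_torus_cell N : measurable (@torus_cell R N).
Proof.
rewrite (_ : torus_cell N =
  [set v : 'rV[R]_N | forall i, (fun=> `[0, 1[%classic) i (v 0 i)]).
  apply: (@measurable_box R N (fun=> `[0, 1[%classic)) => i.
  exact: measurable_itv.
by apply/seteqP; split => v /= + i => /(_ i); rewrite in_itv.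
Qed.

Lemma measurable_shift_rV N (w : 'rV[R]_N) :
  measurable_fun [set: 'rV[R]_N] (fun x => x + w).
Proof.
apply: measurable_fun_coordP => i; under eq_fun do rewrite mxE.
by apply: measurable_funD => //; exact: measurable_coord.
Qed.

Lemma ge0_integral_cellS n (F : 'rV[R]_n.+1 -> \bar R) :
  measurable_fun [set: 'rV[R]_n.+1] F -> (forall x, 0 <= F x)%E ->
  (\int[lebesgue_rV n.+1]_(x in torus_cell n.+1) F x =
   \int[(lebesgue_measure \x lebesgue_rV n)%E]_(p in `[0%R, 1%R[%classic `*` torus_cell n)
     F (cons_rV p))%E.
Proof.
move=> mF F0; have mc := @measurable_cons_rV R n.
rewrite [LHS](@ge0_integral_pushforward _ _ _ _ R _ mc
  (lebesgue_measure \x lebesgue_rV n)%E (torus_cell n.+1)) //.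
- congr integral; apply/seteqP; split => -[t v] /=.
    move=> tv; split=> [|i].
      by have := tv ord0; rewrite /= in_itv/= mxE unlift_none.
    by have := tv (lift ord0 i); rewrite mxE liftK.
  move=> [t01 v01] i; rewrite mxE; case: unliftP => [j _|_]/=; [exact: v01|by rewrite in_itv/= in t01].
- exact: measurable_torus_cell.
- exact: measurable_funS mF.
Qed.

(** Induction on the dimension: Tonelli isolates the first coordinate, and the shift acts either on
    it, where the one-dimensional result applies, or on the others, where the induction hypothesis
    does. The variable being shifted is integrated innermost in both cases. *)
Lemma ge0_integral_cell_shift N (i : 'I_N) (h : R) (F : 'rV[R]_N -> \bar R) :
  measurable_fun [set: 'rV[R]_N] F -> (forall x, 0 <= F x)%E ->
  (forall x, F (x + delta_mx 0 i) = F x) -> 0 <= h <= 1 ->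
  (\int[lebesgue_rV N]_(x in torus_cell N) F (x + h *: delta_mx 0 i)%R =
   \int[lebesgue_rV N]_(x in torus_cell N) F x)%E.
Proof.
elim: N i F => [[]//|n IHn] i F mF F0 Fp h01.
have mcell := @measurable_torus_cell n.
have mc := @measurable_cons_rV R n.
have m01 : measurable (`[0%R, 1%R[%classic : set (measurableTypeR R)).
  exact: measurable_itv.
have mFs : measurable_fun [set: 'rV[R]_n.+1]
    (fun x => F (x + h *: delta_mx 0 i)).
  exact: (measurableT_comp mF (measurable_shift_rV _)).
have mFc : measurable_fun [set: measurableTypeR R * 'rV[R]_n] (F \o @cons_rV R n).
  exact: measurableT_comp.
have mFsc : measurable_fun [set: measurableTypeR R * 'rV[R]_n]
    (fun p => F (cons_rV p + h *: delta_mx 0 i)).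
  exact: (measurableT_comp mFs mc).
rewrite !ge0_integral_cellS//.
have [j ij|ij] := unliftP ord0 i.
  have consD (t c : R) v : cons_rV (t, v) + c *: delta_mx 0 i =
      cons_rV (t, v + c *: delta_mx 0 j).
    apply/rowP => k; rewrite !mxE eqxx/= ij; case: unliftP => [l ->|->] /=.
      by rewrite !mxE eqxx/= (inj_eq lift_inj).
    by rewrite ?(negbTE (neq_lift _ _)) mulr0 addr0.
  rewrite (restricted_tonelli1 lebesgue_measure (lebesgue_rV n) m01 mcell mFsc (fun p => F0 _)).
  rewrite (restricted_tonelli1 lebesgue_measure (lebesgue_rV n) m01 mcell mFc (fun p => F0 _)).
  apply: eq_integral => t _.
  under eq_integral do rewrite consD.
  apply: (IHn j (fun v => F (cons_rV (t, v)))) => //.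
    exact: (measurableT_comp mFc (pair1_measurable _)).
  by move=> v; rewrite -[delta_mx 0 j]scale1r -consD scale1r Fp.
have consD (t c : R) v : cons_rV (t, v) + c *: delta_mx 0 i = cons_rV (t + c, v).
  apply/rowP => k; rewrite !mxE eqxx/= ij; case: unliftP => [l ->|->] /=.
    by rewrite ?(negbTE (neq_lift _ _)) mulr0 addr0.
  by rewrite mulr1.
rewrite (restricted_tonelli2 lebesgue_measure (lebesgue_rV n) m01 mcell mFsc (fun p => F0 _)).
rewrite (restricted_tonelli2 lebesgue_measure (lebesgue_rV n) m01 mcell mFc (fun p => F0 _)).
apply: eq_integral => v _.
under eq_integral do rewrite consD.
apply: (@ge0_integral_periodic_shift R (fun t => F (cons_rV (t, v)))) => //.
  exact: (measurableT_comp mFc (pair2_measurable _)).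
by move=> t; rewrite -consD scale1r Fp.
Qed.

Lemma integral_torus_shift N (i : 'I_N) (h : R) (f : 'rV[R]_N -> R) :
  measurable_fun [set: 'rV[R]_N] f -> torus_periodic f -> 0 <= h <= 1 ->
  integral_torus (fun x => f (x + h *: delta_mx 0 i)) = integral_torus f.
Proof.
move=> mf fp h01; rewrite /integral_torus /Rintegral; congr fine.
have shift (F : 'rV[R]_N -> \bar R) := @ge0_integral_cell_shift N i h F.
rewrite integralE [RHS]integralE; congr (_ - _)%E.
  rewrite -[RHS](shift _ _ _ _ h01) => //.
  - by apply: eq_integral => x _; rewrite !funeposE.
  - by apply: measurable_funepos; exact/measurable_EFinP.
  - by move=> x; rewrite !funeposE /= fp.
rewrite -[RHS](shift _ _ _ _ h01) => //.
- by apply: eq_integral => x _; rewrite !funenegE.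
- by apply: measurable_funeneg; exact/measurable_EFinP.
- by move=> x; rewrite !funenegE /= fp.
Qed.

End torus_integral.

(** * Bounded measurable functions *)

Section gluing.
Context d d' (Y : measurableType d) (Z : measurableType d').

(** Countably many pieces, selected by the measurable level sets of [c]. Serves for functions of
    grid cells and for functions assembled from time steps. *)
Lemma measurable_fun_glue (K : countType) (c : Y -> K) (D : set Y)
    (f : K -> Y -> Z) :
  (forall k, measurable (D `&` c @^-1` [set k])) ->
  (forall k, measurable_fun D (f k)) ->
  measurable_fun D (fun y => f (c y) y).
Proof.
move=> mc mf mD B mB.
rewrite (_ : _ `&` _ = \bigcup_k ((D `&` c @^-1` [set k]) `&` (D `&` f k @^-1` B))).
  apply: countable_bigcupT_measurable; first exact: countableP.
  by move=> k; apply: measurableI => //; exact: mf.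
apply/seteqP; split => [y [Dy By]|y [k _ [[Dy <-]] []]] //.
by exists (c y).
Qed.

End gluing.

(** * Rounding to grids, and measurability of continuous composites *)

Section discretization.
Context {R : realType}.

(** Rounding downwards keeps a time of [[0, T]] inside [[0, T]], where the coefficients are known to
    be continuous. *)
Definition disc (m : nat) (s : R) : R := (Num.floor (s * m.+1%:R))%:~R / m.+1%:R.

Lemma disc_le m s : disc m s <= s.
Proof. by rewrite /disc ler_pdivrMr ?ltr0n// Num.Theory.floor_le. Qed.

Lemma disc_gt m s : s - m.+1%:R^-1 < disc m s.
Proof.
rewrite /disc ltr_pdivlMr ?ltr0n// mulrBl mulVf ?pnatr_eq0// ltrBlDr.
by have /andP[_] := Num.Theory.floor_itv (s * m.+1%:R); rewrite intrD.
Qed.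

Lemma disc_ge0 m s : 0 <= s -> 0 <= disc m s.
Proof.
move=> s0; rewrite /disc divr_ge0// ler0z Num.Theory.floor_ge0.
by rewrite mulr_ge0.
Qed.

Lemma near_disc (e : R) : 0 < e ->
  \forall m \near \oo, forall s, ball s e (disc m s).
Proof.
move=> e0; near=> m => s; rewrite /ball/= ger0_norm ?subr_ge0 ?disc_le//.
rewrite ltrBlDl -ltrBlDr; apply: le_lt_trans (disc_gt m s).
rewrite lerD2l lerN2; near: m.
by apply: filterS (near_infty_natSinv_lt (PosNum e0)) => m /= /ltW.
Unshelve. all: by end_near. Qed.

Lemma measurable_floor_fiber d (Y : measurableType d) (D : set Y) (g : Y -> R)
    (m : nat) (z : int) : measurable D -> measurable_fun D g ->
  measurable (D `&` [set y | Num.floor (g y * m.+1%:R) = z]).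
Proof.
move=> mD mg.
have -> : D `&` [set y | Num.floor (g y * m.+1%:R) = z] =
    D `&` (fun y => g y * m.+1%:R) @^-1` `[z%:~R, (z + 1)%:~R[%classic.
  apply/seteqP; split => y [Dy] /=; rewrite in_itv/= => H; split => //.
    by move/eqP: H; rewrite Num.Theory.floor_eq.
  by apply/eqP; rewrite Num.Theory.floor_eq.
have mgm : measurable_fun D (fun y => g y * m.+1%:R) by exact: measurable_funM.
by apply: mgm => //; exact: measurable_itv.
Qed.

(** The sigma-algebra on row vectors is generated by the coordinates and [f] is continuous only
    relative to a slab. With the arguments rounded to a grid, the composite takes one value on each
    of countably many measurable pieces, and it converges pointwise to the original by
    continuity. *)
Lemma measurable_continuous_comp (N k : nat) (T : R)
    (f : (R * 'rV[R]_N) * 'rV[R]_k -> R)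
    d (Y : measurableType d) (D : set Y) (t : Y -> R) (x : Y -> 'rV[R]_N)
    (y : Y -> 'rV[R]_k) :
  measurable D -> {within QT_closure N T `*` setT, continuous f} ->
  (forall z, D z -> 0 <= t z <= T) ->
  measurable_fun D t -> (forall i, measurable_fun D (fun z => x z 0 i)) ->
  (forall i, measurable_fun D (fun z => y z 0 i)) ->
  measurable_fun D (fun z => f ((t z, x z), y z)).
Proof.
move=> mD cf t0T mt mx my.
(* [c] codes the grid cell by integers, a countable type as [measurable_fun_glue] requires; [e]
   decodes it into the lower corner of the cell. *)
pose c m z : int * 'rV[int]_N * 'rV[int]_k :=
  ((Num.floor (t z * m.+1%:R), \row_i Num.floor (x z 0 i * m.+1%:R)),
   \row_i Num.floor (y z 0 i * m.+1%:R)).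
pose e (m : nat) (q : int * 'rV[int]_N * 'rV[int]_k) : (R * 'rV[R]_N) * 'rV[R]_k :=
  ((q.1.1%:~R / m.+1%:R, \row_i ((q.1.2 0 i)%:~R / m.+1%:R)),
   \row_i ((q.2 0 i)%:~R / m.+1%:R)).
apply: (@measurable_fun_cvg _ _ _ D (fun m z => f (e m (c m z)))) => [m|z Dz].
  apply: (@measurable_fun_glue _ _ _ _ _ (c m) D (fun q _ => f (e m q))) => q.
    have -> : D `&` c m @^-1` [set q] =
        (D `&` [set z | Num.floor (t z * m.+1%:R) = q.1.1]) `&`
        ((D `&` \bigcap_(i in [set: 'I_N])
            (D `&` [set z | Num.floor (x z 0 i * m.+1%:R) = q.1.2 0 i])) `&`
        (D `&` \bigcap_(i in [set: 'I_k])
            (D `&` [set z | Num.floor (y z 0 i * m.+1%:R) = q.2 0 i]))).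
      apply/seteqP; split => z.
        move=> [Dz <-]; split; first by split.
        by split; split => // i _; split => //=; rewrite mxE.
      move=> [[Dz qt] [[_ qx] [_ qy]]]; split => //=.
      case: q qt qx qy => [[q1 q2] q3] /= qt qx qy; rewrite /c qt.
      congr ((_, _), _); apply/rowP => i; rewrite mxE.
        by have [] := qx i Logic.I.
      by have [] := qy i Logic.I.
    apply: measurableI; first exact: measurable_floor_fiber.
    by apply: measurableI; apply: measurableI => //;
      apply: fin_bigcap_measurable => // i _; exact: measurable_floor_fiber.
  exact: measurable_cst.
have Q : (QT_closure N T `*` setT) ((t z, x z), y z).
  by do 2!split => //=; rewrite in_itv/= t0T.
have := (subspace_continuousP _ f).1 cf _ Q.
apply: cvg_trans => A /nbhs_ballP[e' /= e'0 H].
suff : \forall m \near \oo, A (f (e m (c m z))) by [].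
near=> m; apply: (H (e m (c m z))); last first.
  do 2!split => //=; rewrite in_itv/=; have /andP[t0 tT] := t0T _ Dz.
  by rewrite (disc_ge0 _ t0) (le_trans (disc_le _ _) tT).
have dm : forall s, ball s e' (disc m s) by near: m; exact: near_disc.
split; first split => //=.
  by split => // i j; rewrite !mxE !ord1; exact: dm.
by split => // i j; rewrite !mxE !ord1; exact: dm.
Unshelve. all: by end_near. Qed.

End discretization.

Section bounded_measurable.
Context d (X : measurableType d) {R : realType} (D : set X).
Implicit Types f g : X -> R.

(** A class closed under the ring operations and integrable on measurable sets of finite measure, so
    that integrability follows from the shape of the integrand. *)
Definition bmf f := measurable_fun D f /\ exists C, forall x, D x -> `|f x| <= C.

Lemma bmf_cst c : bmf (fun=> c).
Proof. by split; [exact: measurable_cst|exists `|c|]. Qed.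

Lemma bmfD f g : bmf f -> bmf g -> bmf (fun x => f x + g x).
Proof.
move=> [mf [C Cf]] [mg [E Eg]]; split; first exact: measurable_funD.
exists (C + E) => x Dx; apply: (le_trans (ler_normD _ _)).
by apply: lerD; [exact: Cf|exact: Eg].
Qed.

Lemma bmfM f g : bmf f -> bmf g -> bmf (fun x => f x * g x).
Proof.
move=> [mf [C Cf]] [mg [E Eg]]; split; first exact: measurable_funM.
by exists (C * E) => x Dx; rewrite normrM; apply: ler_pM => //; [exact: Cf|exact: Eg].
Qed.

Lemma bmfN f : bmf f -> bmf (fun x => - f x).
Proof.
move=> [mf [C Cf]]; split; first exact: measurable_funN.
by exists C => x Dx; rewrite normrN; exact: Cf.
Qed.

Lemma bmfB f g : bmf f -> bmf g -> bmf (fun x => f x - g x).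
Proof. by move=> bf /bmfN; exact: bmfD. Qed.

Lemma bmf_sum (J : Type) (s : seq J) (P : pred J) (F : J -> X -> R) :
  (forall j, P j -> bmf (F j)) -> bmf (fun x => \sum_(j <- s | P j) F j x).
Proof.
move=> bF; elim: s => [|j s IHs].
  by rewrite (_ : (fun x => _) = fun=> 0); [exact: bmf_cst|apply/funext => x; rewrite big_nil].
rewrite (_ : (fun x => _) = fun x =>
  (if P j then F j x else 0) + \sum_(j <- s | P j) F j x).
  by apply: bmfD => //; case Pj: (P j); [exact: bF|exact: bmf_cst].
by apply/funext => x; rewrite big_cons; case: ifPn; rewrite ?add0r.
Qed.

Lemma bmf_integrable (mu : {measure set X -> \bar R}) f :
  measurable D -> (mu D < +oo)%E -> bmf f -> mu.-integrable D (EFin \o f).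
Proof.
move=> mD muD [mf [C Cf]]; apply: measurable_bounded_integrable => //.
exists C; split; first exact: num_real.
by move=> M CM x Dx; exact: le_trans (Cf _ Dx) (ltW CM).
Qed.

End bounded_measurable.

Lemma bmfS d (X : measurableType d) (R : realType) (A B : set X) (f : X -> R) :
  measurable B -> A `<=` B -> bmf B f -> bmf A f.
Proof.
move=> mB AB [mf [C Cf]]; split; first exact: measurable_funS mf.
by exists C => x /AB; exact: Cf.
Qed.

(** * The discrete Laplacian on the torus *)

Section torus_functions.
Context {R : realType} {N : nat}.
Implicit Types f g : 'rV[R]_N -> R.

Notation J := (@integral_torus R N).

(** Measurability and the bound hold on the whole space rather than on the cell, so that the
    translations in the difference operator preserve the class. *)
Definition tfun f := bmf [set: 'rV[R]_N] f /\ torus_periodic f.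

Lemma tfun_cst c : tfun (fun=> c).
Proof. by split; [exact: bmf_cst|]. Qed.

Lemma tfunD f g : tfun f -> tfun g -> tfun (fun x => f x + g x).
Proof.
by move=> [bf pf] [bg pg]; split; [exact: bmfD|move=> i x; rewrite pf pg].
Qed.

Lemma tfunM f g : tfun f -> tfun g -> tfun (fun x => f x * g x).
Proof.
by move=> [bf pf] [bg pg]; split; [exact: bmfM|move=> i x; rewrite pf pg].
Qed.

Lemma tfunZ c f : tfun f -> tfun (fun x => c * f x).
Proof. by move=> tf; apply: tfunM => //; exact: tfun_cst. Qed.

Lemma tfunB f g : tfun f -> tfun g -> tfun (fun x => f x - g x).
Proof.
by move=> [bf pf] [bg pg]; split; [exact: bmfB|move=> i x; rewrite pf pg].
Qed.

Lemma tfun_sum (K : Type) (s : seq K) (P : pred K) (F : K -> 'rV[R]_N -> R) :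
  (forall j, P j -> tfun (F j)) -> tfun (fun x => \sum_(j <- s | P j) F j x).
Proof.
move=> tF; split; first by apply: bmf_sum => j /tF[].
by move=> i x; apply: eq_bigr => j /tF[_ ->].
Qed.

Lemma tfun_shift w f : tfun f -> tfun (fun x => f (x + w)).
Proof.
move=> [[mf [C Cf]] pf]; split; last by move=> i x; rewrite addrAC pf.
split; last by exists C => x _; exact: Cf.
exact: (measurableT_comp mf (measurable_shift_rV _)).
Qed.

Lemma tfun_bounded f : tfun f -> exists2 C, 0 <= C & forall x, `|f x| <= C.
Proof.
move=> [[_ [C Cf]] _]; exists C => [|x]; last exact: Cf.
exact: le_trans (Cf 0 Logic.I).
Qed.

Lemma torus_cell_fin : (lebesgue_rV N (@torus_cell R N) < +oo)%E.
Proof. by rewrite lebesgue_torus_cell ltry. Qed.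

Lemma tfun_integrable f : tfun f ->
  (lebesgue_rV N).-integrable (torus_cell N) (EFin \o f).
Proof.
move=> [bf _]; apply: bmf_integrable.
- exact: measurable_torus_cell.
- exact: torus_cell_fin.
- exact: bmfS bf.
Qed.
Hint Resolve tfun_integrable : core.

Let mcell := @measurable_torus_cell R N.
Hint Resolve mcell : core.

Lemma integral_torusD f g : tfun f -> tfun g ->
  J (fun x => f x + g x) = J f + J g.
Proof. by move=> tf tg; rewrite /integral_torus RintegralD//; exact: tfun_integrable. Qed.

Lemma integral_torusB f g : tfun f -> tfun g ->
  J (fun x => f x - g x) = J f - J g.
Proof. by move=> tf tg; rewrite /integral_torus RintegralB//; exact: tfun_integrable. Qed.

Lemma integral_torusZ c f : tfun f -> J (fun x => c * f x) = c * J f.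
Proof. by move=> tf; rewrite /integral_torus RintegralZl//; exact: tfun_integrable. Qed.

Lemma integral_torus_cst c : J (fun=> c) = c.
Proof.
rewrite /integral_torus Rintegral_cst//.
have -> : fine (lebesgue_rV N (@torus_cell R N)) = 1.
  by rewrite (@lebesgue_torus_cell R N).
by rewrite mulr1.
Qed.

Lemma le_integral_torus f g : tfun f -> tfun g -> (forall x, f x <= g x) ->
  J f <= J g.
Proof. by move=> tf tg fg; apply: le_Rintegral => //; exact: tfun_integrable. Qed.

Lemma integral_torus_ge0 f : (forall x, 0 <= f x) -> 0 <= J f.
Proof. by move=> f0; apply: Rintegral_ge0. Qed.

Lemma eq_integral_torus f g : f =1 g -> J f = J g.
Proof. by move=> /funext ->. Qed.

Lemma norm_integral_torus f : tfun f -> `|J f| <= J (fun x => `|f x|).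
Proof. by move=> tf; apply: le_normr_Rintegral => //; exact: tfun_integrable. Qed.

Lemma integral_torus_sum (K : Type) (s : seq K) (P : pred K)
    (F : K -> 'rV[R]_N -> R) : (forall j, P j -> tfun (F j)) ->
  J (fun x => \sum_(j <- s | P j) F j x) = \sum_(j <- s | P j) J (F j).
Proof.
move=> tF; elim: s => [|j s IHs].
  rewrite big_nil -[RHS](integral_torus_cst 0).
  by apply: eq_integral_torus => x; rewrite big_nil.
rewrite big_cons -IHs; case Pj: (P j).
  rewrite -integral_torusD; [|exact: tF|exact: tfun_sum].
  by apply: eq_integral_torus => x; rewrite big_cons Pj.
by apply: eq_integral_torus => x; rewrite big_cons Pj.
Qed.

Lemma integral_torus_shiftr i (h : R) f : tfun f -> `|h| <= 1 ->
  J (fun x => f (x + h *: delta_mx 0 i)) = J f.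
Proof.
move=> tf; rewrite ler_norml => /andP[h1 h2].
have [h0|h0] := leP 0 h.
  by case: tf => -[mf _] pf; apply: integral_torus_shift => //; rewrite h0.
have [[mg _] pg] := tfun_shift (h *: delta_mx 0 i) tf.
rewrite -(@integral_torus_shift _ _ i (- h) (fun x => f (x + h *: delta_mx 0 i)))//.
  by apply: eq_integral_torus => x; rewrite -addrA -scalerDl addNr scale0r addr0.
by apply/andP; split; lra.
Qed.

Definition lap (h : R) f x : R :=
  \sum_(i < N) (f (x + h *: delta_mx 0 i) + f (x - h *: delta_mx 0 i) - 2 * f x)
    / h ^+ 2.

Let e h i : 'rV[R]_N := h *: delta_mx 0 i.

Lemma tfun_lap h f : tfun f -> tfun (lap h f).
Proof.
move=> tf; apply: tfun_sum => i _.
rewrite (_ : (fun x => _) = fun x => h ^- 2 *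
   (f (x + e h i) + f (x + - e h i) - 2 * f x)); last first.
  by apply/funext => x; rewrite mulrC.
apply: tfunZ; apply: tfunB; last exact: tfunZ.
by apply: tfunD; exact: tfun_shift.
Qed.

Lemma lapD h f g x : lap h (fun x => f x + g x) x = lap h f x + lap h g x.
Proof. by rewrite /lap -big_split/=; apply: eq_bigr => i _; ring. Qed.

Lemma lapZ h c f x : lap h (fun x => c * f x) x = c * lap h f x.
Proof. by rewrite /lap mulr_sumr; apply: eq_bigr => i _; ring. Qed.

Lemma lap_cst0 h x : lap h (fun=> 0) x = 0.
Proof. by rewrite /lap big1// => i _; rewrite mulr0 addr0 subr0 mul0r. Qed.

Section summation_by_parts.
Variables (h : R).
Hypothesis h01 : 0 < h <= 1.

Let hnorm : `|h| <= 1.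
Proof. by case/andP: h01 => h0 h1; rewrite ger0_norm// ltW. Qed.

Lemma integral_torus_shift_swap i f g : tfun f -> tfun g ->
  J (fun x => f x * g (x - h *: delta_mx 0 i)) =
  J (fun x => f (x + h *: delta_mx 0 i) * g x).
Proof.
move=> tf tg.
rewrite -(@integral_torus_shiftr i h (fun x => f x * g (x - e h i)))//.
  by apply: eq_integral_torus => x; rewrite addrK.
by apply: tfunM => //; exact: (tfun_shift (- e h i)).
Qed.

Let lap_term f g i : tfun f -> tfun g ->
  J (fun x => f x * ((g (x + e h i) + g (x - e h i) - 2 * g x) / h ^+ 2)) =
  (J (fun x => f x * g (x + e h i)) + J (fun x => f (x + e h i) * g x)
    - 2 * J (fun x => f x * g x)) / h ^+ 2.
Proof.
move=> tf tg; rewrite -integral_torus_shift_swap//.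
have tfp : tfun (fun x => f x * g (x + e h i)).
  by apply: tfunM => //; exact: tfun_shift.
have tfm : tfun (fun x => f x * g (x + - e h i)).
  by apply: tfunM => //; exact: tfun_shift.
have tfg : tfun (fun x => f x * g x) by exact: tfunM.
rewrite -integral_torusD// -integral_torusZ// -integral_torusB//; last 2 first.
  exact: tfunD.
  exact: tfunZ.
rewrite mulrC -integral_torusZ//; last by apply: tfunB; [exact: tfunD|exact: tfunZ].
by apply: eq_integral_torus => x; ring.
Qed.

(** Translation invariance turns the backward shift of [g] into a forward shift of [f]. The result
    is symmetric in [f] and [g], and for [f = g] it involves a single autocorrelation per direction;
    self-adjointness and the spectral bound both follow. *)
Lemma integral_mul_lap f g : tfun f -> tfun g ->
  J (fun x => f x * lap h g x) =
  \sum_(i < N) (J (fun x => f x * g (x + e h i)) +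
                J (fun x => f (x + e h i) * g x)
               - 2 * J (fun x => f x * g x)) / h ^+ 2.
Proof.
move=> tf tg; under eq_integral_torus do rewrite /lap mulr_sumr.
rewrite integral_torus_sum => [|i _].
  by apply: eq_bigr => i _; exact: lap_term.
apply: tfunM => //; rewrite (_ : (fun x => _) = fun x => h ^- 2 *
   (g (x + e h i) + g (x + - e h i) - 2 * g x)); last first.
  by apply/funext => x; rewrite mulrC.
apply: tfunZ; apply: tfunB; last exact: tfunZ.
by apply: tfunD; exact: tfun_shift.
Qed.

Lemma integral_lap_sym f g : tfun f -> tfun g ->
  J (fun x => f x * lap h g x) = J (fun x => lap h f x * g x).
Proof.
move=> tf tg; under [RHS]eq_integral_torus do rewrite mulrC.
rewrite !integral_mul_lap//; apply: eq_bigr => i _; congr (_ / _).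
have C u v : J (fun x => u x * v x) = J (fun x => v x * u x).
  by apply: eq_integral_torus => x; rewrite mulrC.
rewrite (C g (fun x => f (x + e h i))) (C (fun x => g (x + e h i)) f) (C g f).
by congr (_ - _); rewrite addrC.
Qed.

(** By Young and translation invariance the autocorrelation of [f] lies between [- J (f ^+ 2)] and
    [J (f ^+ 2)]; each of the [N] directions then contributes between [-4] and [0] times
    [J (f ^+ 2) / h ^+ 2]. *)
Lemma lap_energy f : tfun f ->
  - (4 * N%:R / h ^+ 2) * J (fun x => f x ^+ 2) <= J (fun x => f x * lap h f x) <= 0.
Proof.
move=> tf; rewrite integral_mul_lap//; have /andP[h0 _] := h01.
have h2 : 0 < h ^+ 2 by rewrite exprn_gt0.
set q := J (fun x => f x ^+ 2).
have tf2 : tfun (fun x => f x ^+ 2) by under eq_fun do rewrite expr2; exact: tfunM.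
have tfi i : tfun (fun x => f (x + e h i)) by exact: tfun_shift.
have bnd i : - q <= J (fun x => f x * f (x + e h i)) <= q.
  have tfi2 : tfun (fun x => f (x + e h i) ^+ 2).
    by under eq_fun do rewrite expr2; exact: tfunM.
  have tff : tfun (fun x => f x * f (x + e h i)) by exact: tfunM.
  have qi : J (fun x => f (x + e h i) ^+ 2) = q.
    by rewrite (@integral_torus_shiftr i h (fun x => f x ^+ 2)).
  have H2 : J (fun x => 2^-1 * (f x ^+ 2 + f (x + e h i) ^+ 2)) = q.
    rewrite integral_torusZ; last exact: tfunD.
    by rewrite integral_torusD// qi -/q; field.
  apply/andP; split.
    rewrite -[X in - X]H2 -mulN1r -integral_torusZ; last by apply: tfunZ; exact: tfunD.
    apply: le_integral_torus => //; first by do 2!apply: tfunZ; exact: tfunD.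
    move=> x; have := sqr_ge0 (f x + f (x + e h i)); rewrite sqrrD; lra.
  rewrite -[X in _ <= X]H2; apply: le_integral_torus => //.
    by apply: tfunZ; exact: tfunD.
  by move=> x; have := sqr_ge0 (f x - f (x + e h i)); rewrite sqrrB; lra.
have E i : J (fun x => f (x + e h i) * f x) = J (fun x => f x * f (x + e h i)).
  by apply: eq_integral_torus => x; rewrite mulrC.
have Eq : J (fun x => f x * f x) = q by apply: eq_integral_torus => x; rewrite expr2.
apply/andP; split.
  rewrite (_ : - _ * _ = \sum_(i < N) (- (4 * q / h ^+ 2))).
    apply: ler_sum => i _; rewrite -mulNr ler_pM2r ?invr_gt0// E ?Eq.
    by have /andP[? ?] := bnd i; lra.
  by rewrite sumr_const card_ord -mulr_natr; ring.
apply: sumr_le0 => i _; rewrite E ?Eq pmulr_lle0 ?invr_gt0//.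
by have /andP[? ?] := bnd i; lra.
Qed.

End summation_by_parts.

End torus_functions.

(** * The explicit Euler scheme for one species *)

Section euler_scheme.
Context {R : realType} {N : nat}.
Implicit Types f g : 'rV[R]_N -> R.

Notation J := (@integral_torus R N).

Variables (h : R).
Hypothesis h01 : 0 < h <= 1.

Let h2_gt0 : 0 < h ^+ 2.
Proof. by case/andP: h01 => h0 _; rewrite exprn_gt0. Qed.

Lemma tfun_sqr f : tfun f -> tfun (fun x => f x ^+ 2).
Proof. by move=> tf; under eq_fun do rewrite expr2; exact: tfunM. Qed.

(* Summing [y_(k+1) <= y_k + s lap w_k] gives [y_k <= y_0 + lap S_k], where
   [S_k] is the discrete time integral of [w]; testing with [w_k >= 0] makes
   the quadratic form [- J (S_k lap S_k)] appear as a telescoping energy. *)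
Lemma subsolution_l2_bound (y mu : nat -> 'rV[R]_N -> R) (s alpha beta : R) (K : nat) :
  0 < s -> 0 < alpha -> s * (4 * N%:R * beta) <= h ^+ 2 ->
  (forall k, (k < K)%N -> tfun (y k)) -> (forall k, (k < K)%N -> tfun (mu k)) ->
  (forall k x, (k < K)%N -> 0 <= y k x) ->
  (forall k x, (k < K)%N -> alpha <= mu k x <= beta) ->
  (forall k x, (k.+1 < K)%N ->
     y k.+1 x <= y k x + s * lap h (fun x => mu k x * y k x) x) ->
  \sum_(k < K) J (fun x => y k x ^+ 2) <=
    4 * K%:R * beta / alpha * J (fun x => y 0 x ^+ 2).
Proof.
move=> s0 alpha0 cfl ty tmu y0 mub ystep.
case: K => [|K] in ty tmu y0 mub ystep *.
  by rewrite big_ord0 mulr0 !mul0r.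
set w := fun k x => mu k x * y k x.
have tw k : (k < K.+1)%N -> tfun (w k) by move=> kK; apply: tfunM; [exact: tmu|exact: ty].
have beta0 : 0 < beta.
  by have /andP[a b] := mub 0%N 0 isT; apply: lt_le_trans alpha0 (le_trans a b).
have w0 k x : (k < K.+1)%N -> 0 <= w k x.
  move=> kK; rewrite mulr_ge0 ?y0//.
  by have /andP[a _] := mub k x kK; exact: le_trans (ltW alpha0) a.
pose S k x := \sum_(j < k) s * w j x.
have tS k : (k <= K.+1)%N -> tfun (S k).
  move=> kK; apply: tfun_sum => j _; apply: tfunZ; apply: tw.
  exact: leq_trans (ltn_ord j) kK.
have SS k x : S k.+1 x = S k x + s * w k x by rewrite /S big_ord_recr.
have yS k x : (k < K.+1)%N -> y k x <= y 0%N x + lap h (S k) x.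
  elim: k => [_|k IHk kK].
    rewrite (_ : S 0%N = fun=> 0) ?lap_cst0 ?addr0//.
    by apply/funext => z; rewrite /S big_ord0.
  apply: le_trans (ystep _ _ kK) _.
  rewrite (_ : S k.+1 = fun x => S k x + s * w k x); last exact/funext.
  by rewrite lapD lapZ addrA lerD2r IHk// ltnW.
pose E k := - J (fun x => S k x * lap h (S k) x).
have E0 k : (k <= K.+1)%N -> 0 <= E k.
  by move=> kK; rewrite oppr_ge0; have /andP[] := lap_energy h01 (tS _ kK).
set q := J (fun x => y 0%N x ^+ 2).
(* Testing [yS] with [w k] and multiplying by [2 * s] puts [2 * s * a] on the left. Of it, [s * a]
   pays for the quadratic term of the energy ([cb]) and [2^-1 * s * a] for the initial datum
   ([young]); the stated half is what remains. *)
have step k : (k < K.+1)%N ->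
    2^-1 * s * J (fun x => y k x * w k x) <= 2 * s * beta * q + (E k - E k.+1).
  move=> kK; have tk := ty _ kK; have twk := tw _ kK; have tSk := tS _ (ltnW kK).
  have t0 : tfun (y 0%N) by exact: ty.
  have tl f : tfun f -> tfun (lap h f) by exact: tfun_lap.
  have tyw : tfun (fun x => y k x * w k x) by exact: tfunM.
  set a := J (fun x => y k x * w k x).
  set b := J (fun x => w k x * lap h (S k) x).
  set c := J (fun x => w k x * lap h (w k) x).
  have ES : E k.+1 = E k - 2 * s * b - s ^+ 2 * c.
    have b' : J (fun x => S k x * lap h (w k) x) = b.
      by rewrite integral_lap_sym//; apply: eq_integral_torus => x; rewrite mulrC.
    have -> : E k.+1 = - J (fun x => (S k x * lap h (S k) x +
        s * (S k x * lap h (w k) x)) + (s * (w k x * lap h (S k) x) +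
        s ^+ 2 * (w k x * lap h (w k) x))).
      congr (- _); apply: eq_integral_torus => x.
      rewrite (_ : S k.+1 = fun x => S k x + s * w k x); last exact/funext.
      by rewrite lapD lapZ; ring.
    have t1 : tfun (fun x => S k x * lap h (S k) x) by apply: tfunM => //; exact: tl.
    have t2 : tfun (fun x => S k x * lap h (w k) x) by apply: tfunM => //; exact: tl.
    have t3 : tfun (fun x => w k x * lap h (S k) x) by apply: tfunM => //; exact: tl.
    have t4 : tfun (fun x => w k x * lap h (w k) x) by apply: tfunM => //; exact: tl.
    rewrite integral_torusD; [|by apply: tfunD => //; exact: tfunZ|
      by apply: tfunD; exact: tfunZ].
    rewrite integral_torusD//; last exact: tfunZ.
    rewrite integral_torusD//; [|exact: tfunZ..].
    by rewrite !integral_torusZ// b' /E -/b -/c; ring.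
  (* The step restriction acts here: combine the spectral bound [4 * N / h ^+ 2], the pointwise
     [w ^+ 2 <= beta * y * w], and [s * (4 * N * beta) <= h ^+ 2]. *)
  have cb : - c * s <= a.
    have /andP[cl _] := lap_energy h01 twk.
    have ww : J (fun x => w k x ^+ 2) <= beta * a.
      rewrite -integral_torusZ//; apply: le_integral_torus.
      - exact: tfun_sqr.
      - exact: tfunZ.
      - move=> x; rewrite expr2 mulrA ler_wpM2r ?w0//.
        by rewrite ler_wpM2r ?y0//; have /andP[] := mub k x kK.
    have a0 : 0 <= a by apply: integral_torus_ge0 => x; rewrite mulr_ge0 ?y0 ?w0.
    have W0 : 0 <= J (fun x => w k x ^+ 2) by apply: integral_torus_ge0 => x; exact: sqr_ge0.
    apply: (@le_trans _ _ (4 * N%:R / h ^+ 2 * J (fun x => w k x ^+ 2) * s)).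
      by rewrite ler_wpM2r ?(ltW s0)// lerNl -mulNr.
    apply: (@le_trans _ _ (4 * N%:R / h ^+ 2 * (beta * a) * s)).
      rewrite ler_wpM2r ?(ltW s0)// ler_wpM2l//.
      by rewrite divr_ge0 ?(ltW h2_gt0)// mulr_ge0.
    rewrite (_ : _ * s = s * (4 * N%:R * beta) / h ^+ 2 * a); last by ring.
    by rewrite ler_piMl// ler_pdivrMr// mul1r.
  have aw : a <= J (fun x => y 0%N x * w k x) + b.
    rewrite -integral_torusD; [|exact: tfunM|by apply: tfunM => //; exact: tl].
    apply: le_integral_torus => //.
      by apply: tfunD; apply: tfunM => //; exact: tl.
    by move=> x; have := ler_wpM2r (w0 k x kK) (yS k x kK); lra.
  have young : J (fun x => y 0%N x * w k x) <= 4^-1 * a + beta * q.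
    rewrite -integral_torusZ// -integral_torusZ; last exact: tfun_sqr.
    rewrite -integral_torusD; [|exact: tfunZ|by apply: tfunZ; exact: tfun_sqr].
    apply: le_integral_torus; first exact: tfunM.
      by apply: tfunD; apply: tfunZ => //; exact: tfun_sqr.
    (* Young with weight [mu]: expand [0 <= mu * (y / 2 - y_0) ^+ 2], then replace [mu] by [beta] in
       front of [y_0 ^+ 2]. *)
    move=> x; rewrite /w; have /andP[m1 m2] := mub k x kK.
    have m0 : 0 <= mu k x by exact: le_trans (ltW alpha0) m1.
    have : 0 <= mu k x * (2^-1 * y k x - y 0%N x) ^+ 2 by rewrite mulr_ge0 ?sqr_ge0.
    have : 0 <= (beta - mu k x) * y 0%N x ^+ 2 by rewrite mulr_ge0 ?sqr_ge0 ?subr_ge0.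
    by rewrite sqrrB; nra.
  rewrite ES.
  have H1 := ler_wpM2l (ltW s0) aw.
  have H2 := ler_wpM2l (ltW s0) young.
  have H3 := ler_wpM2l (ltW s0) cb.
  by nra.
have E00 : E 0%N = 0.
  rewrite /E (@eq_integral_torus _ _ _ (fun=> 0)) ?integral_torus_cst ?oppr0// => x.
  by rewrite [S 0%N x]big_ord0 mul0r.
have sumb k : (k <= K.+1)%N ->
    2^-1 * s * \sum_(j < k) J (fun x => y j x * w j x) <=
    2 * s * beta * q * k%:R - E k.
  elim: k => [_|k IHk kK]; first by rewrite big_ord0 E00 !mulr0 subr0.
  rewrite big_ord_recr/= mulrDr (_ : k.+1%:R = k%:R + 1 :> R) ?natr1//.
  by have := IHk (ltnW kK); have := step _ kK; lra.
have alphaJ : alpha * \sum_(k < K.+1) J (fun x => y k x ^+ 2) <=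
    \sum_(k < K.+1) J (fun x => y k x * w k x).
  rewrite mulr_sumr; apply: ler_sum => k _; have tk := ty _ (ltn_ord k).
  rewrite -integral_torusZ; last exact: tfun_sqr.
  apply: le_integral_torus.
  - by apply: tfunZ; exact: tfun_sqr.
  - by apply: tfunM => //; exact: tw.
  - move=> x; rewrite /w expr2 [leRHS]mulrCA ler_wpM2r ?mulr_ge0 ?y0//.
    by have /andP[] := mub k x (ltn_ord k).
rewrite -/q -(ler_pM2l alpha0) (_ : alpha * (_ * q) = 4 * beta * q * K.+1%:R); last first.
  by field; rewrite gt_eqF.
apply: (le_trans alphaJ).
rewrite -(ler_pM2l s0) -(ler_pM2l (_ : 0 < 2^-1 :> R)) ?invr_gt0//.
have := sumb _ (leqnn _); have := E0 _ (leqnn K.+1).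
set a := \sum_(k < K.+1) _; set b := K.+1%:R; set c := E K.+1.
rewrite -mulrA => c0 H; apply: (le_trans H); apply: (@le_trans _ _ (2 * s * beta * q * b)).
  by rewrite gerBl.
by rewrite le_eqVlt; apply/orP; left; apply/eqP; field.
Qed.

Section one_species.
Variables (z mu g : nat -> 'rV[R]_N -> R) (tau alpha beta : R).
Hypotheses (tau0 : 0 < tau) (alpha0 : 0 < alpha).
Hypothesis zE : forall k x, z k.+1 x =
  z k x + tau * lap h (fun x => mu k x * z k x) x + tau * (g k x * z k x).

(** Self-adjointness puts the difference operator on the test function. With [f] equal to [1], to a
    reflected kernel and to a test function at the next time, this yields the mass bound, the time
    regularity of the convolutions and the discrete weak form. *)
Lemma euler_test k f : tfun (z k) -> tfun (mu k) -> tfun (g k) -> tfun f ->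
  J (fun x => z k.+1 x * f x) = J (fun x => z k x * f x) +
    tau * J (fun x => z k x * (mu k x * lap h f x + g k x * f x)).
Proof.
move=> tz tmu tg tf.
have tmz : tfun (fun x => mu k x * z k x) by exact: tfunM.
have tgz : tfun (fun x => g k x * z k x) by exact: tfunM.
have tl := tfun_lap h tmz.
rewrite (@eq_integral_torus _ _ _ (fun x => z k x * f x +
  (tau * (lap h (fun x => mu k x * z k x) x * f x) + tau * (g k x * z k x * f x)))); last first.
  by move=> x; rewrite zE; ring.
rewrite integral_torusD; [|exact: tfunM|].
  rewrite integral_torusD; [|by apply: tfunZ; exact: tfunM..].
  rewrite !integral_torusZ; [|exact: tfunM..].
  rewrite -integral_lap_sym// -mulrDr -integral_torusD; [|by apply: tfunM => //; exact: tfun_lap|exact: tfunM].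
  by congr (_ + tau * _); apply: eq_integral_torus => x; ring.
by apply: tfunD; apply: tfunZ; exact: tfunM.
Qed.

Lemma euler_mass k M : 0 <= M -> tfun (z k) -> tfun (mu k) -> tfun (g k) ->
  (forall x, 0 <= z k x) -> (forall x, g k x <= M) ->
  J (z k.+1) <= (1 + tau * M) * J (z k).
Proof.
move=> M0 tz tmu tg z0 gM.
have t1 : tfun (fun _ : 'rV[R]_N => 1 : R) by exact: tfun_cst.
have := euler_test tz tmu tg t1.
rewrite (@eq_integral_torus _ _ (fun x => z k.+1 x * 1) (z k.+1)); last by move=> x; rewrite mulr1.
rewrite (@eq_integral_torus _ _ (fun x => z k x * 1) (z k)); last by move=> x; rewrite mulr1.
move=> ->; rewrite mulrDl mul1r lerD2l -mulrA ler_pM2l//.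
rewrite -integral_torusZ//; apply: le_integral_torus.
- apply: tfunM => //; apply: tfunD; first by apply: tfunM => //; exact: tfun_lap.
  exact: tfunM.
- exact: tfunZ.
- move=> x; rewrite mulr1 [lap h _ x](_ : _ = 0) ?mulr0 ?add0r 1?mulrC ?ler_wpM2r//.
  by rewrite /lap big1// => i _; rewrite mulr1 -mulr2n subrr mul0r.
Qed.

(** The neighbours enter the update with non-negative weights, and the weight of the centre is at
    least [1 - tau * (2 * N * beta / h ^+ 2 + L)]. *)
Lemma euler_ge0 k L : tau * (2 * N%:R * beta / h ^+ 2 + L) <= 1 ->
  (forall x, 0 <= z k x) -> (forall x, 0 <= mu k x <= beta) ->
  (forall x, - L <= g k x) -> forall x, 0 <= z k.+1 x.
Proof.
move=> cfl z0 mub gL x; rewrite zE /lap.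
have lb : - (2 * N%:R * beta / h ^+ 2) * z k x <= lap h (fun x => mu k x * z k x) x.
  rewrite (_ : - _ * _ = \sum_(i < N) (- (2 * (beta * z k x)) / h ^+ 2)); last first.
    by rewrite sumr_const card_ord -mulr_natr; ring.
  apply: ler_sum => i _; rewrite ler_pM2r ?invr_gt0//.
  have pos y : 0 <= mu k y * z k y by rewrite mulr_ge0//; have /andP[] := mub y.
  have := pos (x + h *: delta_mx 0 i); have := pos (x - h *: delta_mx 0 i).
  have : mu k x * z k x <= beta * z k x by rewrite ler_wpM2r//; have /andP[] := mub x.
  by lra.
have H1 := ler_wpM2l (ltW tau0) lb.
have H2 := ler_wpM2l (ltW tau0) (ler_wpM2r (z0 x) (gL x)).
have H3 := ler_wpM2r (z0 x) cfl.
rewrite -/(lap h (fun x => mu k x * z k x) x); lra.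
Qed.

(** Dividing by [th ^+ k] with [th = 1 + tau * M] absorbs the reaction and leaves a subsolution of
    the pure diffusion scheme with time step [tau / th]. Undoing the scaling in a square costs at
    most [th ^+ (2 * K)]. *)
Lemma euler_l2_bound (M : R) (K : nat) :
  0 <= M -> tau * (4 * N%:R * beta) <= h ^+ 2 -> 0 <= beta ->
  (forall k, (k < K)%N -> tfun (z k)) -> (forall k, (k < K)%N -> tfun (mu k)) ->
  (forall k x, (k < K)%N -> 0 <= z k x) ->
  (forall k x, (k < K)%N -> alpha <= mu k x <= beta) ->
  (forall k x, (k < K)%N -> g k x <= M) ->
  \sum_(k < K) tau * J (fun x => z k x ^+ 2) <=
    (1 + tau * M) ^+ (2 * K) * (4 * (tau * K%:R) * beta / alpha) *
      J (fun x => z 0 x ^+ 2).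
Proof.
move=> M0 cfl beta0 tz tmu z0 mub gM; set th := 1 + tau * M.
have tM : 0 <= tau * M by rewrite mulr_ge0// ltW.
have th1 : 1 <= th by rewrite /th lerDl.
have th0 : 0 < th by exact: lt_le_trans th1.
pose y k x := th ^- k * z k x.
have zy k x : z k x = th ^+ k * y k x.
  by rewrite /y mulrA divff ?mul1r// expf_neq0// gt_eqF.
have s0 : 0 < tau / th by rewrite divr_gt0.
have yb : \sum_(k < K) J (fun x => y k x ^+ 2) <=
    4 * K%:R * beta / alpha * J (fun x => y 0 x ^+ 2).
  apply: (@subsolution_l2_bound y mu (tau / th)) => //.
  - apply: le_trans cfl; rewrite ler_wpM2r ?mulr_ge0//.
    by rewrite ler_pdivrMr// ler_peMr// ltW.
  - by move=> k kK; apply: tfunZ; exact: tz.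
  - by move=> k x kK; rewrite mulr_ge0 ?z0// invr_ge0 exprn_ge0// ltW.
  - move=> k x kK; have kK' : (k < K)%N by exact: ltnW.
    rewrite -(ler_pM2l (exprn_gt0 k.+1 th0)) -zy zE.
    rewrite (_ : (fun x => mu k x * z k x) = fun x => th ^+ k * (mu k x * y k x)); last first.
      by apply/funext => x'; rewrite zy; ring.
    rewrite lapZ exprS mulrDr (_ : th * th ^+ k * (tau / th * _) =
       tau * (th ^+ k * lap h (fun x => mu k x * y k x) x)); last first.
      by field; rewrite gt_eqF.
    rewrite addrAC lerD2r -mulrA -zy /th mulrDl mul1r lerD2l -mulrA ler_pM2l//.
    by rewrite ler_wpM2r ?z0// gM.
apply: (@le_trans _ _ (th ^+ (2 * K) * tau * \sum_(k < K) J (fun x => y k x ^+ 2))).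
  rewrite mulr_sumr; apply: ler_sum => k _.
  rewrite (@eq_integral_torus _ _ _ (fun x => th ^+ (2 * k) * y k x ^+ 2)); last first.
    by move=> x; rewrite zy exprMn -exprM mulnC.
  rewrite integral_torusZ; last by apply: tfun_sqr; apply: tfunZ; exact: tz.
  rewrite mulrCA mulrA ler_wpM2r//.
    by apply: integral_torus_ge0 => x; exact: sqr_ge0.
  by rewrite ler_wpM2r ?(ltW tau0)// ler_weXn2l// leq_mul2l/= ltnW.
have E : J (fun x => y 0%N x ^+ 2) = J (fun x => z 0%N x ^+ 2).
  by apply: eq_integral_torus => x; rewrite zy expr0 mul1r.
rewrite -mulrA -[X in _ <= X]mulrA ler_wpM2l ?exprn_ge0 ?(ltW th0)//.
by rewrite -E; have := ler_wpM2l (ltW tau0) yb; congr (_ <= _); ring.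
Qed.

End one_species.

End euler_scheme.

(** * Compactness and difference quotients *)

Section compactness.
Context {R : realType}.

Lemma compact_unif_continuous (X : pseudoMetricType R) (K : set X) (f : X -> R) :
  compact K -> {within K, continuous f} ->
  forall e, 0 < e -> exists2 d, 0 < d &
    forall x y, K x -> K y -> ball x d y -> `|f x - f y| <= e.
Proof.
move=> cK cf e e0.
have := (compact_near_coveringP K).1 cK R (0^'+) (fun d x => K x ->
  forall y, K y -> ball x d y -> `|f x - f y| <= e) _.
have e20 : 0 < e / 2 by rewrite divr_gt0.
case=> [x Kx|d /= d0 H]; last first.
  exists (d / 2); first by rewrite divr_gt0.
  move=> x y Kx Ky xy; apply: (H (d / 2)) => //=; last by rewrite divr_gt0.
  by rewrite sub0r normrN gtr0_norm ?divr_gt0// ltr_pdivrMr// ltr_pMr// ltr1n.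
have /cvgrPdist_lt /(_ _ e20) := (subspace_continuousP _ f).1 cf x Kx.
move=> /nbhs_ballP[r /= r0 H].
have r20 : 0 < r / 2 by rewrite divr_gt0.
near=> x' d => Kx'.
have xx' : ball x (r / 2) x' by near: x'; exact: nbhsx_ballx.
have dr : d <= r / 2 by near: d; exact: nbhs_right_le.
move=> y Ky x'y; have xy : ball x r y.
  by rewrite (splitr r); apply: ball_triangle xx' _; apply: le_ball x'y.
have H1 := H _ xy Ky.
have H2 : `|f x - f x'| < e / 2.
  by apply: H Kx'; apply: le_ball xx'; rewrite ler_pdivrMr// ler_peMr ?ltW// ltr1n.
rewrite (_ : f x' - f y = (f x - f y) - (f x - f x')); last by ring.
by rewrite (le_trans (ler_normB _ _))// (splitr e) lerD// ltW.
Unshelve. all: by end_near. Qed.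

Lemma compact_bounded_fun (X : topologicalType) (K : set X) (f : X -> R) :
  compact K -> {within K, continuous f} -> exists C, forall x, K x -> `|f x| <= C.
Proof.
move=> cK cf; have /compact_bounded[M [_ Mf]] := continuous_compact cf cK.
exists (M + 1) => x Kx; apply: (Mf (M + 1)); first by rewrite ltrDl.
by exists x.
Qed.

Lemma compact_box N (a b : R) :
  compact [set x : 'rV[R]_N | forall i, a <= x 0 i <= b].
Proof.
rewrite (_ : mkset _ = [set x : 'rV[R]_N | forall i, (fun=> `[a, b]%classic) i (x ord0 i)]).
  by apply: (@rV_compact R N (fun=> `[a, b]%classic)) => i; exact: segment_compact.
by apply/seteqP; split => x /= + i => /(_ i); rewrite in_itv.
Qed.

(* A cluster point in the product topology approximates infinitely many terms
   on any finite set; the equicontinuity-type hypothesis [net] upgrades this to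
   all of [D]. *)
Lemma uniform_cluster (X : eqType) (D : set X) (F : nat -> X -> R) (W : R) :
  (forall n p, D p -> `|F n p| <= W) ->
  (forall e, 0 < e -> exists (G : finType) (net : G -> X) (n0 : nat),
     forall p, D p -> exists g, D (net g) /\
       forall n, (n0 <= n)%N -> `|F n p - F n (net g)| <= e) ->
  exists w : X -> R, forall e n, 0 < e -> exists k, (n <= k)%N /\
    forall p, D p -> `|F k p - w p| <= e.
Proof.
move=> FW net.
(* Off [D] the terms are set to [0], so that every coordinate of the product lies in the compact
   interval to which Tychonoff is applied. *)
pose F' n : forall p : X, R := fun p => if `[<D p>] then F n p else 0.
have F'E n p : D p -> F' n p = F n p by rewrite /F' => /asboolT ->.
have W0 : 0 <= `|W| by [].
have cK := @tychonoff X (fun=> R) (fun=> `[- `|W|, `|W|]%classic)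
  (fun=> @segment_compact R (- `|W|) `|W|).
have [|w [_ cw]] := cK (F' @ \oo) _.
  exists 0%N => // n _ p /=; rewrite in_itv/= -ler_norml.
  have [Dp|nDp] := pselect (D p); first by rewrite F'E// (le_trans (FW _ _ Dp))// ler_norm.
  by rewrite /F' asboolF// normr0.
have approx (G : finType) (net' : G -> X) e n : 0 < e -> exists2 k, (n <= k)%N &
    forall g, `|F' k (net' g) - w (net' g)| <= e.
  move=> e0.
  have nw : nbhs w [set u : forall p : X, R | forall g, `|w (net' g) - u (net' g)| < e].
    apply: (@filter_forall (forall p : X, R) G
      (fun g u => `|w (net' g) - u (net' g)| < e) (nbhs w)) => g.
    exact: (@proj_continuous X (fun=> R) (net' g) w _ (nbhsx_ballx (w (net' g)) e e0)).
  have nF : (F' @ \oo) (F' @` [set k | (n <= k)%N]).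
    by exists n => // k /= nk; exists k.
  have [u [[k nk <-] H]] := cw _ _ nF nw.
  by exists k => // g; rewrite distrC; exact: ltW.
exists w => e n e0.
(* Budget: moving [F k] from [p] to the net costs one fifth, comparing [F k] with [w] on the net one
   fifth, and moving [w] back to [p] three fifths, because that passes through an auxiliary term of
   the sequence at both points. *)
have e50 : 0 < e / 5 by rewrite divr_gt0.
have [G [net' [n0 H]]] := net _ e50.
have wnet p g : D p -> D (net' g) ->
    (forall n, (n0 <= n)%N -> `|F n p - F n (net' g)| <= e / 5) ->
    `|w p - w (net' g)| <= 3 * (e / 5).
  move=> Dp Dg Hg.
  have [k n0k Hk] := @approx bool (fun b => if b then p else net' g) _ n0 e50.
  have := Hk true; have := Hk false; rewrite !F'E//; have := Hg _ n0k.
  by rewrite !ler_norml => /andP[? ?] /andP[? ?] /andP[? ?]; apply/andP; split; lra.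
have [k nk Hk] := @approx G net' (e / 5) (maxn n n0) e50.
exists k; split; first by rewrite (leq_trans _ nk)// leq_maxl.
move=> p Dp; have [g [Dg Hg]] := H _ Dp.
have n0k : (n0 <= k)%N by rewrite (leq_trans _ nk)// leq_maxr.
have := wnet _ _ Dp Dg Hg; have := Hk g; have := Hg _ n0k; rewrite F'E//.
by rewrite !ler_norml => /andP[? ?] /andP[? ?] /andP[? ?]; apply/andP; split; lra.
Qed.

End compactness.

(** * Mean value estimates along a direction *)

Section taylor.
Context {R : realType} (V : normedModType R).
Implicit Types (f : V -> R) (x v : V).

Lemma is_derive_line f x v (s : R) : derivable f (x + s *: v) v ->
  is_derive s 1 (fun s : R => f (x + s *: v)) ('D_v f (x + s *: v)).
Proof.
move=> df.
have E : (fun h : R => h^-1 *: (f (x + (h *: (1 : R) + s) *: v) - f (x + s *: v))) =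
    (fun h : R => h^-1 *: (f (h *: v + (x + s *: v)) - f (x + s *: v))).
  apply/funext => h; congr (_ *: (f _ - _)).
  by rewrite -[h *: (1 : R)]/(h * 1) mulr1 scalerDl addrCA.
by split; rewrite /derivable /derive /= E.
Qed.

Lemma dir_mvt f x v (s : R) : (forall y, derivable f y v) -> 0 <= s ->
  exists2 c, 0 <= c <= s & f (x + s *: v) - f x = s * 'D_v f (x + c *: v).
Proof.
move=> df s0.
have [||c] := @MVT_segment R (fun s : R => f (x + s *: v))
  (fun s => 'D_v f (x + s *: v)) 0 s s0.
- by move=> c _; exact: is_derive_line.
- apply: continuous_subspaceT => c.
  by case: (is_derive_line (df (x + c *: v))) => /derivable1_diffP/differentiable_continuous.
- by rewrite in_itv/= => c0s; rewrite scale0r addr0 subr0 mulrC => ?; exists c.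
Qed.

(** The mean value theorem is applied to the symmetrised [G], then to ['D_v f] between [x - c *: v]
    and [x + c *: v], two points at parameter distance [2 * c <= 2 * h]: hence the factor [2]. *)
Lemma second_difference f x v (h l e : R) :
  (forall y, differentiable f y) -> (forall y, derivable ('D_v f) y v) ->
  0 <= h -> (forall s, `|s| <= h -> `|'D_v ('D_v f) (x + s *: v) - l| <= e) ->
  `|f (x + h *: v) + f (x - h *: v) - 2 * f x - h ^+ 2 * l| <= 2 * h ^+ 2 * e.
Proof.
move=> df ddf h0 H.
pose G (s : R) := f (x + s *: v) + f (x + s *: (- v)) - l * s ^+ 2.
have GE : G = ((fun s => f (x + s *: v)) + (fun s => f (x + s *: (- v)))) -
  l \*: ((@id R) ^+ 2) by [].
pose dG (s : R) := 'D_v f (x + s *: v) - 'D_v f (x - s *: v) - 2 * s * l.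
have dv y w : derivable f y w by exact: diff_derivable.
have DN y : 'D_(- v) f y = - 'D_v f y by rewrite !deriveE// linearN.
have iG (s : R) : is_derive s 1 G (dG s).
  have i1 := is_derive_line (dv (x + s *: v) v).
  have i2 := is_derive_line (dv (x + s *: - v) (- v)).
  rewrite GE; apply: is_derive_eq; rewrite /dG DN scalerN.
  congr (_ - _); rewrite expr1 /GRing.scale/= mulr1; ring.
have [|c] := @MVT_segment R G dG 0 h h0 (fun c _ => iG c).
  apply: continuous_subspaceT => c.
  by case: (iG c) => /derivable1_diffP/differentiable_continuous.
rewrite in_itv/= => /andP[c0 ch].
have -> : G h = f (x + h *: v) + f (x - h *: v) - h ^+ 2 * l.
  by rewrite /G scalerN (mulrC l).
have -> : G 0 = 2 * f x.
  by rewrite /G !scale0r !addr0 expr0n/= mulr0 subr0; ring.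
rewrite subr0 (_ : _ - _ - _ = f (x + h *: v) + f (x - h *: v) - 2 * f x - h ^+ 2 * l); last by ring.
move=> ->.
have [c' /andP[c'0 c'c]] := dir_mvt (x - c *: v) (ddf) (mulr_ge0 (ler0n R 2) c0).
have -> : x - c *: v + (2 * c) *: v = x + c *: v.
  by rewrite -addrA -scaleNr -scalerDl (_ : - c + 2 * c = c)//; ring.
have -> : x - c *: v + c' *: v = x + (c' - c) *: v.
  by rewrite -addrA -scaleNr -scalerDl (addrC (- c)).
move=> E; rewrite /dG E -mulrBr normrM (ger0_norm h0).
rewrite normrM ger0_norm ?mulr_ge0//.
have He : `|'D_v ('D_v f) (x + (c' - c) *: v) - l| <= e.
  by apply: H; rewrite ler_norml; apply/andP; split; lra.
have e0 : 0 <= e by exact: le_trans He.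
apply: (@le_trans _ _ (2 * h * e * h)); last by rewrite le_eqVlt; apply/orP; left; apply/eqP; ring.
rewrite ler_wpM2r// ler_pM ?mulr_ge0//.
by rewrite ler_wpM2l.
Qed.

End taylor.

(** * Periodic functions, kernels and test functions *)

Section periodicity.
Context {R : realType} {N : nat}.
Implicit Types (f : 'rV[R]_N -> R) (x : 'rV[R]_N).

Lemma torus_periodic_int f (z : 'I_N -> int) x : torus_periodic f ->
  f (x + \row_i (z i)%:~R) = f x.
Proof.
move=> pf.
have step i (n : int) y : f (y + n%:~R *: delta_mx 0 i) = f y.
  have nat_step (m : nat) y' : f (y' + m%:R *: delta_mx 0 i) = f y'.
    elim: m y' => [|m IHm] y'; first by rewrite scale0r addr0.
    by rewrite -natr1 scalerDl scale1r addrA pf IHm.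
  case: n => n; first by rewrite -pmulrn nat_step.
  rewrite NegzE -[in RHS](subrK (n.+1%:R *: delta_mx 0 i) y) nat_step.
  by rewrite mulrNz scaleNr -pmulrn.
rewrite [X in _ + X]row_sum_delta.
under eq_bigr do rewrite mxE.
elim: (index_enum _) x => [|i s IHs] x; first by rewrite big_nil addr0.
by rewrite big_cons addrA IHs step.
Qed.

Definition int_part x : 'rV[R]_N := \row_i (Num.floor (x 0 i))%:~R.
Definition frac_part x := x - int_part x.

Lemma frac_cell x : torus_cell N (frac_part x).
Proof.
move=> i; rewrite !mxE subr_ge0 Num.Theory.floor_le/= ltrBlDl.
by have /andP[_] := Num.Theory.floor_itv (x 0 i); rewrite intrD.
Qed.

Lemma periodic_subint f x y : torus_periodic f -> f (y - int_part x) = f y.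
Proof.
move=> pf; rewrite -[RHS](@torus_periodic_int f (fun i => - Num.floor (x 0 i)))//.
by congr f; apply/rowP => i; rewrite !mxE mulrNz.
Qed.

Lemma periodic_frac f x : torus_periodic f -> f (frac_part x) = f x.
Proof. exact: periodic_subint. Qed.

Lemma measurable_frac : measurable_fun [set: 'rV[R]_N] frac_part.
Proof.
apply: measurable_fun_coordP => i; under eq_fun do rewrite !mxE.
apply: measurable_funB; first exact: measurable_coord.
apply: (@measurableT_comp _ _ _ _ _ _ (fun s : R => (Num.floor s)%:~R : R)).
  apply: nondecreasing_measurable => //.
  by move=> a b ab; rewrite ler_int Num.Theory.le_floor.
exact: measurable_coord.
Qed.

Lemma frac_periodic i x : frac_part (x + delta_mx 0 i) = frac_part x.
Proof.
apply/rowP => j; rewrite !mxE; case: (_ && _) => /=; last by rewrite !addr0.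
rewrite Num.Theory.floorDrz ?rpred1// Num.Theory.floor1 intrD; ring.
Qed.

Lemma frac_id x : torus_cell N x -> frac_part x = x.
Proof.
move=> cx; apply/rowP => i; rewrite !mxE.
suff -> : Num.floor (x 0 i) = 0 by rewrite subr0.
by apply/eqP; rewrite Num.Theory.floor_eq; have := cx i; rewrite mulr0z.
Qed.

End periodicity.

Section continuous_measurability.
Context {R : realType} {N : nat}.

Lemma measurable_time_space_comp (T : R) (f : R * 'rV[R]_N -> R)
    d (Y : measurableType d) (D : set Y) (t : Y -> R) (x : Y -> 'rV[R]_N) :
  measurable D -> continuous f -> (forall z, D z -> 0 <= t z <= T) ->
  measurable_fun D t -> (forall i, measurable_fun D (fun z => x z 0 i)) ->
  measurable_fun D (fun z => f (t z, x z)).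
Proof.
move=> mD cf tT mt mx.
apply: (@measurable_continuous_comp R N 0 T (fun p => f p.1) _ _ _ _ _ (fun=> 0)) => //.
apply: continuous_subspaceT => p.
by apply: (@continuous_comp _ _ _ fst f); [exact: cvg_fst|exact: cf].
Qed.

Lemma continuous_measurable_rV (f : 'rV[R]_N -> R) : continuous f ->
  measurable_fun setT f.
Proof.
move=> cf; apply: (@measurable_time_space_comp 0 (fun p => f p.2) _ _ _ (fun=> 0) id) => //.
- by move=> p; apply: (@continuous_comp (R * 'rV[R]_N)%type _ _ snd f p);
    [exact: cvg_snd|exact: cf].
- by move=> z _; rewrite lexx.
- by move=> i; exact: measurable_coord.
Qed.

End continuous_measurability.

(** * Uniform bounds on a smooth periodic kernel *)

Section smooth_kernel.
Context {R : realType} {N : nat} (rho : 'rV[R]_N -> R).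
Hypotheses (srho : smooth rho) (prho : torus_periodic rho).

(** The closed unit cell with a margin of [1]: room for shifts of size [h <= 1], and for a second
    point at distance less than [1] from a point of the cell. *)
Let box := [set x : 'rV[R]_N | forall i, -1 <= x 0 i <= 2].

Let crho vs : continuous (iter_derive rho vs).
Proof. by move=> x; apply: differentiable_continuous; exact: srho. Qed.

Lemma smooth_periodic_tfun : tfun rho.
Proof.
split=> //; split.
  exact: continuous_measurable_rV (@crho [::]).
have [C HC] := compact_bounded_fun (@compact_box R N (-1) 2)
  (continuous_subspaceT (@crho [::])).
exists C => x _; rewrite -periodic_frac//; apply: HC => i /=.
by have /andP[? ?] := frac_cell x i; apply/andP; split; lra.
Qed.

Lemma smooth_kernel_refl x : tfun (fun y => rho (x - y)).
Proof.
have [[mrho [C HC]] _] := smooth_periodic_tfun.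
split; last first.
  by move=> i y; rewrite opprD addrA -[LHS](prho i) subrK.
split; last by exists C => y _; exact: HC.
apply: (measurableT_comp mrho); apply: measurable_fun_coordP => i.
under eq_fun do rewrite !mxE.
by apply: measurable_funB => //; exact: measurable_coord.
Qed.

Lemma lap_refl h x y : lap h (fun y => rho (x - y)) y = lap h rho (x - y).
Proof.
apply: eq_bigr => i _; congr (_ / _); rewrite [X in _ = X - _]addrC.
by congr (rho _ + rho _ - _); rewrite opprD ?opprK addrA.
Qed.

(** Uniformity in [h] is the point: it makes the Lipschitz constant in time of the convolutions
    independent of the mesh. It is [second_difference] with [l = 0], after translation to the unit
    cell. *)
Lemma smooth_kernel_lap_bounded : exists2 C, 0 <= C &
  forall h x, 0 < h <= 1 -> `|lap h rho x| <= C.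
Proof.
have /choice[C HC] : forall i : 'I_N, exists C, forall x, box x ->
    `|'D_(delta_mx 0 i) ('D_(delta_mx 0 i) rho) x| <= C.
  move=> i; apply: compact_bounded_fun; first exact: compact_box.
  by apply: continuous_subspaceT; exact: (@crho [:: delta_mx 0 i; delta_mx 0 i]).
exists (\sum_(i < N) 2 * `|C i|) => [|h x /andP[h0 h1]].
  by apply: sumr_ge0 => i _; rewrite mulr_ge0.
have -> : lap h rho x = lap h rho (frac_part x).
  apply: eq_bigr => i _; congr ((_ + _ - 2 * _) / _); last by rewrite periodic_frac.
    by rewrite /frac_part addrAC periodic_subint.
  by rewrite /frac_part addrAC periodic_subint.
apply: le_trans (ler_norm_sum _ _ _) _; apply: ler_sum => i _.
have := @second_difference R _ rho (frac_part x) (delta_mx 0 i) h 0 `|C i| (srho [::])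
  (fun y => @diff_derivable _ _ _ _ _ _ (srho [:: delta_mx 0 i] y)) (ltW h0) _.
rewrite mulr0 subr0 => H.
rewrite normrM normfV (ger0_norm (sqr_ge0 h)) ler_pdivrMr ?exprn_gt0// mulrAC.
apply: H => s sh; rewrite subr0; apply: le_trans (ler_norm _).
apply: HC => j; have := frac_cell x j; rewrite !mxE eqxx/= => /andP[c0 c1].
move: sh; rewrite ler_norml => /andP[s1 s2].
by case: (j == i); rewrite ?mulr1 ?mulr0 ?addr0; apply/andP; split; lra.
Qed.

Lemma smooth_kernel_unif e : 0 < e -> exists2 d, 0 < d &
  forall x y, ball x d y -> `|rho x - rho y| <= e.
Proof.
move=> e0; have [d d0 H] := compact_unif_continuous (@compact_box R N (-1) 2)
  (continuous_subspaceT (@crho [::])) e0.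
exists (Num.min d 1); first by rewrite lt_min d0/=.
move=> x y xy.
rewrite -(periodic_frac x prho) -(periodic_subint x y prho).
have [_ xyb] := xy.
have xyi i : `|x 0 i - y 0 i| < 1.
  by have := xyb 0 i; rewrite /ball/= lt_min => /andP[].
have c i := frac_cell x i.
apply: H => [i|i|].
- by have /andP[? ?] := c i; apply/andP; split; lra.
- have := c i; have := xyi i; rewrite !mxE ltr_norml => /andP[? ?] /andP[? ?].
  by apply/andP; split; lra.
- split=> // i j; rewrite !mxE ord1 /ball/=.
  have E (p q r : R) : p - r - (q - r) = p - q by ring.
  by rewrite E; have := xyb 0 j; rewrite /ball/= lt_min => /andP[].
Qed.

End smooth_kernel.

(** * Consistency of difference quotients on test functions *)

Section test_functions.
Context {R : realType} {N : nat} (T : R) (phi : R * 'rV[R]_N -> R).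
Hypothesis tphi : test_function T phi.

Let sphi : smooth phi. Proof. by case: tphi. Qed.
Let pphi t : torus_periodic (fun x => phi (t, x)). Proof. by case: tphi. Qed.

Let K : set (R * 'rV[R]_N) :=
  `[0, T]%classic `*` [set x : 'rV[R]_N | forall i, -1 <= x 0 i <= 2].

Let compactK : compact K.
Proof. apply: compact_setX; [exact: segment_compact|exact: compact_box]. Qed.

Let cell_K t x : 0 <= t <= T -> torus_cell N x -> K (t, x).
Proof.
move=> tT cx; split => /=; first by rewrite in_itv.
by move=> i; have /andP[? ?] := cx i; apply/andP; split; lra.
Qed.

Lemma test_function_continuous vs : continuous (iter_derive phi vs).
Proof. by move=> x; apply: differentiable_continuous; exact: sphi. Qed.
Let cphi := test_function_continuous.

Lemma test_function_end t x : T <= t -> phi (t, x) = 0.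
Proof. by case: tphi => _ _ [s sT H] Tt; apply: H; exact: le_trans (ltW sT) Tt. Qed.

Lemma test_function_tfun t : 0 <= t <= T -> tfun (fun x => phi (t, x)).
Proof.
move=> tT; split; last exact: pphi.
have cf : continuous (fun x => phi (t, x)).
  move=> x; apply: (@continuous_comp _ _ _ (fun x => (t, x)) phi).
    apply: (@cvg_pair _ _ _ (nbhs x) (nbhs t) (nbhs x) _ _ _ (fun=> t) id).
      exact: cvg_cst.
    exact: cvg_id.
  exact: (@cphi [::]).
split; first exact: continuous_measurable_rV.
have [C HC] := compact_bounded_fun compactK (continuous_subspaceT (@cphi [::])).
exists C => x _; rewrite -(periodic_frac x (pphi t)); apply: HC.
by apply: cell_K => //; exact: frac_cell.
Qed.

Lemma test_function_bounded vs : exists2 C, 0 <= C & forall t x, 0 <= t <= T ->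
  torus_cell N x -> `|iter_derive phi vs (t, x)| <= C.
Proof.
have [C HC] := compact_bounded_fun compactK (continuous_subspaceT (@cphi vs)).
exists `|C| => // t x tT cx; apply: le_trans (ler_norm _).
by apply: HC; exact: cell_K.
Qed.

Lemma test_function_unif e : 0 < e -> exists2 d, 0 < d & forall t t' x,
  0 <= t <= T -> 0 <= t' <= T -> `|t - t'| < d -> torus_cell N x ->
  `|phi (t, x) - phi (t', x)| <= e.
Proof.
move=> e0; have [d d0 H] := compact_unif_continuous compactK
  (continuous_subspaceT (@cphi [::])) e0.
exists d => // t t' x tT t'T tt' cx; apply: H; [exact: cell_K|exact: cell_K|].
by split => //; exact: ballxx.
Qed.

(** The derivative is taken at any time [t] of the step, since the weak form integrates over [t]
    while the scheme sees only the end points. *)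
Lemma time_derive_quotient e : 0 < e -> exists2 d, 0 < d & forall t1 t2 t x,
  0 <= t1 -> t1 < t2 -> t2 <= T -> t1 <= t <= t2 -> t2 - t1 < d ->
  torus_cell N x ->
  `|(phi (t2, x) - phi (t1, x)) / (t2 - t1) - time_derive phi (t, x)| <= e.
Proof.
move=> e0; have [d d0 H] := compact_unif_continuous compactK
  (continuous_subspaceT (@cphi [:: (1, 0)])) e0.
exists d => // t1 t2 t x t10 t12 t2T /andP[t1t tt2] t21 cx.
have [c /andP[c0 c21]] := @dir_mvt R _ phi (t1, x) (1, 0) (t2 - t1)
  (fun y => @diff_derivable _ _ _ _ _ _ (sphi [::] y)) ltac:(by rewrite subr_ge0 ltW).
have E s : (t1, x) + s *: (1, 0) = (t1 + s, x) :> R * 'rV[R]_N.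
  by congr pair; rewrite /= ?scaler0 ?addr0// /GRing.scale/= mulr1.
have E2 : t1 + (t2 - t1) = t2 by ring.
rewrite !E E2 => ->; rewrite mulrAC divff ?subr_eq0 ?gt_eqF// mul1r.
apply: H; [apply: cell_K => //; lra|apply: cell_K => //; lra|].
split; last exact: ballxx.
by rewrite /ball/= ltr_norml; apply/andP; split; lra.
Qed.

Lemma lap_laplacian e : 0 < e -> exists2 d, 0 < d & forall h t t' x,
  0 < h <= 1 -> h < d -> 0 <= t <= T -> 0 <= t' <= T -> `|t - t'| < d ->
  torus_cell N x ->
  `|lap h (fun x => phi (t', x)) x - laplacian phi (t, x)| <= e.
Proof.
move=> e0; pose v i : R * 'rV[R]_N := (0, delta_mx 0 i).
(* Each of the [N] directions contributes [2 * e'] by [second_difference]; [N.+1] keeps the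
   denominator positive. *)
pose e' := e / (2 * N.+1%:R).
have e'0 : 0 < e' by rewrite divr_gt0// mulr_gt0.
have : \forall d \near 0^'+, forall i : 'I_N, forall p q, K p -> K q ->
    ball p d q -> `|iter_derive phi [:: v i; v i] p - iter_derive phi [:: v i; v i] q| <= e'.
  apply: (@filter_forall R _ (fun i d => forall p q, K p -> K q ->
    ball p d q -> `|iter_derive phi [:: v i; v i] p - iter_derive phi [:: v i; v i] q| <= e') (0^'+)) => i.
  have [d d0 H] := compact_unif_continuous compactK
    (continuous_subspaceT (@cphi [:: v i; v i])) e'0.
  near=> d' => p q Kp Kq pq; apply: H => //; apply: le_ball pq.
  by near: d'; exact: nbhs_right_le.
move=> /(filterI (nbhs_right_gt 0))/filter_ex[d [d0 H]].
exists d => // h t t' x /andP[h0 h1] hd tT t'T tt' cx.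
rewrite /lap /laplacian -sumrB.
apply: le_trans (ler_norm_sum _ _ _) _.
apply: (@le_trans _ _ (\sum_(i < N) 2 * e')); last first.
  rewrite sumr_const card_ord -[_ *+ N]mulr_natr /e'.
  have : N%:R <= N.+1%:R :> R by rewrite ler_nat.
  have : 0 < N.+1%:R :> R by rewrite ltr0n.
  move: (N.+1%:R : R) (N%:R : R) => c n c0 nc.
  rewrite (_ : _ * _ = e * (n / c)); last by field; rewrite gt_eqF.
  by apply: ler_piMr; [exact: ltW|rewrite ler_pdivrMr// mul1r].
apply: ler_sum => i _.
set l := iter_derive phi _ (t, x).
have := @second_difference R _ phi (t', x) (v i) h l e' (sphi [::])
  (fun y => @diff_derivable _ _ _ _ _ _ (sphi [:: v i] y)) (ltW h0) _.
have E s : (t', x) + s *: v i = (t', x + s *: delta_mx 0 i).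
  by congr pair; rewrite /= scaler0 addr0.
rewrite -scaleNr !E scaleNr => H2.
rewrite -(ler_pM2r (exprn_gt0 2 h0)) -[X in _ * X](ger0_norm (sqr_ge0 h)) -normrM.
rewrite mulrBl divfK ?expf_neq0 ?gt_eqF// (mulrC l) [leRHS]mulrAC; apply: H2 => s sh.
rewrite E distrC; apply: H.
- exact: cell_K.
- split => /=; first by rewrite in_itv.
  move=> j; rewrite !mxE eqxx/=; have /andP[? ?] := cx j.
  move: sh; rewrite ler_norml => /andP[? ?].
  by case: (j == i); rewrite ?mulr1 ?mulr0 ?addr0; apply/andP; split; lra.
- split => //; split=> // a b; rewrite !mxE ord1 eqxx/= /ball/=.
  rewrite opprD addrA subrr add0r normrN normrM.
  apply: le_lt_trans hd; apply: le_trans sh; rewrite ler_piMr//.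
  by case: (b == i); rewrite ?normr1// normr0.
Unshelve. all: by end_near. Qed.

End test_functions.

(** * Integration over space-time *)

Section space_time.
Context {R : realType} {N : nat}.

Notation J := (@integral_torus R N).

Lemma measurable_strip (a b : R) :
  measurable (`[a, b[%classic `*` torus_cell N : set (measurableTypeR R * 'rV[R]_N)).
Proof. by apply: measurableX; [exact: measurable_itv|exact: measurable_torus_cell]. Qed.

Lemma lebesgue_measure_co (a b : R) : a <= b ->
  lebesgue_measure (`[a, b[%classic : set R) = (b - a)%:E.
Proof.
move=> ab; rewrite lebesgue_measure_itv/= lte_fin.
by case: ltP => // ba; rewrite (le_anti (introT andP (conj ab ba))) subrr.
Qed.

Lemma QT_measure_strip (a b : R) : a <= b ->
  QT_measure N (`[a, b[%classic `*` torus_cell N) = (b - a)%:E.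
Proof.
move=> ab; rewrite -[LHS]/((lebesgue_measure \x lebesgue_rV N)%E
  (`[a, b[%classic `*` torus_cell N)) product_measure1E//; last first.
  exact: measurable_torus_cell.
by rewrite (@lebesgue_torus_cell R N) mule1; exact: lebesgue_measure_co.
Qed.

Lemma measurable_QT (T : R) : measurable (QT N T).
Proof. exact: measurable_strip. Qed.

Lemma QT_measure_fin (T : R) : 0 <= T -> (QT_measure N (QT N T) < +oo)%E.
Proof. by move=> T0; rewrite QT_measure_strip// ltry. Qed.

Lemma integral_strip (a b : R) (g : 'rV[R]_N -> R) : a <= b -> tfun g ->
  \int[QT_measure N]_(p in `[a, b[%classic `*` torus_cell N) g p.2 = (b - a) * J g.
Proof.
move=> ab tg; set D := _ `*` _.
have mI : measurable (`[a, b[%classic : set (measurableTypeR R)) by exact: measurable_itv.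
have mC := @measurable_torus_cell R N.
have mD : measurable D by exact: measurable_strip.
have [[mg [C HC]] _] := tg.
have ig : (QT_measure N).-integrable D (fun p => (g p.2)%:E).
  apply: (@bmf_integrable _ _ _ _ _ (fun p => g p.2)) => //.
    by rewrite /D QT_measure_strip// ltry.
  split; last by exists C => p _; exact: HC.
  by apply: measurable_funTS; exact: (measurableT_comp mg measurable_snd).
rewrite /Rintegral integral_mkcond.
have ih : (QT_measure N).-integrable setT ((fun p => (g p.2)%:E) \_ D).
  by apply/(integrable_mkcond _ _).1.
rewrite -(@integral21_prod_meas1 _ _ _ _ _ lebesgue_measure (lebesgue_rV N) _ ih).
rewrite /fubini_G.
have -> : (fun y => \int[lebesgue_measure]_x ((fun p : measurableTypeR R * 'rV[R]_N => (g p.2)%:E) \_ D) (x, y))%E =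
   (fun y => (b - a)%:E * (g y)%:E)%E \_ (torus_cell N).
  apply/funext => y; rewrite patchE; case: ifPn => yC; last first.
    by rewrite integral0_eq// => x _; rewrite patchE /D in_setX/= (negbTE yC) andbF.
  rewrite (_ : (fun x => _) = (cst (g y)%:E) \_ `[a, b[%classic); last first.
    by apply/funext => x; rewrite !patchE /D in_setX/= yC andbT.
  rewrite -integral_mkcond integral_cst// muleC; congr (_ * _)%E.
  exact: lebesgue_measure_co.
rewrite -integral_mkcond.
have igC : (lebesgue_rV N).-integrable (torus_cell N) (EFin \o g) by exact: tfun_integrable.
rewrite integralZl// fineM// ; exact: integrable_fin_num.
Qed.

Lemma bmf_QT_integrable (T : R) (f : R * 'rV[R]_N -> R) : 0 <= T ->
  bmf (QT N T) (f : measurableTypeR R * 'rV[R]_N -> R) ->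
  (QT_measure N).-integrable (QT N T) (EFin \o f).
Proof.
move=> T0 bf; apply: bmf_integrable => //; [exact: measurable_QT|exact: QT_measure_fin].
Qed.

End space_time.

(** * Functions assembled from time steps *)

Section step_functions.
Context {R : realType} {N : nat} (tau : R) (K : nat).
Hypothesis tau0 : 0 < tau.

Notation J := (@integral_torus R N).
Notation T := (K%:R * tau).

Definition step_index (t : R) : nat := Num.truncn (t / tau).

Lemma step_index_itv t : 0 <= t ->
  (step_index t)%:R * tau <= t < (step_index t).+1%:R * tau.
Proof.
move=> t0; rewrite -ler_pdivlMr// -ltr_pdivrMr//.
by apply: Num.Theory.truncn_itv; rewrite divr_ge0// ltW.
Qed.

Lemma step_index_eq t k : k%:R * tau <= t < k.+1%:R * tau -> step_index t = k.
Proof.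
move=> ht; apply: Num.Theory.truncn_def.
by rewrite ler_pdivlMr// ltr_pdivrMr.
Qed.

Lemma step_index_lt t : 0 <= t < T -> (step_index t < K)%N.
Proof.
move=> /andP[t0 tT]; have /andP[h _] := step_index_itv t0.
by have := le_lt_trans h tT; rewrite ltr_pM2r// ltr_nat.
Qed.

Lemma measurable_step d (Y : measurableType d) (D : set Y) (t : Y -> R) k :
  measurable D -> measurable_fun D t -> (forall y, D y -> 0 <= t y) ->
  measurable (D `&` (step_index \o t) @^-1` [set k]).
Proof.
move=> mD mt t0.
have -> : D `&` (step_index \o t) @^-1` [set k] =
    D `&` t @^-1` `[k%:R * tau, k.+1%:R * tau[%classic.
  apply/seteqP; split => y /= [Dy]; rewrite in_itv/= => H; split => //.
    by rewrite -H step_index_itv// t0.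
  exact: step_index_eq.
by apply: mt => //; exact: measurable_itv.
Qed.

Lemma bmf_step (T' : R) (f : nat -> R * 'rV[R]_N -> R) : T' = T ->
  (forall k, (k < K)%N -> bmf (QT N T') (f k : measurableTypeR R * 'rV[R]_N -> R)) ->
  bmf (QT N T') ((fun p => f (step_index p.1) p) : measurableTypeR R * 'rV[R]_N -> R).
Proof.
move=> T'E bf.
have D0 (p : measurableTypeR R * 'rV[R]_N) : QT N T' p -> 0 <= p.1 < T.
  by rewrite -T'E; move=> [/=]; rewrite in_itv.
(* Nothing is assumed about [f k] for [k >= K]; such indices do not occur on the domain and get the
   value [0], so that the gluing can range over all of [nat]. *)
pose g k p := if (k < K)%N then f k p else 0.
have bg k : bmf (QT N T') (g k : measurableTypeR R * 'rV[R]_N -> R).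
  by rewrite /g; case kK: (k < K)%N; [exact: bf|exact: bmf_cst].
have E : {in QT N T', (fun p => g (step_index p.1) p) =1 (fun p => f (step_index p.1) p)}.
  by move=> p /set_mem/D0/step_index_lt kK; rewrite /g kK.
split.
  apply: eq_measurable_fun E _.
  apply: (@measurable_fun_glue _ _ (measurableTypeR R * 'rV[R]_N)%type _ nat
    (fun p => step_index p.1) (QT N T') g) => k; last by case: (bg k).
  apply: (@measurable_step _ (measurableTypeR R * 'rV[R]_N)%type (QT N T') (fun p => p.1)).
  - exact: measurable_QT.
  - by apply: measurable_funTS; exact: measurable_fst.
  - by move=> p /D0/andP[].
have /choice[C HC] k : exists C, forall p, QT N T' p -> `|g k p| <= C.
  by case: (bg k) => _ [C HC]; exists C.
exists (\sum_(k < K) `|C k|) => p Dp; rewrite -E ?inE//.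
have kK := step_index_lt (D0 _ Dp).
apply: (@le_trans _ _ `|C (step_index p.1)|).
  exact: le_trans (HC _ _ Dp) (ler_norm _).
by rewrite (bigD1 (Ordinal kK))//= lerDl sumr_ge0.
Qed.

Lemma integral_step (T' : R) (F : R * 'rV[R]_N -> R) (f : nat -> 'rV[R]_N -> R) : T' = T ->
  bmf (QT N T') (F : measurableTypeR R * 'rV[R]_N -> R) ->
  (forall k, (k < K)%N -> tfun (f k)) ->
  (forall t x, 0 <= t < T -> torus_cell N x -> F (t, x) = f (step_index t) x) ->
  integral_QT T' F = \sum_(k < K) tau * J (f k).
Proof.
move=> -> bF tf FE; rewrite /integral_QT.
have mstrip := @measurable_strip R N.
suff H k : (k <= K)%N ->
    \int[QT_measure N]_(p in `[0, (k%:R * tau)[%classic `*` torus_cell N) F p =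
    \sum_(j < k) tau * J (f j) by exact: H.
elim: k => [_|k IHk kK].
  rewrite big_ord0 mul0r (_ : _ `*` _ = set0) ?Rintegral_set0//.
  by apply/seteqP; split => // -[t x] /= []; rewrite in_itv/= => /andP[t0 /(le_lt_trans t0)]; rewrite ltxx.
have ktau : k%:R * tau <= k.+1%:R * tau by rewrite ler_pM2r// ler_nat.
have k0 : 0 <= k%:R * tau by rewrite mulr_ge0// ltW.
have KT : k.+1%:R * tau <= T by rewrite ler_pM2r// ler_nat.
have E : (`[0, (k.+1%:R * tau)[%classic `*` torus_cell N : set (measurableTypeR R * 'rV[R]_N)) =
    (`[0, (k%:R * tau)[%classic `*` torus_cell N) `|`
    (`[(k%:R * tau), (k.+1%:R * tau)[%classic `*` torus_cell N).
  apply/seteqP; split => -[t x] /=; rewrite !in_itv/=.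
    move=> [/andP[-> ->] cx].
    by case: (ltP t (k%:R * tau)) => _; [left|right].
  by move=> [|] [/andP[t0 t1] cx]; split => //; apply/andP; split => //; lra.
rewrite E Rintegral_setU//; first last.
- apply/disj_setPS => -[t x] /= [] [] /=; rewrite !in_itv/= => /andP[_ t1] _ [] /andP[t2 _] _.
  by have := lt_le_trans t1 t2; rewrite ltxx.
- have iF : (QT_measure N).-integrable (QT N T) (EFin \o F).
    by apply: bmf_QT_integrable => //; rewrite mulr_ge0// ltW.
  rewrite -E; apply: integrableS iF => //; first exact: mstrip.
  move=> -[t x] /= [] /=; rewrite !in_itv/= => /andP[t0 t1] cx; split => //=.
  by rewrite in_itv/=; apply/andP; split => //; exact: lt_le_trans t1 KT.
rewrite IHk ?(ltnW kK)// big_ord_recr/=; congr (_ + _).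
have -> : tau * J (f k) = (k.+1%:R * tau - k%:R * tau) * J (f k).
  by rewrite -natr1; ring.
rewrite -integral_strip//; last exact: tf.
apply: eq_Rintegral => -[t x] /set_mem [] /=; rewrite in_itv/= => /andP[t0 t1] cx.
rewrite FE//; last by apply/andP; split; lra.
by rewrite (@step_index_eq t k)// t0.
Qed.

End step_functions.

Section integral_QT_lemmas.
Context {R : realType} {N : nat} (T : R).
Hypothesis T0 : 0 <= T.
Implicit Types f g : R * 'rV[R]_N -> R.

Definition qfun f := bmf (QT N T) (f : measurableTypeR R * 'rV[R]_N -> R).

Let mQ := @measurable_QT R N T.

Lemma qfun_integrable f : qfun f -> (QT_measure N).-integrable (QT N T) (EFin \o f).
Proof. exact: bmf_QT_integrable. Qed.

Lemma integral_QTD f g : qfun f -> qfun g ->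
  integral_QT T (fun p => f p + g p) = integral_QT T f + integral_QT T g.
Proof.
by move=> qf qg; rewrite /integral_QT RintegralD//; exact: qfun_integrable.
Qed.

Lemma integral_QTB f g : qfun f -> qfun g ->
  integral_QT T (fun p => f p - g p) = integral_QT T f - integral_QT T g.
Proof.
by move=> qf qg; rewrite /integral_QT RintegralB//; exact: qfun_integrable.
Qed.

Lemma integral_QTZ c f : qfun f ->
  integral_QT T (fun p => c * f p) = c * integral_QT T f.
Proof. by move=> qf; rewrite /integral_QT RintegralZl//; exact: qfun_integrable. Qed.

Lemma le_integral_QT f g : qfun f -> qfun g ->
  (forall p, QT N T p -> f p <= g p) -> integral_QT T f <= integral_QT T g.
Proof. by move=> qf qg fg; apply: le_Rintegral => //; exact: qfun_integrable. Qed.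

Lemma norm_integral_QT f : qfun f ->
  `|integral_QT T f| <= integral_QT T (fun p => `|f p|).
Proof. by move=> qf; apply: le_normr_Rintegral => //; exact: qfun_integrable. Qed.

Lemma integral_QT_ge0 f : (forall p, QT N T p -> 0 <= f p) -> 0 <= integral_QT T f.
Proof. exact: Rintegral_ge0. Qed.

Lemma eq_integral_QT f g : (forall p, QT N T p -> f p = g p) ->
  integral_QT T f = integral_QT T g.
Proof. by move=> fg; apply: eq_Rintegral => p /set_mem; exact: fg. Qed.

Lemma integral_QT_cst c : integral_QT T (fun _ : R * 'rV[R]_N => c) = c * T.
Proof.
rewrite /integral_QT Rintegral_cst//; congr (_ * _).
have -> : QT_measure N (QT N T) = T%:E by rewrite QT_measure_strip// subr0.
by [].
Qed.

Lemma qfun_norm f : qfun f -> qfun (fun p => `|f p|).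
Proof.
move=> [mf [C HC]]; split; first exact: measurableT_comp.
by exists C => p Dp; rewrite normr_id HC.
Qed.

Lemma qfun_snd (g : 'rV[R]_N -> R) : tfun g -> qfun (fun p => g p.2).
Proof.
move=> [[mg [C HC]] _]; split; last by exists C => p _; exact: HC.
by apply: measurable_funTS; exact: (measurableT_comp mg measurable_snd).
Qed.

End integral_QT_lemmas.

(** * The discrete system *)

Section system_data.
Context {R : realType} {N I : nat}.

(** Each [b i] receives the whole vector of convolutions, so that all species are handled alike. The
    upper constants are common, obtained later by summing absolute values; the positive lower bounds
    [alpha i] stay individual. [Cr] bounds the kernels and their discrete Laplacians, uniformly in
    the mesh. *)
Record system_data (T : R) (b : 'I_I -> (R * 'rV[R]_N) * 'rV[R]_I -> R)
    (r : 'I_I -> 'rV[R]_I -> R) (rho : 'I_I -> 'rV[R]_N -> R)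
    (alpha : 'I_I -> R) (beta M C Cr : R) : Prop := SystemData {
  data_T_gt0 : 0 < T;
  data_b_periodic : forall i t y, 0 <= t <= T ->
    torus_periodic (fun x => b i ((t, x), y));
  data_b_continuous : forall i, {within QT_closure N T `*` setT, continuous (b i)};
  data_alpha_gt0 : forall i, 0 < alpha i;
  data_b_bounds : forall i p y, QT_closure N T p -> alpha i <= b i (p, y) <= beta;
  data_r_continuous : forall i, continuous (r i);
  data_M_ge0 : 0 <= M;
  data_r_le : forall i x, r i x <= M;
  data_r_affine : forall i x, `|r i x| <= C * (1 + \sum_(j < I) `|x 0 j|);
  data_rho_smooth : forall i, smooth (rho i);
  data_rho_periodic : forall i, torus_periodic (rho i);
  data_rho_ge0 : forall i x, 0 <= rho i x;
  data_rho_le : forall i x, `|rho i x| <= Cr;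
  data_rho_lap : forall i h x, 0 < h <= 1 -> `|lap h (rho i) x| <= Cr }.

End system_data.

Section system.
Context {R : realType} {N I : nat}.
Variables (T : R) (b : 'I_I -> (R * 'rV[R]_N) * 'rV[R]_I -> R)
  (r : 'I_I -> 'rV[R]_I -> R) (rho : 'I_I -> 'rV[R]_N -> R)
  (alpha : 'I_I -> R) (beta M C Cr m0 : R).
Hypothesis data : system_data T b r rho alpha beta M C Cr.

Let T0 := data_T_gt0 data.
Let b_periodic := data_b_periodic data.
Let b_continuous := data_b_continuous data.
Let alpha_gt0 := data_alpha_gt0 data.
Let b_bounds := data_b_bounds data.
Let r_continuous := data_r_continuous data.
Let M_ge0 := data_M_ge0 data.
Let r_le := data_r_le data.
Let r_affine := data_r_affine data.
Let rho_smooth := data_rho_smooth data.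
Let rho_periodic := data_rho_periodic data.
Let rho_ge0 := data_rho_ge0 data.
Let rho_le := data_rho_le data.
Let rho_lap := data_rho_lap data.

Notation J := (@integral_torus R N).

Definition convolve (s : 'I_I -> 'rV[R]_N -> R) x : 'rV[R]_I :=
  \row_j J (fun y => s j y * rho j (x - y)).

Definition mass_bound := expR (M * T) * m0.
Definition conv_bound := mass_bound * Cr.
Definition rate_bound := C * (1 + I%:R * conv_bound).
Definition time_lip := mass_bound * (beta * Cr + rate_bound * Cr).

(** For non-negative functions the integral is the L^1 norm, so this controls the convolutions,
    their modulus of continuity in space and the reaction rates. *)
Definition admissible (s : 'I_I -> 'rV[R]_N -> R) :=
  forall i, [/\ tfun (s i), forall x, 0 <= s i x & J (s i) <= mass_bound].

Let tfun_conv_int s j x : tfun (s j) -> tfun (fun y => s j y * rho j (x - y)).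
Proof. by move=> ts; apply: tfunM => //; exact: smooth_kernel_refl. Qed.

Lemma convolve_periodic s i x : convolve s (x + delta_mx 0 i) = convolve s x.
Proof.
apply/rowP => j; rewrite !mxE; apply: eq_integral_torus => y.
by rewrite addrAC rho_periodic.
Qed.

Lemma convolve_bounds s j x : admissible s -> 0 <= convolve s x 0 j <= conv_bound.
Proof.
move=> /(_ j)[ts s0 Js]; rewrite mxE; apply/andP; split.
  by apply: integral_torus_ge0 => y; rewrite mulr_ge0.
have Cr0 : 0 <= Cr by exact: le_trans (rho_le j 0).
apply: (@le_trans _ _ (Cr * J (s j))).
  rewrite -integral_torusZ//; apply: le_integral_torus => //.
  - exact: tfun_conv_int.
  - exact: tfunZ.
  - by move=> y; rewrite mulrC ler_wpM2r// (le_trans (ler_norm _)).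
by rewrite mulrC ler_wpM2r.
Qed.

(** The modulus is that of the kernel times the mass, hence the same for all admissible states: this
    is the equicontinuity in space behind the cluster point. *)
Lemma convolve_unif j e : 0 < e -> exists2 d, 0 < d & forall s x x',
  admissible s -> ball x d x' -> `|convolve s x 0 j - convolve s x' 0 j| <= e.
Proof.
move=> e0.
have mb1 : 0 < `|mass_bound| + 1 by rewrite ltr_pwDr.
have [d d0 H] := smooth_kernel_unif (rho_smooth j) (rho_periodic j) (divr_gt0 e0 mb1).
exists d => // s x x' /(_ j)[ts s0 Js] xx'; rewrite !mxE.
have t1 := tfun_conv_int x ts; have t2 := tfun_conv_int x' ts.
rewrite -integral_torusB//; apply: le_trans (norm_integral_torus (tfunB t1 t2)) _.
apply: (@le_trans _ _ (J (fun y => e / (`|mass_bound| + 1) * s j y))).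
  apply: le_integral_torus.
  - split; last by move=> i y; congr (`|_|); rewrite (tfunB t1 t2).2.
    have [[mf [D HD]] _] := tfunB t1 t2; split; first exact: measurableT_comp.
    by exists D => y _; rewrite normr_id HD.
  - exact: tfunZ.
  - move=> y; rewrite -mulrBr normrM ger0_norm// mulrC ler_wpM2r//.
    apply: H; have [_ xb] := xx'; split => // p q.
    have := xb p q; rewrite /ball/= !mxE.
    by rewrite (_ : _ - _ - _ = x p q - x' p q)//; ring.
rewrite integral_torusZ// mulrAC ler_pdivrMr// ler_pM2l//.
by rewrite (le_trans Js)// (le_trans (ler_norm _))// lerDl.
Qed.

Lemma tfun_convolve s j : admissible s -> tfun (fun x => convolve s x 0 j).
Proof.
move=> as_; split; last by move=> i x; rewrite convolve_periodic.
split; last first.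
  exists conv_bound => x _; have /andP[? ?] := convolve_bounds j x as_.
  by rewrite ger0_norm.
suff cf : continuous (fun x => convolve s x 0 j) by exact: continuous_measurable_rV.
move=> x; apply/(@cvgrPdist_le _ _ _ (nbhs x)) => e e0.
have [d d0 H] := convolve_unif j e0.
by apply: filterS (nbhsx_ballx x d d0) => x'; exact: H.
Qed.

Lemma rate_bounds s i x : admissible s -> `|r i (convolve s x)| <= rate_bound.
Proof.
move=> as_; apply: le_trans (r_affine _ _) _.
(* The sub-affine bound at the origin reads [|r i 0| <= C]. *)
have C0 : 0 <= C.
  by have := r_affine i 0; rewrite big1 ?addr0 ?mulr1 => [/(le_trans (normr_ge0 _))|j _]//;
     rewrite mxE normr0.
rewrite /rate_bound ler_wpM2l// lerD2l.
apply: (@le_trans _ _ (\sum_(j < I) conv_bound)).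
  apply: ler_sum => j _; have /andP[? ?] := convolve_bounds j x as_.
  by rewrite ger0_norm.
by rewrite sumr_const card_ord mulr_natl.
Qed.

Lemma tfun_rate s i : admissible s -> tfun (fun x => r i (convolve s x)).
Proof.
move=> as_; split; last by move=> j x; rewrite convolve_periodic.
split; last by exists rate_bound => x _; exact: rate_bounds.
apply: (@measurable_continuous_comp R N I 0 (fun p => r i p.2) _ _ _ (fun=> 0) id) => //.
- apply: continuous_subspaceT => p.
  by apply: (@continuous_comp _ _ _ snd (r i)); [exact: cvg_snd|exact: r_continuous].
- by move=> x _; rewrite lexx.
- by move=> j; exact: measurable_coord.
- by move=> j; have [[]] := tfun_convolve j as_.
Qed.

Lemma tfun_coef s i t : admissible s -> 0 <= t <= T ->
  tfun (fun x => b i ((t, x), convolve s x)).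
Proof.
move=> as_ tT; split; last first.
  by move=> j x; rewrite convolve_periodic b_periodic.
split; last first.
  exists beta => x _; have /andP[a1 a2] := @b_bounds i (t, x) (convolve s x)
    ltac:(by split => //=; rewrite in_itv).
  by rewrite ger0_norm// (le_trans (ltW (alpha_gt0 i)) a1).
apply: (@measurable_continuous_comp R N I T (b i) _ _ _ (fun=> t) id) => //.
- by move=> j; exact: measurable_coord.
- by move=> j; have [[]] := tfun_convolve j as_.
Qed.

(** The condition [scheme_cfl] does two jobs: half of its diffusion term together with [rate_bound]
    gives non-negativity, and the full [4 * N] is what the L^2 estimate absorbs. *)
Record scheme_data (h tau : R) (K : nat) (s0 : 'I_I -> 'rV[R]_N -> R) : Prop :=
  SchemeData {
  scheme_h : 0 < h <= 1;
  scheme_tau : 0 < tau;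
  scheme_T : T = K%:R * tau;
  scheme_cfl : tau * (4 * N%:R * beta / h ^+ 2 + rate_bound) <= 1;
  scheme_tfun : forall i, tfun (s0 i);
  scheme_ge0 : forall i x, 0 <= s0 i x;
  scheme_mass : forall i, J (s0 i) <= m0 }.

Section scheme.
Variables (h tau : R) (K : nat) (s0 : 'I_I -> 'rV[R]_N -> R).
Hypothesis sdata : scheme_data h tau K s0.

Let h01 := scheme_h sdata.
Let tau0 := scheme_tau sdata.
Let KT := scheme_T sdata.
Let cfl := scheme_cfl sdata.
Let s0_tfun := scheme_tfun sdata.
Let s0_ge0 := scheme_ge0 sdata.
Let s0_mass := scheme_mass sdata.

Fixpoint state (k : nat) : 'I_I -> 'rV[R]_N -> R :=
  if k is k'.+1 then fun i x => state k' i x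
    + tau * lap h (fun x => b i ((k'%:R * tau, x), convolve (state k') x) * state k' i x) x
    + tau * (r i (convolve (state k') x) * state k' i x)
  else s0.

Let coef k i x := b i ((k%:R * tau, x), convolve (state k) x).
Let rate k i x := r i (convolve (state k) x).

Let time_in k : (k <= K)%N -> 0 <= k%:R * tau <= T.
Proof.
move=> kK; rewrite mulr_ge0 ?(ltW tau0)//= KT ler_pM2r//.
by rewrite ler_nat.
Qed.

Let h2 : 0 < h ^+ 2.
Proof. by case/andP: h01 => ? _; rewrite exprn_gt0. Qed.

Let beta_gt0 (i : 'I_I) : 0 < beta.
Proof.
have /andP[a1 a2] := @b_bounds i (0, 0) 0 ltac:(by split => //=; rewrite in_itv/= lexx ltW).
exact: lt_le_trans (alpha_gt0 i) (le_trans a1 a2).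
Qed.

Lemma growth_le k : (k <= K)%N -> (1 + tau * M) ^+ k <= expR (M * T).
Proof.
move=> kK; have tM : 0 <= tau * M by rewrite mulr_ge0// ltW.
apply: (@le_trans _ _ (expR (tau * M) ^+ k)).
  apply: lerXn2r.
  - by rewrite nnegrE addr_ge0.
  - by rewrite nnegrE expR_ge0.
  - exact: expR_ge1Dx.
rewrite -expRM_natl ler_expR KT (_ : M * (K%:R * tau) = K%:R * (tau * M)); last by ring.
by rewrite ler_wpM2r// ler_nat.
Qed.

Lemma m0_ge0 (i : 'I_I) : 0 <= m0.
Proof. by apply: le_trans (s0_mass i); apply: integral_torus_ge0. Qed.

(** One induction for the three properties: they make step [k] admissible, which bounds its rates;
    bounded rates keep step [k.+1] non-negative, and non-negativity of step [k] limits the growth of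
    mass. The mass is tracked as [(1 + tau * M) ^+ k * m0] because the fixed [mass_bound] would not
    reproduce itself from one step to the next. *)
Lemma state_invariant k : (k <= K)%N -> forall i,
  [/\ tfun (state k i), forall x, 0 <= state k i x &
      J (state k i) <= (1 + tau * M) ^+ k * m0].
Proof.
elim: k => [_ i|k IHk kK i]; first by rewrite expr0 mul1r; split.
have H := IHk (ltnW kK).
have as_ : admissible (state k).
  move=> j; have [tj j0 Jj] := H j; split => //; apply: le_trans Jj _.
  by rewrite ler_wpM2r ?(m0_ge0 j)// growth_le// ltnW.
have [ti i0 Ji] := H i.
have tc := tfun_coef i as_ (time_in (ltnW kK)).
have tr := tfun_rate i as_.
have bb x : alpha i <= coef k i x <= beta.
  by apply: b_bounds; split => //=; rewrite in_itv/= time_in// ltnW.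
have zE k' x : state k'.+1 i x = state k' i x +
    tau * lap h (fun x => coef k' i x * state k' i x) x + tau * (rate k' i x * state k' i x).
  by [].
split.
- apply: tfunD; first (apply: tfunD => //; apply: tfunZ; apply: tfun_lap; exact: tfunM).
  by apply: tfunZ; exact: tfunM.
- apply: (@euler_ge0 _ _ h h01 (fun k => state k i) (fun k => coef k i)
    (fun k => rate k i) tau beta tau0 zE k rate_bound) => //.
  + apply: le_trans cfl; rewrite ler_pM2l// lerD2r -!mulrA ler_wpM2r//.
      by rewrite mulr_ge0// divr_ge0 ?ltW// (beta_gt0 i).
    by rewrite ler_nat.
  + by move=> x; have /andP[a1 ->] := bb x; rewrite (le_trans (ltW (alpha_gt0 i)) a1).
  + by move=> x; have := rate_bounds i x as_; rewrite ler_norml => /andP[].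
- rewrite exprS -mulrA.
  apply: le_trans (@euler_mass _ _ h h01 (fun k => state k i) (fun k => coef k i)
    (fun k => rate k i) tau tau0 zE k M M_ge0 ti tc tr i0 _) _.
    by move=> x; exact: r_le.
  by rewrite ler_wpM2l// addr_ge0// mulr_ge0// ltW.
Qed.

Lemma state_admissible k : (k <= K)%N -> admissible (state k).
Proof.
move=> kK j; have [tj j0 Jj] := state_invariant kK j; split => //; apply: le_trans Jj _.
by rewrite ler_wpM2r ?(m0_ge0 j)// growth_le.
Qed.


Let zE i k x : state k.+1 i x = state k i x +
  tau * lap h (fun x => coef k i x * state k i x) x + tau * (rate k i x * state k i x).
Proof. by []. Qed.

Let tfun_state k i : (k <= K)%N -> tfun (state k i).
Proof. by move=> kK; have [] := state_invariant kK i. Qed.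

Let state_ge0 k i x : (k <= K)%N -> 0 <= state k i x.
Proof. by move=> kK; have [_ + _] := state_invariant kK i; exact. Qed.

Let state_mass k i : (k <= K)%N -> J (state k i) <= mass_bound.
Proof. by move=> kK; have [] := state_admissible kK i. Qed.

Let tfun_coefk k i : (k <= K)%N -> tfun (coef k i).
Proof. by move=> kK; apply: tfun_coef; [exact: state_admissible|exact: time_in]. Qed.

Let tfun_ratek k i : (k <= K)%N -> tfun (rate k i).
Proof. by move=> kK; apply: tfun_rate; exact: state_admissible. Qed.

Let coef_bounds k i x : (k <= K)%N -> alpha i <= coef k i x <= beta.
Proof. by move=> kK; apply: b_bounds; split => //=; rewrite in_itv/= time_in. Qed.

Let rate_le k i x : (k <= K)%N -> `|rate k i x| <= rate_bound.
Proof. by move=> kK; apply: rate_bounds; exact: state_admissible. Qed.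

(** The constant involves neither the mesh nor the supremum of [s0], so it stays uniform when the
    truncation of the initial datum is released. *)
Lemma state_l2 i : \sum_(k < K) tau * J (fun x => state k i x ^+ 2) <=
  expR (M * T) ^+ 2 * (4 * T * beta / alpha i) * J (fun x => s0 i x ^+ 2).
Proof.
have b0 := beta_gt0 i; have tM : 0 <= tau * M by rewrite mulr_ge0// ltW.
have R0 : 0 <= rate_bound by exact: le_trans (rate_le i 0 (leq0n K)).
apply: le_trans (@euler_l2_bound _ _ h h01 (fun k => state k i)
  (fun k => coef k i) (fun k => rate k i) tau (alpha i) beta tau0 (alpha_gt0 i)
  (zE i) M K M_ge0 _ (ltW b0) _ _ _ _ _) _.
- have : tau * (4 * N%:R * beta / h ^+ 2) <= 1.
    by apply: le_trans cfl; rewrite ler_pM2l// lerDl.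
  by rewrite mulrA ler_pdivrMr// mul1r.
- by move=> k kK; exact: tfun_state (ltnW kK).
- by move=> k kK; exact: tfun_coefk (ltnW kK).
- by move=> k x kK; exact: state_ge0 (ltnW kK).
- by move=> k x kK; exact: coef_bounds (ltnW kK).
- by move=> k x kK; exact: r_le.
rewrite ler_wpM2r//; first by apply: integral_torus_ge0 => x; exact: sqr_ge0.
rewrite (mulrC tau K%:R) -KT ler_wpM2r//.
  by rewrite divr_ge0 ?(ltW (alpha_gt0 i))// !mulr_ge0// ltW.
rewrite mulnC exprM lerXn2r ?nnegrE ?expR_ge0 ?exprn_ge0 ?growth_le//.
by rewrite addr_ge0.
Qed.

(** The increment of the state is not controlled pointwise, but tested against the kernel it falls
    on [lap h] of the kernel, which is bounded uniformly in [h]. *)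
Lemma convolve_step k j x : (k < K)%N ->
  `|convolve (state k.+1) x 0 j - convolve (state k) x 0 j| <= tau * time_lip.
Proof.
move=> kK; have kK' := ltnW kK; rewrite !mxE.
set f := fun y => rho j (x - y).
have tf : tfun f by exact: smooth_kernel_refl.
have tl : tfun (lap h f) by exact: tfun_lap.
have tE : tfun (fun y => coef k j y * lap h f y + rate k j y * f y).
  by apply: tfunD; apply: tfunM => //; [exact: tfun_coefk|exact: tfun_ratek].
have tz := tfun_state j kK'.
rewrite (@euler_test _ _ h h01 (fun k => state k j) (fun k => coef k j)
  (fun k => rate k j) tau (zE j) k f)//; [|exact: tfun_coefk|exact: tfun_ratek].
rewrite addrAC subrr add0r normrM gtr0_norm// ler_pM2l//.
have tzE : tfun (fun y => state k j y * (coef k j y * lap h f y + rate k j y * f y)).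
  exact: tfunM.
apply: le_trans (norm_integral_torus tzE) _.
have Cr0 : 0 <= Cr by exact: le_trans (rho_le j 0).
have R0 : 0 <= rate_bound by exact: le_trans (rate_le j 0 kK').
set c := beta * Cr + rate_bound * Cr.
have c0 : 0 <= c by rewrite addr_ge0// mulr_ge0// ltW// (beta_gt0 j).
apply: (@le_trans _ _ (J (fun y => c * state k j y))); last first.
  by rewrite integral_torusZ// /time_lip mulrC ler_wpM2r// state_mass.
apply: le_integral_torus.
- split; last by move=> i y; congr (`|_|); rewrite tzE.2.
  have [[mf [D HD]] _] := tzE; split; first exact: measurableT_comp.
  by exists D => y _; rewrite normr_id HD.
- exact: tfunZ.
- move=> y; rewrite normrM (ger0_norm (state_ge0 _ _ kK')) mulrC ler_wpM2r ?state_ge0//.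
  apply: (le_trans (ler_normD _ _)); rewrite !normrM; apply: lerD.
    apply: ler_pM => //; last by rewrite /f lap_refl rho_lap.
    have /andP[a1 a2] := coef_bounds j y kK'.
    by rewrite ger0_norm// (le_trans (ltW (alpha_gt0 j)) a1).
  by apply: ler_pM => //; [exact: rate_le|exact: rho_le].
Qed.

Lemma convolve_steps k l j x : (k <= l)%N -> (l <= K)%N ->
  `|convolve (state l) x 0 j - convolve (state k) x 0 j| <=
    (l%:R * tau - k%:R * tau) * time_lip.
Proof.
move=> /subnKC <-; elim: (l - k)%N => [_|n IHn nK].
  by rewrite addn0 !subrr normr0 mul0r.
rewrite addnS in nK *; have H1 := IHn (ltnW nK); have H2 := convolve_step j x nK.
rewrite (_ : _ - _ = (convolve (state (k + n).+1) x 0 j - convolve (state (k + n)) x 0 j) +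
  (convolve (state (k + n)) x 0 j - convolve (state k) x 0 j)); last by ring.
apply: (le_trans (ler_normD _ _)); apply: (le_trans (lerD H2 H1)).
rewrite -(natr1 (k + n)) le_eqVlt; apply/orP; left; apply/eqP; ring.
Qed.

Definition euler_approx i (p : R * 'rV[R]_N) := state (step_index tau p.1) i p.2.

Let idx_lt t : 0 <= t < T -> (step_index tau t < K)%N.
Proof. by rewrite KT; exact: step_index_lt. Qed.

Lemma euler_approx_admissible t : 0 <= t < T -> admissible (fun i x => euler_approx i (t, x)).
Proof. by move=> tT i; exact: (state_admissible (ltnW (idx_lt tT)) i). Qed.

(** The additional [tau] accounts for rounding times to the grid: two close times may lie on either
    side of a jump. *)
Lemma euler_approx_time t t' j x : 0 <= t < T -> 0 <= t' < T ->
  `|convolve (fun i x => euler_approx i (t, x)) x 0 j -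
    convolve (fun i x => euler_approx i (t', x)) x 0 j| <= (`|t - t'| + tau) * time_lip.
Proof.
move=> tT t'T; wlog tt' : t t' tT t'T / t' <= t.
  move=> H; have [/H|/ltW/H] := leP t' t; first exact.
  by rewrite distrC (distrC t t'); exact.
have L0 : 0 <= time_lip.
  have H := convolve_step j x (idx_lt tT).
  by rewrite -(ler_pM2l tau0) mulr0; exact: le_trans H.
have /andP[t0 _] := tT; have /andP[t'0 _] := t'T.
have /andP[a1 a2] := step_index_itv tau0 t0.
have /andP[b1 b2] := step_index_itv tau0 t'0.
have kl : (step_index tau t' <= step_index tau t)%N.
  by rewrite -ltnS -(ltr_nat R) -(ltr_pM2r tau0); apply: le_lt_trans b1 (le_lt_trans tt' a2).
apply: le_trans (convolve_steps j x kl (ltnW (idx_lt tT))) _.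
rewrite ler_wpM2r// ger0_norm ?subr_ge0//.
by move: b2; rewrite -natr1 mulrDl mul1r; lra.
Qed.

Lemma euler_approx_qfun i : qfun T (euler_approx i).
Proof.
apply: (@bmf_step _ _ tau K tau0 T (fun k p => state k i p.2) KT) => k kK.
by apply: qfun_snd; exact: tfun_state (ltnW kK).
Qed.

Lemma euler_approx_convolve_qfun j :
  qfun T (fun p => convolve (fun i x => euler_approx i (p.1, x)) p.2 0 j).
Proof.
apply: (@bmf_step _ _ tau K tau0 T (fun k p => convolve (state k) p.2 0 j) KT) => k kK.
apply: (qfun_snd T (g := fun x => convolve (state k) x 0 j)).
by apply: tfun_convolve; exact: state_admissible (ltnW kK).
Qed.

Lemma euler_approx_mass i : integral_QT T (euler_approx i) <= T * mass_bound.
Proof.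
rewrite (@integral_step _ _ tau K tau0 T _ (fun k => state k i) KT) => //.
- apply: (@le_trans _ _ (\sum_(k < K) tau * mass_bound)).
    by apply: ler_sum => k _; rewrite ler_pM2l// state_mass// ltnW.
  by rewrite sumr_const card_ord -mulr_natl mulrA -KT.
- exact: euler_approx_qfun.
- by move=> k kK; exact: tfun_state (ltnW kK).
Qed.

Lemma euler_approx_l2 i : integral_QT T (fun p => euler_approx i p ^+ 2) <=
  expR (M * T) ^+ 2 * (4 * T * beta / alpha i) * J (fun x => s0 i x ^+ 2).
Proof.
rewrite (@integral_step _ _ tau K tau0 T _ (fun k x => state k i x ^+ 2) KT) => //.
- exact: state_l2.
- have q := euler_approx_qfun i.
  by rewrite (_ : (fun p => _) = fun p => euler_approx i p * euler_approx i p)//; exact: bmfM.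
- by move=> k kK; apply: tfun_sqr; exact: tfun_state (ltnW kK).
Qed.

Lemma step_index_bounds t : 0 <= t < T -> let k := step_index tau t in
  k%:R * tau <= t < k.+1%:R * tau /\ k.+1%:R * tau <= T.
Proof.
move=> tT; have /andP[t0 _] := tT; split; first exact: step_index_itv.
by rewrite KT ler_pM2r// ler_nat; exact: idx_lt.
Qed.

Section weak_form.
Variables (i : 'I_I) (phi : R * 'rV[R]_N -> R).
Hypothesis tphi : test_function T phi.

(** The adjoint of the scheme. Summation by parts in time puts [phi] at the new time in the
    diffusion and reaction terms, while the coefficients stay at the old time. *)
Definition discrete_operator k x :=
  (phi (k.+1%:R * tau, x) - phi (k%:R * tau, x)) / tau +
  b i ((k%:R * tau, x), convolve (state k) x) *
    lap h (fun x => phi (k.+1%:R * tau, x)) x +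
  r i (convolve (state k) x) * phi (k.+1%:R * tau, x).

Let tfun_phi k : (k <= K)%N -> tfun (fun x => phi (k%:R * tau, x)).
Proof. by move=> kK; apply: (test_function_tfun tphi); exact: time_in. Qed.

Lemma tfun_discrete_operator k : (k < K)%N -> tfun (discrete_operator k).
Proof.
move=> kK; have t1 := tfun_phi kK; have t0 := tfun_phi (ltnW kK).
apply: tfunD; first apply: tfunD.
- by apply: tfunM; [exact: tfunB|exact: tfun_cst].
- by apply: tfunM; [exact: tfun_coefk (ltnW kK)|exact: tfun_lap].
- by apply: tfunM => //; exact: tfun_ratek (ltnW kK).
Qed.

(** The sum telescopes, and the term at the final time vanishes with [phi]. *)
Lemma discrete_weak_form :
  \sum_(k < K) tau * J (fun x => state k i x * discrete_operator k x) =
  - J (fun x => s0 i x * phi (0, x)).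
Proof.
suff H n : (n <= K)%N ->
    \sum_(k < n) tau * J (fun x => state k i x * discrete_operator k x) =
    J (fun x => state n i x * phi (n%:R * tau, x)) - J (fun x => s0 i x * phi (0, x)).
  rewrite H// -KT (@eq_integral_torus _ _ (fun x => _ * phi (T, x)) (fun=> 0)).
    by rewrite integral_torus_cst sub0r.
  by move=> x; rewrite (test_function_end tphi)// mulr0.
elim: n => [_|n IHn nK]; first by rewrite big_ord0 /= mul0r subrr.
rewrite big_ord_recr/= IHn ?(ltnW nK)//; have nK' := ltnW nK.
have t1 := tfun_phi nK; have t0 := tfun_phi nK'.
have tz := tfun_state i nK'.
have := @euler_test _ _ h h01 (fun k => state k i) (fun k => coef k i)
  (fun k => rate k i) tau (zE i) n (fun x => phi (n.+1%:R * tau, x))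
  tz (tfun_coefk i nK') (tfun_ratek i nK') t1.
rewrite /= => ->.
have tE := tfun_discrete_operator nK.
have tF : tfun (fun x => coef n i x * lap h (fun x => phi (n.+1%:R * tau, x)) x +
   rate n i x * phi (n.+1%:R * tau, x)).
  apply: tfunD; apply: tfunM => //; [exact: tfun_coefk|exact: tfun_lap|exact: tfun_ratek].
suff -> : tau * J (fun x => state n i x * discrete_operator n x) =
    (J (fun x => state n i x * phi (n.+1%:R * tau, x)) -
     J (fun x => state n i x * phi (n%:R * tau, x))) +
    tau * J (fun x => state n i x * (coef n i x * lap h (fun x => phi (n.+1%:R * tau, x)) x +
      rate n i x * phi (n.+1%:R * tau, x))) by ring.
rewrite -integral_torusB; [|exact: tfunM..].
rewrite -!integral_torusZ; [|exact: tfunM..].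
rewrite -integral_torusD; [|by apply: tfunB; exact: tfunM|by apply: tfunZ; exact: tfunM].
apply: eq_integral_torus => x; rewrite /discrete_operator /coef /rate.
by field; rewrite gt_eqF.
Qed.

(** A uniform error in the operator costs only the space-time mass, since the approximation is
    non-negative. *)
Lemma euler_approx_weak_error (psi : R * 'rV[R]_N -> R) e : 0 <= e -> qfun T psi ->
  (forall t x, 0 <= t < T -> torus_cell N x ->
     `|psi (t, x) - discrete_operator (step_index tau t) x| <= e) ->
  `|integral_QT T (fun p => euler_approx i p * psi p) + J (fun x => s0 i x * phi (0, x))| <=
    e * (T * mass_bound).
Proof.
move=> e0 qpsi H; have T0' := ltW T0.
have qa := euler_approx_qfun i.
have qE : qfun T (fun p => discrete_operator (step_index tau p.1) p.2).
  apply: (@bmf_step _ _ tau K tau0 T (fun k p => discrete_operator k p.2) KT) => k kK.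
  by apply: qfun_snd; exact: tfun_discrete_operator.
rewrite -[J _]opprK -discrete_weak_form.
rewrite -(@integral_step _ _ tau K tau0 T
  (fun p => euler_approx i p * discrete_operator (step_index tau p.1) p.2)
  (fun k x => state k i x * discrete_operator k x) KT)//; first last.
- by move=> k kK; apply: tfunM; [exact: tfun_state (ltnW kK)|exact: tfun_discrete_operator].
- exact: bmfM.
rewrite -integral_QTB//; [|exact: bmfM..].
have qd : qfun T (fun p => euler_approx i p * psi p - euler_approx i p * discrete_operator (step_index tau p.1) p.2).
  by apply: bmfB; exact: bmfM.
apply: le_trans (norm_integral_QT T0' qd) _.
apply: (@le_trans _ _ (integral_QT T (fun p => e * euler_approx i p))).
  apply: le_integral_QT => //; first exact: qfun_norm.
    by apply: bmfM => //; exact: bmf_cst.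
  move=> [t x] [] /=; rewrite in_itv/= => tT cx.
  rewrite -mulrBr normrM mulrC; have [_ a0 _] := euler_approx_admissible tT i.
  by rewrite (ger0_norm (a0 x)) ler_wpM2r//; exact: H.
by rewrite integral_QTZ// ler_wpM2l// euler_approx_mass.
Qed.

End weak_form.

End scheme.

End system.

(** * Completeness of L^1 *)

Section fatou_corollary.
Context d (X : measurableType d) (R : realType).
Variables (mu : {measure set X -> \bar R}) (D : set X).
Hypothesis mD : measurable D.

Lemma fatou_le (F : nat -> X -> R) (f : X -> R) (c : \bar R) :
  (forall n, measurable_fun D (F n)) ->
  (forall n x, D x -> 0 <= F n x) ->
  (forall x, D x -> F n x @[n --> \oo] --> f x) ->
  (forall n, \int[mu]_(x in D) (F n x)%:E <= c)%E ->
  (\int[mu]_(x in D) (f x)%:E <= c)%E.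
Proof.
move=> mF F0 Ff Fc.
have := @fatou _ _ R mu D mD (fun n x => (F n x)%:E) _ _.
rewrite (eq_integral (fun x => (f x)%:E)); last first.
  move=> x /set_mem Dx /=.
  have /cvg_limn_einf_sup[-> _] : (F n x)%:E @[n --> \oo] --> (f x)%:E.
    by apply: cvg_EFin; [exact: nearW|exact: Ff].
  by [].
move=> H; apply: le_trans (H _ _) _.
- by move=> n; exact/measurable_EFinP.
- by move=> n x Dx; rewrite lee_fin F0.
rewrite limn_einf_lim; apply: lime_le; first exact: is_cvg_einfs.
by near=> n; apply: le_trans (Fc n); apply: ereal_inf_lbound; exists n => /=.
Unshelve. all: by end_near. Qed.

End fatou_corollary.

Section L1_completeness.
Context d (X : measurableType d) (R : realType).
Variables (mu : {measure set X -> \bar R}) (D : set X) (f : nat -> X -> R).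
Hypotheses (mD : measurable D) (mf : forall n, measurable_fun D (f n))
  (f0 : forall n x, D x -> 0 <= f n x)
  (f_cauchy : forall e, 0 < e -> exists n0, forall n m, (n0 <= n)%N -> (n0 <= m)%N ->
    (\int[mu]_(x in D) `|f n x - f m x|%:E <= e%:E)%E).

(** Riesz-Fischer, with a limit that is non-negative everywhere and vanishes off [D]; the last
    clause transfers L^2 bounds to it by Fatou. *)
Lemma L1_complete : exists g : X -> R,
  [/\ measurable_fun setT g, forall x, 0 <= g x, forall x, ~ D x -> g x = 0,
      forall e, 0 < e -> exists n0, forall n, (n0 <= n)%N ->
        (\int[mu]_(x in D) `|f n x - g x|%:E <= e%:E)%E &
      forall c, (forall n, \int[mu]_(x in D) (f n x ^+ 2)%:E <= c)%E ->
        (\int[mu]_(x in D) (g x ^+ 2)%:E <= c)%E].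
Proof.
have pow2 (l : nat) : 0 < (1 / (2 ^ (l + 1))%:R : R).
  by rewrite divr_gt0// ltr0n expn_gt0.
have /choice[n_ n_P] := fun l : nat => f_cauchy (pow2 l).
(* The summand [l] drives [psi] to infinity and the sum dominates every [n_ j] with [j <= l], so
   consecutive terms of the subsequence are within [1 / 2 ^ (l + 1)] in L^1. *)
pose psi l := (l + \sum_(j < l.+1) n_ j)%N.
have psi_ge j l : (j <= l)%N -> (n_ j <= psi l)%N.
  by move=> jl; rewrite /psi (bigD1 (Ordinal (jl : (j < l.+1)%N)))//= addnCA leq_addr.
pose s l x := `|f (psi l.+1) x - f (psi l) x|.
have ms l : measurable_fun D (s l).
  by apply: measurableT_comp => //; exact: measurable_funB.
have s0 l x : 0 <= s l x by exact: normr_ge0.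
pose S x : \bar R := (\sum_(l <oo) (s l x)%:E)%E.
have S0 x : (0 <= S x)%E by apply: nneseries_ge0 => l _ _; rewrite lee_fin.
have mS : measurable_fun D S.
  by apply: ge0_emeasurable_sum => l *; rewrite ?lee_fin//; exact/measurable_EFinP.
have intS : (\int[mu]_(x in D) S x < +oo)%E.
  rewrite integral_nneseries//; last 2 first.
    by move=> l; exact/measurable_EFinP.
    by move=> l x Dx; rewrite lee_fin.
  apply: (@le_lt_trans _ _ (\sum_(l <oo) (1 / (2 ^ (l + 1))%:R : R)%:E)%E).
    apply: lee_nneseries => [l _ _|l _]; first by apply: integral_ge0 => x _; rewrite lee_fin.
    by apply: n_P; apply: psi_ge.
  rewrite (_ : (\sum_(l <oo) _)%E = (1 / 2 ^+ 0 : R)%:E) ?ltry//.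
  by apply: cvg_lim => //; exact: (@cvg_geometric_eseries_half R 1 0).
(* On [E] the increments are absolutely summable, so the subsequence converges there; the rest of
   [D] is negligible and the limit is set to [0] on it. *)
pose E := D `&` [set x | S x < +oo]%E.
have mE : measurable E by exact: emeasurable_fun_infty_o.
have muE : mu (D `\` E) = 0.
  have iS : mu.-integrable D S.
    apply/integrableP; split => //.
    by under eq_integral do rewrite gee0_abs//.
  have [A [mA A0 DA]] := integrable_ae mD iS.
  apply/eqP; rewrite eq_le measure_ge0 andbT -A0 le_measure ?inE//.
    exact: measurableD.
  move=> x [Dx nEx]; apply: DA => /= /(_ Dx) Sfin; apply: nEx; split => //=.
  by rewrite -ge0_fin_numE.
have cvgE x : E x -> cvgn (fun l => f (psi l) x).
  move=> [Dx /= Sx].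
  pose u l := f (psi l.+1) x - f (psi l) x.
  have cu : cvgn (series u).
    apply: normed_cvg; apply: nondecreasing_is_cvgn.
      by apply: nondecreasing_series => n _ _; exact: normr_ge0.
    exists (fine (S x)) => _ [n _ <-]; rewrite -lee_fin fineK ?ge0_fin_numE//.
    rewrite /series/= -sumEFin; apply: le_trans (nneseries_lim_ge n _) => //.
    by move=> k _ _; rewrite lee_fin.
  rewrite (_ : (fun l => _) = fun l => f (psi 0%N) x + series u l); last first.
    apply/funext => l; rewrite /series/= telescope_sumr// addrC subrK//.
  by apply: is_cvgD => //; exact: is_cvg_cst.
pose g x := limn (fun l => (f (psi l) \_ E) x).
have patch_in x : E x -> (fun l => (f (psi l) \_ E) x) = (fun l => f (psi l) x).
  by move=> Ex; apply/funext => l; rewrite patchE mem_set.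
have patch_out x : ~ E x -> (fun l => (f (psi l) \_ E) x) = (fun=> 0).
  by move=> nEx; apply/funext => l; rewrite patchE memNset.
have gE x : E x -> f (psi l) x @[l --> \oo] --> g x.
  by move=> Ex; rewrite /g patch_in//; exact: cvgE.
have gN x : ~ E x -> g x = 0.
  by move=> nEx; rewrite /g patch_out//; exact: lim_cst.
have mg : measurable_fun setT g.
  apply: (@measurable_fun_cvg _ _ _ _ (fun l => f (psi l) \_ E)) => [l|x _].
    by apply/(measurable_restrictT _ _).1 => //; apply: measurable_funS (mf _) => // x [].
  have [Ex|nEx] := pselect (E x).
    by rewrite patch_in//; exact: gE.
  by rewrite patch_out// gN//; exact: cvg_cst.
have int_E (F : X -> R) : measurable_fun D F -> (forall x, D x -> 0 <= F x) ->
    (\int[mu]_(x in D) (F x)%:E = \int[mu]_(x in E) (F x)%:E)%E.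
  move=> mF F0; rewrite (@ge0_negligible_integral _ _ _ mu D (D `\` E))//.
  - by congr integral; rewrite setDD; apply/setIidPr => x [].
  - exact: measurableD.
  - exact/measurable_EFinP.
have mfE n : measurable_fun E (f n) by apply: measurable_funS (mf n) => // x [].
have mgD A : measurable_fun A g by exact: measurable_funS mg.
have ED x : E x -> D x by case.
exists g; split => //.
- move=> x; have [Ex|nEx] := pselect (E x); last by rewrite gN.
  apply: (@cvgr_to_ge _ _ _ _ _ _ _ (gE _ Ex)); apply: nearW => l.
  exact: f0 (ED _ Ex).
- by move=> x nDx; apply: gN => -[].
- move=> e e0; have [n0 Hn0] := f_cauchy e0; exists n0 => n n0n.
  have [l0 Hl0] : exists l0, forall l, (n0 <= psi (l + l0))%N.
    by exists n0 => l; rewrite /psi -addnA addnCA leq_addr.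
  rewrite int_E//; last first.
    by apply: measurableT_comp => //; exact: measurable_funB.
  apply: (@fatou_le _ _ _ mu E mE (fun l x => `|f n x - f (psi (l + l0)) x|)) => //.
  + by move=> l; apply: measurableT_comp => //; exact: measurable_funB.
  + move=> x Ex; apply: cvg_norm; apply: cvgB; first exact: cvg_cst.
    by have := gE x Ex; rewrite -(cvg_shiftn l0).
  + move=> l; apply: le_trans (Hn0 n (psi (l + l0)) n0n (Hl0 l)).
    rewrite [leRHS]int_E//.
    by apply: measurableT_comp => //; exact: measurable_funB.
- move=> c Hc; rewrite int_E//; last by move=> x _; exact: sqr_ge0.
    apply: (@fatou_le _ _ _ mu E mE (fun l x => f (psi l) x ^+ 2)) => //.
    + by move=> l; exact: measurable_funX.
    + by move=> l x _; exact: sqr_ge0.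
    + by move=> x Ex; exact: (cvgM (gE x Ex) (gE x Ex)).
    + move=> l; apply: le_trans (Hc (psi l)); rewrite [leRHS]int_E//.
        exact: measurable_funX.
      by move=> x _; exact: sqr_ge0.
  exact: measurable_funX.
Qed.

End L1_completeness.

(** * Cluster points of the convolutions *)

Section convolution_compactness.
Context {R : realType} {N I : nat}.
Variables (T : R) (b : 'I_I -> (R * 'rV[R]_N) * 'rV[R]_I -> R)
  (r : 'I_I -> 'rV[R]_I -> R) (rho : 'I_I -> 'rV[R]_N -> R)
  (alpha : 'I_I -> R) (beta M C Cr m0 : R).
Hypothesis data : system_data T b r rho alpha beta M C Cr.

Let T0 := data_T_gt0 data.

(** [uniform_cluster] is used on triples [(j, (t, x))], periodicity reducing [x] to the unit cell.
    The defect [dlt n] in the time regularity is small only for large [n], which the threshold [n0]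
    of the net accommodates. *)
Lemma convolution_cluster (U : nat -> 'I_I -> R * 'rV[R]_N -> R)
    (Lam : R) (dlt : nat -> R) : 0 <= Lam ->
  (forall n t, 0 <= t < T -> admissible T M m0 (fun i x => U n i (t, x))) ->
  (forall n t t' j x, 0 <= t < T -> 0 <= t' < T ->
    `|convolve rho (fun i x => U n i (t, x)) x 0 j -
      convolve rho (fun i x => U n i (t', x)) x 0 j| <= (`|t - t'| + dlt n) * Lam) ->
  (forall e, 0 < e -> exists n0, forall n, (n0 <= n)%N -> dlt n <= e) ->
  exists w : R -> 'rV[R]_N -> 'rV[R]_I, forall e n, 0 < e -> exists k, (n <= k)%N /\
    forall t x j, 0 <= t < T ->
      `|convolve rho (fun i x => U k i (t, x)) x 0 j - w t x 0 j| <= e.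
Proof.
move=> Lam0 adm time dlt0.
pose F n (p : 'I_I * (R * 'rV[R]_N)) :=
  convolve rho (fun i x => U n i (p.2.1, x)) p.2.2 0 p.1.
pose D := [set p : 'I_I * (R * 'rV[R]_N) | 0 <= p.2.1 < T].
have FW n p : D p -> `|F n p| <= conv_bound T M Cr m0.
  move=> Dp; have /andP[a1 a2] := convolve_bounds data p.1 p.2.2 (adm n _ Dp).
  by rewrite ger0_norm.
have net e : 0 < e -> exists (G : finType) (net : G -> 'I_I * (R * 'rV[R]_N)) (n0 : nat),
     forall p, D p -> exists g, D (net g) /\
       forall n, (n0 <= n)%N -> `|F n p - F n (net g)| <= e.
  (* Moving in time costs [2 * e3 * Lam <= 2 * (e / 3)], half of it for the defect [dlt n]; moving
     in space costs the last third. *)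
  move=> e0; pose e3 := e / (3 * (Lam + 1)).
  have L1 : 0 < Lam + 1 by rewrite ltr_pwDr.
  have e30 : 0 < e3 by rewrite divr_gt0// mulr_gt0.
  have e3L : e3 * Lam <= e / 3.
    rewrite /e3 -mulrA ler_pM2l// invfM -mulrA ler_piMr// mulrC ler_pdivrMr// mul1r.
    by rewrite lerDl.
  have e_3 : 0 < e / 3 by rewrite divr_gt0.
  have [n0 Hn0] := dlt0 _ e30.
  have /choice[d Hd] : forall j : 'I_I, exists d, 0 < d /\ forall s x x',
      admissible T M m0 s -> ball x d x' ->
      `|convolve rho s x 0 j - convolve rho s x' 0 j| <= e / 3.
    move=> j; have [d d0 H] := convolve_unif m0 data j e_3.
    by exists d.
  have [m Hm] : exists m, (forall s : R, ball s e3 (disc m s)) /\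
      forall j (s : R), ball s (d j) (disc m s).
    have H1 : \forall m \near \oo, forall j : 'I_I, forall s : R, ball s (d j) (disc m s).
      apply: (@filter_forall nat _ (fun j m => forall s : R, ball s (d j) (disc m s)) \oo) => j.
      by apply: near_disc; case: (Hd j).
    have [m [? ?]] := filter_ex (filterI (near_disc e30) H1).
    by exists m.
  case: Hm => Hm1 Hm2.
  (* The largest time node may be [T], which is outside [D]; rounding a time [t < T] down selects a
     node before [T]. *)
  pose B := (Num.truncn (T * m.+1%:R)).+1.
  pose nt (g : 'I_I * 'I_B * {ffun 'I_N -> 'I_m.+1}) : 'I_I * (R * 'rV[R]_N) :=
    (g.1.1, ((g.1.2)%:R / m.+1%:R, \row_i ((g.2 i)%:R / m.+1%:R))).
  exists _, nt, n0 => -[j [t x]] Dp.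
  have /andP[t0 tT] : 0 <= t < T by exact: Dp.
  have trE (s : R) : 0 <= s -> disc m s = (Num.truncn (s * m.+1%:R))%:R / m.+1%:R.
    move=> s0; rewrite /disc; congr (_ / _).
    rewrite Num.Theory.truncn_floor mulr_ge0// natr_absz ger0_norm//.
    by rewrite Num.Theory.floor_ge0 mulr_ge0.
  have ktB : (Num.truncn (t * m.+1%:R) < B)%N.
    by rewrite ltnS Num.Theory.le_truncn// ler_pM2r// ltW.
  have kx (i : 'I_N) : (Num.truncn (frac_part x 0 i * m.+1%:R)%R < m.+1)%N.
    have /andP[x0 x1] := frac_cell x i.
    by rewrite Num.Theory.truncn_lt_nat ?mulr_ge0// gtr_pMl.
  exists ((j, Ordinal ktB), [ffun i => Ordinal (kx i)]).
  have E : nt ((j, Ordinal ktB), [ffun i => Ordinal (kx i)]) =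
      (j, (disc m t, \row_i disc m (frac_part x 0 i))).
    rewrite /nt/= -trE//; congr (_, (_, _)); apply/rowP => i; rewrite [LHS]mxE [RHS]mxE ffunE/= trE//.
    by have /andP[] := frac_cell x i.
  have t'T : 0 <= disc m t < T by rewrite disc_ge0//= (le_lt_trans (disc_le _ _)).
  split; first by rewrite E.
  move=> n n0n; rewrite E /F/=.
  have per s y : convolve rho s y 0 j = convolve rho s (frac_part y) 0 j.
    rewrite (@periodic_frac _ _ (fun y => convolve rho s y 0 j))// => i z.
    by rewrite (convolve_periodic data).
  rewrite (per _ x).
  have H1 := time n t (disc m t) j (frac_part x) Dp t'T.
  have H2 : `|convolve rho (fun i x => U n i (disc m t, x)) (frac_part x) 0 j -
     convolve rho (fun i x => U n i (disc m t, x)) (\row_i disc m (frac_part x 0 i)) 0 j| <= e / 3.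
    case: (Hd j) => dj0; apply; first exact: adm.
    by split => // p q; rewrite !mxE !ord1; exact: Hm2.
  have H3 : (`|t - disc m t| + dlt n) * Lam <= 2 * (e / 3).
    apply: (@le_trans _ _ ((e3 + e3) * Lam)); last by rewrite mulrDl; lra.
    by rewrite ler_wpM2r// lerD ?Hn0//; exact: ltW (Hm1 t).
  rewrite (_ : _ - _ =
    (convolve rho (fun i x => U n i (t, x)) (frac_part x) 0 j -
     convolve rho (fun i x => U n i (disc m t, x)) (frac_part x) 0 j) +
    (convolve rho (fun i x => U n i (disc m t, x)) (frac_part x) 0 j -
     convolve rho (fun i x => U n i (disc m t, x)) (\row_i disc m (frac_part x 0 i)) 0 j)); last by ring.
  apply: (le_trans (ler_normD _ _)); lra.
have [w Hw] := uniform_cluster FW net.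
exists (fun t x => \row_j w (j, (t, x))) => e n e0.
have [k [nk Hk]] := Hw e n e0; exists k; split => // t x j tT.
by rewrite mxE; exact: (Hk (j, (t, x))).
Qed.

(** Consistency of the scheme, with [w] known only through its distance to the convolutions [z]. The
    difference splits into the time quotient, the variation of [b], the discrete Laplacian, the
    variation of [r] and the variation of [phi] in time; each gets [e / 5]. *)
Lemma operator_close i phi e : test_function T phi -> 0 < e ->
  exists2 d, 0 < d & forall h tau k t x (z w : 'rV[R]_I),
    0 < h <= 1 -> h < d -> 0 < tau < d -> k%:R * tau <= t < k.+1%:R * tau ->
    0 <= t -> k.+1%:R * tau <= T -> torus_cell N x ->
    (forall j, 0 <= z 0 j <= conv_bound T M Cr m0) ->
    (forall j, `|z 0 j - w 0 j| < d) ->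
    `|time_derive phi (t, x) + b i ((t, x), w) * laplacian phi (t, x) +
       r i w * phi (t, x) -
      ((phi (k.+1%:R * tau, x) - phi (k%:R * tau, x)) / tau +
       b i ((k%:R * tau, x), z) * lap h (fun x => phi (k.+1%:R * tau, x)) x +
       r i z * phi (k.+1%:R * tau, x))| <= e.
Proof.
move=> tphi e0; set W := conv_bound T M Cr m0.
(* The margin [1] keeps [w] in the compact set once it is within [1] of [z]; hence the [1] in the
   minimum chosen below. *)
pose Kz := [set z : 'rV[R]_I | forall j, -1 <= z 0 j <= W + 1].
have cKz : compact Kz by exact: compact_box.
pose Kb : set ((R * 'rV[R]_N) * 'rV[R]_I) :=
  (`[0, T]%classic `*` [set x : 'rV[R]_N | forall i, 0 <= x 0 i <= 1]) `*` Kz.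
have cKb : compact Kb.
  apply: compact_setX => //; apply: compact_setX; [exact: segment_compact|exact: compact_box].
have cb : {within Kb, continuous (b i)}.
  have sub : Kb `<=` QT_closure N T `*` setT by move=> -[[t x] z] [[t0 _] _].
  by apply: (continuous_subspaceW sub); exact: (data_b_continuous data).
have cr : {within Kz, continuous (r i)}.
  by apply: continuous_subspaceT; exact: (data_r_continuous data).
have [Cp Cp0 HCp] := test_function_bounded tphi [::].
have /choice[Cl HCl] : forall j : 'I_N, exists c, forall t x, 0 <= t <= T -> torus_cell N x ->
    `|iter_derive phi [:: (0, delta_mx 0 j); (0, delta_mx 0 j)] (t, x)| <= c.
  by move=> j; have [c _ H] := test_function_bounded tphi [:: (0, delta_mx 0 j); (0, delta_mx 0 j)];
     exists c.
pose CL := \sum_(j < N) `|Cl j|.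
have HCL t x : 0 <= t <= T -> torus_cell N x -> `|laplacian phi (t, x)| <= CL.
  move=> tT cx; apply: le_trans (ler_norm_sum _ _ _) _; apply: ler_sum => j _.
  by apply: le_trans (HCl j t x tT cx) (ler_norm _).
have CL0 : 0 <= CL by apply: sumr_ge0 => j _.
have [Mr HMr] := compact_bounded_fun cKz cr.
pose Mr' := `|Mr|.
have HMr' z : Kz z -> `|r i z| <= Mr' by move=> /HMr H; exact: le_trans H (ler_norm _).
have Mr'0 : 0 <= Mr' by exact: normr_ge0.
(* [c] bounds the factor multiplying a small term; [c + 1] keeps the denominator positive. *)
have pos c : 0 <= c -> 0 < e / (5 * (c + 1)).
  by move=> c0; rewrite divr_gt0// mulr_gt0// ltr_pwDr.
have posE c : 0 <= c -> e / (5 * (c + 1)) * c <= e / 5.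
  move=> c0; rewrite invfM mulrA -mulrA ler_piMr ?divr_ge0 ?(ltW e0)//.
  by rewrite mulrC ler_pdivrMr ?mul1r ?lerDl// ltr_pwDr.
have e5 : 0 < e / 5 by rewrite divr_gt0.
have [d1 d10 H1] := time_derive_quotient tphi e5.
have [d2 d20 H2] := lap_laplacian tphi (pos _ (normr_ge0 beta)).
have [d3 d30 H3] := compact_unif_continuous cKb cb (pos _ CL0).
have [d4 d40 H4] := compact_unif_continuous cKz cr (pos _ Cp0).
have [d5 d50 H5] := test_function_unif tphi (pos _ Mr'0).
exists (Num.min 1 (Num.min (Num.min d1 d2) (Num.min (Num.min d3 d4) d5))).
  by rewrite !lt_min ltr01 d10 d20 d30 d40 d50.
move=> h tau k t x z w h01; rewrite !lt_min.
move=> /and3P[_ /andP[_ hd2] _].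
move=> /andP[tau0 /and3P[_ /andP[taud1 taud2] /andP[/andP[taud3 _] taud5]]].
move=> /andP[kt tk] t0 kT cx z01 zw.
have zw' j : [/\ `|z 0 j - w 0 j| < 1, `|z 0 j - w 0 j| < d3 & `|z 0 j - w 0 j| < d4].
  by have := zw j; rewrite !lt_min => /and3P[-> _ /andP[/andP[-> ->] _]].
have Kzz : Kz z.
  by move=> j; have /andP[z1 z2] := z01 j; clear -T0 data m0 z1 z2; apply/andP; split; lra.
have Kzw : Kz w.
  move=> j; have /andP[z1 z2] := z01 j; have [+ _ _] := zw' j.
  rewrite ltr_norml => /andP[z3 z4].
  by clear -T0 data m0 z1 z2 z3 z4; apply/andP; split; lra.
have kS : k.+1%:R * tau = k%:R * tau + tau by rewrite -natr1 mulrDl mul1r.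
have k0 : 0 <= k%:R * tau by rewrite mulr_ge0// ltW.
set t1 := k%:R * tau in kt k0 kS *; set t2 := k.+1%:R * tau in tk kT kS *.
have tT : 0 <= t <= T by rewrite t0/=; clear -T0 data m0 tk kT; lra.
have t1T : 0 <= t1 <= T by rewrite k0/=; clear -T0 data m0 kT kS tau0; lra.
have t2T : 0 <= t2 <= T by clear -T0 data m0 kT kS tau0 k0; apply/andP; split; lra.
have cx1 j : 0 <= x 0 j <= 1 by have /andP[-> /ltW ->] := cx j.
have A1 : `|(phi (t2, x) - phi (t1, x)) / tau - time_derive phi (t, x)| <= e / 5.
  have -> : tau = t2 - t1 by rewrite kS; ring.
  by apply: H1 => //; clear -T0 data m0 kt tk kS tau0 taud1; [lra|apply/andP; split; lra|lra].
have A2 : `|lap h (fun x => phi (t2, x)) x - laplacian phi (t, x)| <= e / (5 * (`|beta| + 1)).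
  by apply: H2 => //; rewrite ltr_norml; clear -T0 data m0 kt tk kS tau0 taud2; apply/andP; split; lra.
have A3 : `|b i ((t, x), w) - b i ((t1, x), z)| <= e / (5 * (CL + 1)).
  apply: H3.
  - by do 2!split => //=; rewrite in_itv.
  - by do 2!split => //=; rewrite in_itv.
  - split => /=; first (split => /=; last exact: ballxx).
      by rewrite /ball/= ltr_norml; clear -T0 data m0 kt tk kS tau0 taud3; apply/andP; split; lra.
    by split => // p q; rewrite !ord1 /ball/= distrC; have [] := zw' q.
have A4 : `|r i w - r i z| <= e / (5 * (Cp + 1)).
  apply: H4 => //; split => // p q; rewrite !ord1 /ball/= distrC; by have [] := zw' q.
have A5 : `|phi (t, x) - phi (t2, x)| <= e / (5 * (Mr' + 1)).
  by apply: H5 => //; rewrite ltr_norml; clear -T0 data m0 kt tk kS tau0 taud5; apply/andP; split; lra.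
have bz : `|b i ((t1, x), z)| <= `|beta|.
  have /andP[b1 b2] := @data_b_bounds _ _ _ _ _ _ _ _ _ _ _ _ data i (t1, x) z
     ltac:(by split => //=; rewrite in_itv).
  have b0 : 0 <= b i ((t1, x), z) by exact: le_trans (ltW (data_alpha_gt0 data i)) b1.
  by rewrite ger0_norm// (le_trans b2)// ler_norm.
have L1 := HCL t x tT cx; have P1 := HCp t x tT cx; have R1 := HMr' z Kzz.
rewrite (_ : _ - _ = - ((phi (t2, x) - phi (t1, x)) / tau - time_derive phi (t, x)) +
  (b i ((t, x), w) - b i ((t1, x), z)) * laplacian phi (t, x) -
  b i ((t1, x), z) * (lap h (fun x => phi (t2, x)) x - laplacian phi (t, x)) +
  (r i w - r i z) * phi (t, x) + r i z * (phi (t, x) - phi (t2, x))); last by ring.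
have Q1 : `|(b i ((t, x), w) - b i ((t1, x), z)) * laplacian phi (t, x)| <= e / 5.
  rewrite normrM; apply: le_trans (posE _ CL0); exact: ler_pM.
have Q2 : `|b i ((t1, x), z) * (lap h (fun x => phi (t2, x)) x - laplacian phi (t, x))| <= e / 5.
  rewrite normrM mulrC; apply: le_trans (posE _ (normr_ge0 beta)); exact: ler_pM.
have Q3 : `|(r i w - r i z) * phi (t, x)| <= e / 5.
  rewrite normrM; apply: le_trans (posE _ Cp0); exact: ler_pM.
have Q4 : `|r i z * (phi (t, x) - phi (t2, x))| <= e / 5.
  rewrite normrM mulrC; apply: le_trans (posE _ Mr'0); exact: ler_pM.
move: A1 Q1 Q2 Q3 Q4; rewrite !ler_norml => /andP[a1 a2] /andP[b1 b2] /andP[c1 c2]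
  /andP[f1 f2] /andP[g1 g2].
by clear -T0 data m0 a1 a2 b1 b2 c1 c2 f1 f2 g1 g2; apply/andP; split; lra.
Qed.

End convolution_compactness.

(** * Convex combinations converging in L^2 *)

Section midpoint_convexity.
Context {R : realType} {N I : nat} (T : R).
Hypothesis T0 : 0 < T.

Let V := 'I_I -> R * 'rV[R]_N -> R.
Implicit Types u v : V.

(** Dyadic convex combinations: midpoints are what the parallelogram law calls for, and properties
    stable under averaging pass by induction. *)
Inductive midpoint_closure (P : V -> Prop) : V -> Prop :=
| midpoint_base v : P v -> midpoint_closure P v
| midpoint_avg u v : midpoint_closure P u -> midpoint_closure P v ->
    midpoint_closure P (fun i p => 2^-1 * (u i p + v i p)).

Lemma midpoint_closureS (P Q : V -> Prop) v :
  (forall v, P v -> Q v) -> midpoint_closure P v -> midpoint_closure Q v.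
Proof.
move=> PQ; elim=> [w /PQ|u w _ Hu _ Hw]; first exact: midpoint_base.
exact: midpoint_avg.
Qed.

(** Summing over the species lets one sequence of convex combinations serve them all. *)
Definition energy v := \sum_(i < I) integral_QT T (fun p => v i p ^+ 2).

Lemma qfun_sqr (f : R * 'rV[R]_N -> R) : qfun T f -> qfun T (fun p => f p ^+ 2).
Proof. by move=> qf; rewrite (_ : (fun p => _) = fun p => f p * f p)//; exact: bmfM. Qed.

Lemma energy_ge0 v : 0 <= energy v.
Proof. by apply: sumr_ge0 => i _; apply: integral_QT_ge0 => p _; exact: sqr_ge0. Qed.

Lemma qfun_midpoint (f g : R * 'rV[R]_N -> R) : qfun T f -> qfun T g ->
  qfun T (fun p => 2^-1 * (f p + g p)).
Proof. by move=> qf qg; apply: bmfM; [exact: bmf_cst|exact: bmfD]. Qed.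

Lemma midpoint_qfun (P : V -> Prop) v : (forall w, P w -> forall i, qfun T (w i)) ->
  midpoint_closure P v -> forall i, qfun T (v i).
Proof.
move=> HP; elim=> [w /HP//|u w _ Hu _ Hw i].
exact: qfun_midpoint.
Qed.

Lemma parallelogram u v : (forall i, qfun T (u i)) -> (forall i, qfun T (v i)) ->
  energy (fun i p => u i p - v i p) =
  2 * energy u + 2 * energy v - 4 * energy (fun i p => 2^-1 * (u i p + v i p)).
Proof.
move=> qu qv; have T0' := ltW T0.
rewrite /energy !mulr_sumr -big_split/= -sumrB; apply: eq_bigr => i _.
have qu2 := qfun_sqr (qu i); have qv2 := qfun_sqr (qv i).
have qm := qfun_sqr (qfun_midpoint (qu i) (qv i)).
have qZ c f : qfun T f -> qfun T (fun p => c * f p).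
  by move=> qf; apply: bmfM => //; exact: bmf_cst.
rewrite -!integral_QTZ// -integral_QTD//; [|exact: qZ..].
rewrite -integral_QTB//; [|by apply: bmfD; exact: qZ|exact: qZ].
by apply: eq_integral_QT => p _; field.
Qed.

(* In a Hilbert space a bounded sequence has convex combinations of its tails
   which converge strongly: take almost-minimisers of the norm over the
   midpoint closures of the tails, which are Cauchy by the parallelogram law. *)
Lemma tail_midpoints_cauchy (u : nat -> V) (B : R) :
  (forall n i, qfun T (u n i)) -> (forall n, energy (u n) <= B) ->
  exists v : nat -> V,
    (forall n, midpoint_closure (fun w => exists k, (n <= k)%N /\ w = u k) (v n)) /\
    forall e, 0 < e -> exists n0, forall n m, (n0 <= n)%N -> (n0 <= m)%N ->
      energy (fun i p => v n i p - v m i p) <= e.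
Proof.
move=> qu uB.
pose tail n w := exists k, (n <= k)%N /\ w = u k.
pose E n := [set energy w | w in midpoint_closure (tail n)].
have qtail n w : midpoint_closure (tail n) w -> forall i, qfun T (w i).
  by apply: midpoint_qfun => _ [k [_ ->]].
have utail n : midpoint_closure (tail n) (u n) by apply: midpoint_base; exists n.
have hE n : has_inf (E n).
  split; first by exists (energy (u n)), (u n).
  by exists 0 => _ [w _ <-]; exact: energy_ge0.
pose A n := inf (E n).
have AB n : A n <= B.
  by apply: le_trans (uB n); apply: ge_inf; [case: (hE n)|exists (u n)].
have Ale n w : midpoint_closure (tail n) w -> A n <= energy w.
  by move=> tw; apply: ge_inf; [case: (hE n)|exists w].
have tailS n m w : (n <= m)%N -> midpoint_closure (tail m) w -> midpoint_closure (tail n) w.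
  move=> nm; apply: midpoint_closureS => _ [k [mk ->]].
  by exists k; split => //; exact: leq_trans mk.
have /choice[v Hv] n : exists w, midpoint_closure (tail n) w /\ energy w < A n + n.+1%:R^-1.
  have n0 : 0 < n.+1%:R^-1 :> R by rewrite invr_gt0.
  have [_ [w tw <-] ?] := inf_adherent n0 (hE n).
  by exists w.
exists v; split=> [n|e e0]; first by case: (Hv n).
have hS : has_sup (range A).
  by split; [exists (A 0%N), 0%N|exists B => _ [n _ <-]].
pose S := sup (range A).
have AS n : A n <= S by apply: ub_le_sup; [case: hS|exists n].
(* With [S] the supremum of the tail infima, the parallelogram law gives at most [2 * (S + e / 8) +
   2 * (S + e / 8) - 4 * (S - e / 8) = e]. *)
have e40 : 0 < e / 8 by rewrite divr_gt0.
have [_ [n1 _ <-] Sn1] := sup_adherent e40 hS.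
have [n2 Hn2] : exists n2, forall n, (n2 <= n)%N -> n.+1%:R^-1 <= e / 8.
  have := near_infty_natSinv_lt (PosNum e40) => -[n2 _ H2].
  by exists n2 => n n2n; apply: ltW; exact: H2.
exists (maxn n1 n2) => n m; rewrite !geq_max => /andP[n1n n2n] /andP[n1m n2m].
have [tn En] := Hv n; have [tm Em] := Hv m.
rewrite parallelogram; [|exact: qtail tn|exact: qtail tm].
have Hmid : A n1 <= energy (fun i p => 2^-1 * (v n i p + v m i p)).
  by apply: Ale; apply: midpoint_avg; [exact: tailS tn|exact: tailS tm].
have := AS n; have := AS m; move: Sn1 (Hn2 _ n2n) (Hn2 _ n2m) En Em.
by rewrite -/S; move: (n.+1%:R^-1 : R) (m.+1%:R^-1 : R) => x y; lra.
Qed.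

(** The pointwise inequality [|f| <= e + f ^+ 2 / e], integrated: Cauchy-Schwarz in the form with a
    free parameter. *)
Lemma l1_of_l2 (f : R * 'rV[R]_N -> R) (e : R) : 0 < e -> qfun T f ->
  integral_QT T (fun p => `|f p|) <= e * T + e^-1 * integral_QT T (fun p => f p ^+ 2).
Proof.
move=> e0 qf; have T0' := ltW T0; have qf2 := qfun_sqr qf.
rewrite -(integral_QT_cst (N := N) T0') -integral_QTZ// -integral_QTD//; last 2 first.
  exact: bmf_cst.
  by apply: bmfM => //; exact: bmf_cst.
apply: le_integral_QT => //; first exact: qfun_norm.
  by apply: bmfD; [exact: bmf_cst|apply: bmfM => //; exact: bmf_cst].
move=> p _; rewrite -real_normK ?num_real//.
rewrite -(ler_pM2l e0) mulrDr mulrA mulfV ?gt_eqF// mul1r.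
by have := sqr_ge0 (e - `|f p|); rewrite sqrrB; nra.
Qed.

End midpoint_convexity.

(** * Initial data *)

Section Lp_lemmas.
Context d (X : measurableType d) (R : realType) (mu : {measure set X -> \bar R}).
Variable (D : set X).
Hypothesis mD : measurable D.

Lemma Lp_on_measurable (p : R) (f : X -> R) : Lp_on mu D p f -> measurable_fun D f.
Proof. by move=> /sub_Lfun_mfun; rewrite inE/= => /(measurable_restrictT _ mD). Qed.

Lemma Lp_on1 (f : X -> R) : Lp_on mu D 1 f <-> mu.-integrable D (EFin \o f).
Proof.
rewrite /Lp_on; split=> [/Lfun1_integrable|H].
  by move=> H; apply/(integrable_mkcond _ mD).2; rewrite restrict_EFin.
by apply/Lfun1_integrable; have := (integrable_mkcond _ mD).1 H; rewrite restrict_EFin.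
Qed.

Lemma Lp_on2 (f : X -> R) : measurable_fun D f ->
  (\int[mu]_(x in D) (f x ^+ 2)%:E < +oo)%E -> Lp_on mu D 2 f.
Proof.
move=> mf int2; rewrite /Lp_on inE; apply/andP; split; rewrite inE/=.
  by apply/(measurable_restrictT _ mD).1.
rewrite /finite_norm unlock; apply: poweR_lty.
rewrite integral_mkcond in int2; apply: le_lt_trans int2.
rewrite le_eqVlt; apply/orP; left; apply/eqP; apply: eq_integral => x _ /=.
rewrite !patchE; case: ifPn => _ /=; rewrite ?poweR_EFin.
  by rewrite powR_mulrn// real_normK// num_real.
by rewrite normr0 powR0.
Qed.

Lemma Lp_on2_sqr (f : X -> R) : Lp_on mu D 2 f ->
  mu.-integrable D (fun x => (f x ^+ 2)%:E).
Proof.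
move=> /Lfun2_integrable_sqr H; apply/(integrable_mkcond _ mD).2.
apply: eq_integrable H => // x _ /=.
by rewrite !patchE; case: ifPn => //; rewrite expr0n.
Qed.

End Lp_lemmas.

Section initial_data.
Context {R : realType} {N : nat}.

Notation J := (@integral_torus R N).

Let mC := @measurable_torus_cell R N.

(** The datum is measurable only on the cell and non-negative only almost everywhere, whereas the
    scheme evaluates shifted values everywhere. The periodic extension of its positive part can
    replace it, since the datum enters the weak form through integrals against periodic
    functions. *)
Lemma initial_data (f : 'rV[R]_N -> R) : Lp_torus 2 f ->
  {ae lebesgue_rV N, forall x, torus_cell N x -> 0 <= f x} ->
  exists g : 'rV[R]_N -> R,
  [/\ measurable_fun setT g, torus_periodic g, forall x, 0 <= g x,
      (lebesgue_rV N).-integrable (torus_cell N) (EFin \o g) &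
      (lebesgue_rV N).-integrable (torus_cell N) (fun x => (g x ^+ 2)%:E)] /\
  Lp_torus 1 f /\ forall phi, tfun phi -> J (fun x => f x * phi x) = J (fun x => g x * phi x).
Proof.
move=> f2 f0.
have mf : measurable_fun (torus_cell N) f by exact: Lp_on_measurable f2.
have mfC : measurable_fun setT (f \_ (torus_cell N)).
  exact: (measurable_restrictT _ mC).1 mf.
pose g x := Num.max 0 ((f \_ (torus_cell N)) (frac_part x)).
have mg : measurable_fun setT g.
  apply: measurable_maxr; first exact: measurable_cst.
  exact: (measurableT_comp mfC measurable_frac).
have g0 x : 0 <= g x by rewrite /g le_max lexx.
have gE x : torus_cell N x -> 0 <= f x -> g x = f x.
  by move=> cx fx; rewrite /g frac_id// patchE mem_set//; exact/max_idPr.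
have glef x : torus_cell N x -> g x <= `|f x|.
  by move=> cx; rewrite /g frac_id// patchE mem_set// ge_max normr_ge0 ler_norm.
have if2 := Lp_on2_sqr mC f2.
have mgC : measurable_fun (torus_cell N) g by exact: measurable_funS mg.
have ig2 : (lebesgue_rV N).-integrable (torus_cell N) (fun x => (g x ^+ 2)%:E).
  apply: le_integrable if2 => //.
    by apply/measurable_EFinP; exact: measurable_funX.
  move=> x cx /=; rewrite lee_fin !ger0_norm ?sqr_ge0//.
  rewrite -[leRHS]real_normK ?num_real//.
  by rewrite ler_sqr ?nnegrE// glef.
have i12 : (lebesgue_rV N).-integrable (torus_cell N) (fun x => (1 + f x ^+ 2)%:E).
  rewrite (_ : (fun x => _) = cst 1%:E \+ (fun x => (f x ^+ 2)%:E))%E; last first.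
    by apply/funext => x; rewrite EFinD.
  apply: integrableD => //.
  exact: (tfun_integrable (tfun_cst 1)).
(* L^2 is contained in L^1 on the cell, by [|f| <= 1 + f ^+ 2]. *)
have L1 (h : 'rV[R]_N -> R) : measurable_fun (torus_cell N) h ->
    (forall x, torus_cell N x -> `|h x| <= `|f x|) ->
    (lebesgue_rV N).-integrable (torus_cell N) (EFin \o h).
  move=> mh hf; apply: le_integrable i12 => //; first exact/measurable_EFinP.
  move=> x cx /=; rewrite lee_fin; apply: le_trans (hf _ cx) _.
  rewrite [leRHS]ger0_norm ?addr_ge0 ?sqr_ge0//.
  have : 0 <= (1 - `|f x|) ^+ 2 by exact: sqr_ge0.
  by rewrite sqrrB real_normK ?num_real// => ?; have := normr_ge0 (f x); lra.
have if1 : (lebesgue_rV N).-integrable (torus_cell N) (EFin \o f) by exact: L1.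
have ig1 : (lebesgue_rV N).-integrable (torus_cell N) (EFin \o g).
  by apply: L1 => // x cx; rewrite ger0_norm ?glef.
exists g; split.
  by split => // i x; rewrite /g frac_periodic.
split; first exact/(Lp_on1 _ mC f).2.
move=> phi tphi.
rewrite /integral_torus /Rintegral; congr fine.
have [[mphi [D HD]] _] := tphi.
have mphiC : measurable_fun (torus_cell N) phi by exact: measurable_funS mphi.
apply: ae_eq_integral => //.
- by apply/measurable_EFinP; exact: measurable_funM.
- by apply/measurable_EFinP; exact: measurable_funM.
- by apply: filterS f0 => x H cx; rewrite gE// H.
Qed.

(** The scheme runs on bounded data. Where the truncation is active, [g - s <= g <= g ^+ 2 / n.+1],
    so the L^2 bound turns into a rate of convergence. *)
Lemma truncation (g : 'rV[R]_N -> R) (n : nat) :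
  measurable_fun setT g -> torus_periodic g -> (forall x, 0 <= g x) ->
  (lebesgue_rV N).-integrable (torus_cell N) (EFin \o g) ->
  (lebesgue_rV N).-integrable (torus_cell N) (fun x => (g x ^+ 2)%:E) ->
  let s x := Num.min (g x) n.+1%:R in
  [/\ tfun s, forall x, 0 <= s x, J s <= J g, J (fun x => s x ^+ 2) <= J (fun x => g x ^+ 2) &
   forall phi C, tfun phi -> (forall x, `|phi x| <= C) ->
    `|J (fun x => g x * phi x) - J (fun x => s x * phi x)| <=
      C / n.+1%:R * J (fun x => g x ^+ 2)].
Proof.
move=> mg pg g0 ig ig2 s.
have s0 x : 0 <= s x by rewrite /s le_min g0/=.
have sg x : s x <= g x by rewrite /s ge_min lexx.
have n0 : 0 < n.+1%:R :> R by [].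
have ts : tfun s.
  split; last by move=> i x; rewrite /s pg.
  split; first by apply: measurable_minr => //; exact: measurable_cst.
  by exists n.+1%:R => x _; rewrite ger0_norm// /s ge_min lexx orbT.
have is_ := tfun_integrable ts.
split => //.
- by apply: le_Rintegral.
- apply: le_Rintegral => //; first exact: tfun_integrable (tfun_sqr ts).
  by move=> x _; rewrite ler_sqr ?nnegrE.
move=> phi C tphi HC.
have C0 : 0 <= C by exact: le_trans (HC 0).
have [[mphi _] _] := tphi.
have igp : (lebesgue_rV N).-integrable (torus_cell N) (EFin \o (fun x => g x * phi x)).
  have iC : (lebesgue_rV N).-integrable (torus_cell N) (fun x => (C%:E * (g x)%:E)%E).
    exact: integrableZl.
  apply: le_integrable iC => //.
    by apply/measurable_EFinP; apply: measurable_funS (measurable_funM mg mphi).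
  move=> x _ /=; rewrite lee_fin !normrM (ger0_norm C0) mulrC ler_wpM2r//.
have isp := tfun_integrable (tfunM ts tphi).
rewrite /integral_torus -RintegralB//.
apply: le_trans (le_normr_Rintegral _ _) _ => //.
  by apply: eq_integrable (integrableB mC igp isp) => // x _ /=; rewrite EFinB.
rewrite -RintegralZl//; apply: le_Rintegral => //.
- have := integrableB mC igp isp.
  move=> /integrable_norm; rewrite /comp/=; apply: eq_integrable => // x _ /=.
- have := integrableZl mC (C / n.+1%:R) ig2.
  by apply: eq_integrable => // x _.
- move=> x _; rewrite -mulrBl normrM mulrC (ger0_norm (_ : 0 <= g x - s x)) ?subr_ge0//.
  rewrite -mulrA; apply: ler_pM => //; first by rewrite subr_ge0.
  rewrite /s; case: (leP (g x) n.+1%:R) => gn.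
    by rewrite subrr mulr_ge0 ?sqr_ge0// invr_ge0.
  rewrite mulrC ler_pdivlMr// expr2.
  apply: (@le_trans _ _ (g x * n.+1%:R)); first by rewrite ler_wpM2r// lerBlDr lerDl.
  by rewrite ler_wpM2l// ltW.
Qed.

End initial_data.

(** * Coefficients of the limit system *)

Section test_function_qfun.
Context {R : realType} {N : nat} (T : R) (phi : R * 'rV[R]_N -> R).
Hypothesis tphi : test_function T phi.

Let QT_time (p : measurableTypeR R * 'rV[R]_N) : QT N T p -> 0 <= p.1 <= T.
Proof. by move=> [/=]; rewrite in_itv/= => /andP[-> /ltW]. Qed.

Lemma qfun_iter_derive vs : qfun T (iter_derive phi vs).
Proof.
split.
  rewrite (_ : iter_derive phi vs = fun p => iter_derive phi vs (p.1, p.2)); last first.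
    by apply/funext => -[].
  apply: (@measurable_time_space_comp R N T (iter_derive phi vs) _
    (measurableTypeR R * 'rV[R]_N)%type (QT N T) fst snd) => //.
  - exact: measurable_QT.
  - exact: (test_function_continuous tphi).
  - by apply: measurable_funTS; exact: measurable_fst.
  - move=> i; apply: measurable_funTS.
    exact: (measurableT_comp (measurable_coord i) measurable_snd).
have [C _ HC] := test_function_bounded tphi vs.
by exists C => -[t x] Q; apply: HC; [exact: (QT_time Q)|case: Q].
Qed.

Lemma qfun_laplacian : qfun T (laplacian phi).
Proof. by apply: bmf_sum => i _; exact: qfun_iter_derive. Qed.

End test_function_qfun.

Section coefficients.
Context {R : realType} {N I : nat}.
Variables (T : R) (b : 'I_I -> (R * 'rV[R]_N) * 'rV[R]_I -> R)
  (r : 'I_I -> 'rV[R]_I -> R) (rho : 'I_I -> 'rV[R]_N -> R)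
  (alpha : 'I_I -> R) (beta M C Cr m0 : R).
Hypothesis data : system_data T b r rho alpha beta M C Cr.
Variable w : R -> 'rV[R]_N -> 'rV[R]_I.
Hypothesis qw : forall j, qfun T (fun p => w p.1 p.2 0 j).

Let mQ := @measurable_QT R N T.

Let comp (f : (R * 'rV[R]_N) * 'rV[R]_I -> R) :
  {within QT_closure N T `*` setT, continuous f} ->
  measurable_fun (QT N T) ((fun p => f (p, w p.1 p.2)) : measurableTypeR R * 'rV[R]_N -> R).
Proof.
move=> cf; rewrite (_ : (fun p => _) = fun p => f ((p.1, p.2), w p.1 p.2)); last first.
  by apply/funext => -[].
apply: (@measurable_continuous_comp R N I T f _ (measurableTypeR R * 'rV[R]_N)%type
  (QT N T) fst snd (fun p => w p.1 p.2)) => //.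
- by move=> [t x] [/=]; rewrite in_itv/= => /andP[-> /ltW].
- by apply: measurable_funTS; exact: measurable_fst.
- move=> i; apply: measurable_funTS.
  exact: (measurableT_comp (measurable_coord i) measurable_snd).
- by move=> j; case: (qw j).
Qed.

Lemma qfun_coef i : qfun T (fun p => b i (p, w p.1 p.2)).
Proof.
split; first by apply: comp; exact: (data_b_continuous data).
exists beta => -[t x] [/= tT _].
have /andP[b1 b2] := @data_b_bounds _ _ _ _ _ _ _ _ _ _ _ _ data i (t, x) (w t x)
  ltac:(by split => //=; move: tT; rewrite !in_itv/= => /andP[-> /ltW]).
by rewrite ger0_norm// (le_trans (ltW (data_alpha_gt0 data i)) b1).
Qed.

Lemma qfun_rate i : qfun T (fun p => r i (w p.1 p.2)).
Proof.
split.
  apply: (comp (f := fun p => r i p.2)); apply: continuous_subspaceT => p.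
  by apply: (@continuous_comp _ _ _ snd (r i)); [exact: cvg_snd|exact: (data_r_continuous data)].
have /choice[D HD] j : exists c, forall p, QT N T p -> `|w p.1 p.2 0 j| <= c.
  by case: (qw j) => _.
exists (`|C| * (1 + \sum_(j < I) `|D j|)) => p Qp.
apply: le_trans (data_r_affine data i _) _.
apply: (@le_trans _ _ (`|C| * (1 + \sum_(j < I) `|w p.1 p.2 0 j|))).
  by rewrite ler_wpM2r ?ler_norm// addr_ge0// sumr_ge0.
rewrite ler_wpM2l// lerD2l; apply: ler_sum => j _.
exact: le_trans (HD j p Qp) (ler_norm _).
Qed.

Definition dual_operator i (phi : R * 'rV[R]_N -> R) p : R :=
  time_derive phi p + b i (p, w p.1 p.2) * laplacian phi p + r i (w p.1 p.2) * phi p.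

Lemma qfun_dual_operator i phi : test_function T phi -> qfun T (dual_operator i phi).
Proof.
move=> tphi; apply: bmfD; first apply: bmfD.
- exact: (qfun_iter_derive tphi [:: (1, 0)]).
- by apply: bmfM; [exact: qfun_coef|exact: qfun_laplacian].
- by apply: bmfM; [exact: qfun_rate|exact: (qfun_iter_derive tphi [::])].
Qed.

End coefficients.

(** * Approximating sequences *)

Section approximating_sequence.
Context {R : realType} {N I : nat}.
Variables (T : R) (b : 'I_I -> (R * 'rV[R]_N) * 'rV[R]_I -> R)
  (r : 'I_I -> 'rV[R]_I -> R) (rho : 'I_I -> 'rV[R]_N -> R)
  (alpha : 'I_I -> R) (beta M C Cr : R).
Hypothesis data : system_data T b r rho alpha beta M C Cr.

Notation J := (@integral_torus R N).

Let T0 := data_T_gt0 data.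

Lemma scheme_exists (m0 : R) (s0 : 'I_I -> 'rV[R]_N -> R) (n : nat) :
  (forall i, tfun (s0 i)) -> (forall i x, 0 <= s0 i x) -> (forall i, J (s0 i) <= m0) ->
  exists h tau K, scheme_data T beta M C Cr m0 h tau K s0 /\
    h = n.+1%:R^-1 /\ tau <= n.+1%:R^-1.
Proof.
move=> ts s00 sm; set h := n.+1%:R^-1 : R.
have n1 : 1 <= n.+1%:R :> R by rewrite ler1n.
have n0 : 0 < n.+1%:R :> R by [].
have h0 : 0 < h by rewrite invr_gt0.
have h1 : h <= 1 by rewrite invf_le1.
(* [K] is chosen with [T * X < K], so the single inequality [tau * X <= 1] gives both the step
   restriction and [tau <= 1 / n.+1]; [h] is fixed beforehand because the restriction involves
   [h ^+ 2]. *)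
pose X := n.+1%:R + `|4 * N%:R * beta / h ^+ 2 + @rate_bound R I T M C Cr m0|.
pose K := (Num.truncn (T * X)).+1.
have X0 : 0 < X by rewrite /X ltr_wpDr.
have KX : T * X < K%:R.
  by have /andP[_] := Num.Theory.truncn_itv (mulr_ge0 (ltW T0) (ltW X0)).
have K0 : 0 < K%:R :> R by [].
have tX : T / K%:R * X <= 1 by rewrite mulrAC ler_pdivrMr// mul1r ltW.
have t0 : 0 < T / K%:R by rewrite divr_gt0.
exists h, (T / K%:R), K; split; last split=> //.
  split => //.
  - by rewrite h0.
  - by rewrite mulrC divfK ?gt_eqF.
  - apply: le_trans tX; rewrite ler_pM2l// /X.
    by apply: le_trans (ler_norm _) _; rewrite lerDr ltW.
rewrite /h -[leRHS]div1r ler_pdivlMr//.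
by apply: le_trans tX; rewrite ler_pM2l// /X lerDl.
Qed.

Lemma approximating_sequence (g : 'I_I -> 'rV[R]_N -> R) (m0 := \sum_(i < I) J (g i)) :
  (forall i, [/\ measurable_fun setT (g i), torus_periodic (g i), forall x, 0 <= g i x,
      (lebesgue_rV N).-integrable (torus_cell N) (EFin \o g i) &
      (lebesgue_rV N).-integrable (torus_cell N) (fun x => (g i x ^+ 2)%:E)]) ->
  exists (W : nat -> 'I_I -> R * 'rV[R]_N -> R) (w : R -> 'rV[R]_N -> 'rV[R]_I) (B : 'I_I -> R),
  [/\ forall n i, qfun T (W n i),
      forall n t, 0 <= t < T -> admissible T M m0 (fun i x => W n i (t, x)),
      forall n i, integral_QT T (fun p => W n i p ^+ 2) <= B i,
      forall n t x j, 0 <= t < T ->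
        `|convolve rho (fun i x => W n i (t, x)) x 0 j - w t x 0 j| <= n.+1%:R^-1 &
      forall j, qfun T (fun p => w p.1 p.2 0 j)] /\
  forall i phi e, test_function T phi -> 0 < e -> exists n0, forall n, (n0 <= n)%N ->
    `|integral_QT T (fun p => W n i p * dual_operator b r w i phi p) +
      J (fun x => g i x * phi (0, x))| <= e.
Proof.
move=> Hg.
pose s0 n i x := Num.min (g i x) n.+1%:R.
have gm0 i : J (g i) <= m0.
  by rewrite /m0 (bigD1 i)//= lerDl sumr_ge0// => j _; apply: integral_torus_ge0; case: (Hg j).
have tr n i := let: And5 mg pg g0 ig ig2 := Hg i in truncation n mg pg g0 ig ig2.
have /choice[h_ /choice[tau_ /choice[K_ HK]]] n : exists h tau K,
    scheme_data T beta M C Cr m0 h tau K (s0 n) /\ h = n.+1%:R^-1 /\ tau <= n.+1%:R^-1.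
  apply: scheme_exists => i; case: (tr n i) => // _ _ H _ _.
  exact: le_trans H (gm0 i).
have sd n : scheme_data T beta M C Cr m0 (h_ n) (tau_ n) (K_ n) (s0 n) by case: (HK n).
pose U n := euler_approx b r rho (h_ n) (tau_ n) (s0 n).
have n0gt n : 0 < n.+1%:R :> R by [].
have small e : 0 < e -> exists n0, forall n, (n0 <= n)%N -> n.+1%:R^-1 < e :> R.
  by move=> e0; have [n1 _ H] := near_infty_natSinv_lt (PosNum e0); exists n1.
have [||||w Hw] := @convolution_cluster _ _ _ T b r rho alpha beta M C Cr m0 data U
    `|@time_lip R I T beta M C Cr m0| tau_.
- by [].
- by move=> n t tT; exact: (euler_approx_admissible data (sd n) tT).
- move=> n t t' j x tT t'T.
  apply: le_trans (euler_approx_time data (sd n) j x tT t'T) _.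
  by rewrite ler_wpM2l ?ler_norm// addr_ge0// ltW// (scheme_tau (sd n)).
- move=> e e0; have [n1 H] := small e e0; exists n1 => n n1n.
  by have [_ [_ H2]] := HK n; apply: le_trans H2 (ltW (H _ n1n)).
(* [k_] plays the part of a subsequence: [k_ n >= n], with error at most [1 / n.+1]. *)
have /choice[k_ Hk] n := Hw n.+1%:R^-1 n ltac:(by rewrite invr_gt0).
pose W n := U (k_ n).
have qconv n j : qfun T (fun p => convolve rho (fun i x => W n i (p.1, x)) p.2 0 j).
  exact: (euler_approx_convolve_qfun data (sd (k_ n))).
have adm n t : 0 <= t < T -> admissible T M m0 (fun i x => W n i (t, x)).
  by move=> tT; exact: (euler_approx_admissible data (sd (k_ n)) tT).
have close n t x j : 0 <= t < T ->
    `|convolve rho (fun i x => W n i (t, x)) x 0 j - w t x 0 j| <= n.+1%:R^-1.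
  by case: (Hk n) => _ H; exact: H.
have cb n t x j : 0 <= t < T ->
    0 <= convolve rho (fun i x => W n i (t, x)) x 0 j <= conv_bound T M Cr m0.
  by move=> tT; exact: (convolve_bounds data j x (adm n t tT)).
have QTt (p : R * 'rV[R]_N) : QT N T p -> 0 <= p.1 < T.
  by move=> [/=]; rewrite in_itv.
have qw j : qfun T (fun p => w p.1 p.2 0 j).
  split.
    apply: (@measurable_fun_cvg _ _ _ (QT N T)
      (fun n p => convolve rho (fun i x => W n i (p.1, x)) p.2 0 j)).
      by move=> n; case: (qconv n j).
    move=> p /QTt pT; apply/cvgrPdist_le => e e0; have [n1 H] := small e e0.
    exists n1 => // n /= n1n; rewrite distrC.
    exact: le_trans (close n p.1 p.2 j pT) (ltW (H _ n1n)).
  (* Comparison with the term of index [0], which is within [1] of [w]. *)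
  exists (conv_bound T M Cr m0 + 1) => p /QTt pT.
  have := close 0%N p.1 p.2 j pT; have /andP[] := cb 0%N p.1 p.2 j pT.
  by rewrite invr1 !ler_norml => c0 c1 /andP[? ?]; apply/andP; split; lra.
exists W, w, (fun i => expR (M * T) ^+ 2 * (4 * T * beta / alpha i) * J (fun x => g i x ^+ 2)).
split; first split => //.
- by move=> n i; exact: (euler_approx_qfun data (sd (k_ n))).
- move=> n i; apply: le_trans (euler_approx_l2 data (sd (k_ n)) i) _.
  have [_ _ _ H _] := tr (k_ n) i; apply: ler_wpM2l H.
  have b0 : 0 <= beta.
    have /andP[b1 b2] := @data_b_bounds _ _ _ _ _ _ _ _ _ _ _ _ data i (0, 0) 0
      ltac:(by split => //=; rewrite in_itv/= lexx ltW).
    exact: le_trans (ltW (data_alpha_gt0 data i)) (le_trans b1 b2).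
  by rewrite mulr_ge0 ?exprn_ge0 ?expR_ge0// divr_ge0 ?(ltW (data_alpha_gt0 data i))//
    !mulr_ge0// ltW.
move=> i phi e tphi e0.
have [Cp Cp0 HCp] := tfun_bounded (test_function_tfun tphi (t := 0) ltac:(by rewrite lexx ltW)).
set q := J (fun x => g i x ^+ 2).
have q0 : 0 <= q by apply: integral_torus_ge0 => x; exact: sqr_ge0.
have mb0 : 0 <= T * mass_bound T M m0.
  rewrite mulr_ge0 ?(ltW T0)// mulr_ge0 ?expR_ge0//.
  by apply: le_trans (gm0 i); apply: integral_torus_ge0; case: (Hg i).
(* Half of [e] goes to the consistency error, multiplied by the space-time mass, and half (through
   [e2]) to the truncation of the initial datum. *)
pose e1 := e / 2 / (T * mass_bound T M m0 + 1).
have e10 : 0 < e1 by rewrite !divr_gt0// ltr_pwDr.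
have e1b : e1 * (T * mass_bound T M m0) <= e / 2.
  by rewrite /e1 mulrAC ler_pdivrMr ?ltr_pwDr// ler_wpM2l ?divr_ge0 ?(ltW e0)// lerDl.
pose e2 := e / 2 / (Cp * q + 1).
have Cq0 : 0 <= Cp * q by rewrite mulr_ge0.
have e20 : 0 < e2 by rewrite !divr_gt0// ltr_pwDr.
have [d d0 Hd] := operator_close m0 data i tphi e10.
have [n1 H1] := small _ d0; have [n2 H2] := small _ e20.
exists (maxn n1 n2) => n; rewrite geq_max => /andP[n1n n2n].
have [nk _] := Hk n; set k := k_ n in nk *.
have [sdk [hE tauE]] := HK k.
have kn : k.+1%:R^-1 <= n.+1%:R^-1 :> R by rewrite lef_pV2 ?posrE// ler_nat.
have kd : k.+1%:R^-1 < d by exact: le_lt_trans kn (H1 _ n1n).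
have WE : `|integral_QT T (fun p => W n i p * dual_operator b r w i phi p) +
    J (fun x => s0 k i x * phi (0, x))| <= e1 * (T * mass_bound T M m0).
  apply: (euler_approx_weak_error data sdk tphi (ltW e10)).
    exact: (qfun_dual_operator data qw).
  move=> t x tT cx; have [kt kT] := step_index_bounds sdk tT.
  apply: (Hd (h_ k)) => //.
  - exact: scheme_h sdk.
  - by rewrite hE.
  - by rewrite (scheme_tau sdk)/= (le_lt_trans tauE).
  - by case/andP: tT.
  - by move=> j; exact: (cb n t x j tT).
  - by move=> j; apply: le_lt_trans (close n t x j tT) (H1 _ n1n).
have [_ _ _ _ HJ] := tr k i.
have WJ := HJ _ _ (test_function_tfun tphi (t := 0) ltac:(by rewrite lexx ltW)) HCp.
have HB : Cp / k.+1%:R * q <= e / 2.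
  rewrite mulrAC; apply: (@le_trans _ _ (Cp * q * e2)).
    by rewrite ler_wpM2l// (le_trans kn)// ltW// H2.
  by rewrite /e2 mulrC mulrAC ler_pdivrMr ?ltr_pwDr// ler_wpM2l ?divr_ge0 ?(ltW e0)// lerDl.
have WJ' := le_trans WJ HB; have WE' := le_trans WE e1b.
move: WE' WJ'; rewrite /s0 !ler_norml => /andP[? ?] /andP[? ?].
by apply/andP; split; lra.
Qed.

End approximating_sequence.

(** * Passage to the limit *)

Section limit_tools.
Context {R : realType}.

Lemma measurable_partial_integral d1 d2 (X : measurableType d1) (Y : measurableType d2)
    (mu : {sigma_finite_measure set Y -> \bar R}) (E : set Y) (f : X * Y -> \bar R) :
  measurable E -> measurable_fun [set: X * Y] f -> (forall p, 0 <= f p)%E ->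
  measurable_fun [set: X] (fun x => \int[mu]_(y in E) f (x, y))%E.
Proof.
move=> mE mf f0.
have mg : measurable_fun [set: X * Y] (f \_ (setT `*` E)).
  apply/(measurable_restrictT _ _).1; first exact: measurableX.
  exact: measurable_funS mf.
have g0 p : (0 <= (f \_ (setT `*` E)) p)%E by rewrite patchE; case: ifPn.
have := @measurable_fun_fubini_tonelli_F _ _ _ _ _ mu _ mg g0.
rewrite /fubini_F; congr (measurable_fun _ _); apply/funext => x.
rewrite [RHS]integral_mkcond; apply: eq_integral => y _.
by rewrite !patchE in_setX/= in_setT.
Qed.

Lemma integrable_mul_bmf d (X : measurableType d) (mu : {measure set X -> \bar R})
    (D : set X) (f psi : X -> R) : measurable D ->
  mu.-integrable D (EFin \o f) -> bmf D psi ->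
  mu.-integrable D (EFin \o (fun x => f x * psi x)).
Proof.
move=> mD If [mpsi [C HC]].
have mf : measurable_fun D f by apply/measurable_EFinP; exact: measurable_int If.
have IC : mu.-integrable D (fun x => (C%:E * (f x)%:E)%E) by exact: integrableZl.
apply: le_integrable IC => //; first by apply/measurable_EFinP; exact: measurable_funM.
move=> x Dx /=; rewrite lee_fin !normrM mulrC ler_wpM2r//.
exact: le_trans (HC x Dx) (ler_norm _).
Qed.

Lemma norm_Rintegral_mul_le d (X : measurableType d) (mu : {measure set X -> \bar R})
    (D : set X) (f g psi : X -> R) (C : R) (e : R) : measurable D ->
  mu.-integrable D (EFin \o f) -> mu.-integrable D (EFin \o g) ->
  measurable_fun D psi -> 0 <= C -> (forall x, D x -> `|psi x| <= C) ->
  (\int[mu]_(x in D) `|f x - g x|%:E <= e%:E)%E ->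
  `|\int[mu]_(x in D) (f x * psi x) - \int[mu]_(x in D) (g x * psi x)| <= C * e.
Proof.
move=> mD If Ig mpsi C0 HC fge.
have bpsi : bmf D psi by split => //; exists C.
have Ifp := integrable_mul_bmf mD If bpsi.
have Igp := integrable_mul_bmf mD Ig bpsi.
have Ifg : mu.-integrable D (EFin \o (fun x => f x - g x)).
  by apply: eq_integrable (integrableB mD If Ig) => // x _ /=; rewrite EFinB.
have Ifg_abs : mu.-integrable D (EFin \o (fun x => `|f x - g x|)).
  exact: integrable_norm Ifg.
have Idiff : mu.-integrable D (EFin \o (fun x => f x * psi x - g x * psi x)).
  by apply: eq_integrable (integrableB mD Ifp Igp) => // x _ /=; rewrite EFinB.
rewrite -RintegralB//; apply: le_trans (le_normr_Rintegral mD Idiff) _.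
apply: (@le_trans _ _ (C * \int[mu]_(x in D) `|f x - g x|)).
  rewrite -RintegralZl//; apply: le_Rintegral => //.
  - exact: (integrable_norm Idiff).
  - by apply: eq_integrable (integrableZl mD C Ifg_abs) => // x _.
  - by move=> x Dx; rewrite -mulrBl normrM mulrC ler_wpM2r// HC.
rewrite ler_wpM2l// /Rintegral -lee_fin fineK//.
exact: (integrable_fin_num mD Ifg_abs).
Qed.

End limit_tools.

Section midpoint_properties.
Context {R : realType} {N I : nat} (T : R).
Variables (rho : 'I_I -> 'rV[R]_N -> R) (w : R -> 'rV[R]_N -> 'rV[R]_I) (B : 'I_I -> R).
Hypotheses (T0 : 0 < T)
  (trho : forall j x, tfun (fun y => rho j (x - y))).

(** For fixed [w] every clause is convex in [v], hence survives midpoints. The last one is imposed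
    at every time of [[0, T[], not just almost every time. *)
Definition admissible_limit e (v : 'I_I -> R * 'rV[R]_N -> R) :=
  [/\ forall i, qfun T (v i),
      forall t i, 0 <= t < T -> tfun (fun x => v i (t, x)) /\ forall x, 0 <= v i (t, x),
      forall i, integral_QT T (fun p => v i p ^+ 2) <= B i &
      forall t x j, 0 <= t < T ->
        `|convolve rho (fun i x => v i (t, x)) x 0 j - w t x 0 j| <= e].

Lemma midpoint_admissible_limit e (P : ('I_I -> R * 'rV[R]_N -> R) -> Prop) v :
  (forall v, P v -> admissible_limit e v) -> midpoint_closure P v -> admissible_limit e v.
Proof.
move=> HP; have T0' := ltW T0; elim=> {v} [v /HP//|u v _ [u1 u2 u3 u4] _ [v1 v2 v3 v4]]; split.
- by move=> i; exact: qfun_midpoint.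
- move=> t i tT; have [a1 a2] := u2 t i tT; have [b1 b2] := v2 t i tT; split.
    by apply: tfunZ; exact: tfunD.
  by move=> x; rewrite mulr_ge0// addr_ge0.
- move=> i; have qu2 := qfun_sqr (u1 i); have qv2 := qfun_sqr (v1 i).
  have qZ c f : qfun T f -> qfun T (fun p => c * f p).
    by move=> qf; apply: bmfM => //; exact: bmf_cst.
  apply: (@le_trans _ _ (integral_QT T (fun p => 2^-1 * (u i p ^+ 2 + v i p ^+ 2)))).
    apply: le_integral_QT => //.
    + by apply: qfun_sqr; exact: qfun_midpoint.
    + by apply: qZ; exact: bmfD.
    + by move=> p _; have := sqr_ge0 (u i p - v i p); nra.
  rewrite integral_QTZ//; last exact: bmfD.
  by rewrite integral_QTD//; have := u3 i; have := v3 i; lra.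
- move=> t x j tT; have [a1 a2] := u2 t j tT; have [b1 b2] := v2 t j tT.
  have tu : tfun (fun y => u j (t, y) * rho j (x - y)) by exact: tfunM.
  have tv : tfun (fun y => v j (t, y) * rho j (x - y)) by exact: tfunM.
  have := u4 t x j tT; have := v4 t x j tT; rewrite !mxE.
  rewrite (@eq_integral_torus _ _ (fun y => 2^-1 * (u j (t, y) + v j (t, y)) * rho j (x - y))
    (fun y => 2^-1 * (u j (t, y) * rho j (x - y) + v j (t, y) * rho j (x - y)))); last first.
    by move=> y; ring.
  rewrite integral_torusZ; last exact: tfunD.
  rewrite integral_torusD// !ler_norml => /andP[? ?] /andP[? ?].
  by apply/andP; split; lra.
Qed.

(** With the coefficients frozen, [psi] does not depend on [v], so the defect is affine in [v]. *)
Lemma midpoint_weak (P : ('I_I -> R * 'rV[R]_N -> R) -> Prop) v i psi c e :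
  qfun T psi -> (forall v, P v -> qfun T (v i)) ->
  (forall v, P v -> `|integral_QT T (fun p => v i p * psi p) + c| <= e) ->
  midpoint_closure P v -> qfun T (v i) /\ `|integral_QT T (fun p => v i p * psi p) + c| <= e.
Proof.
move=> qpsi Pq HP; have T0' := ltW T0.
elim=> {v} [v Pv|u v _ [qu Hu] _ [qv Hv]]; first by split; [exact: Pq|exact: HP].
split; first exact: qfun_midpoint.
have q1 : qfun T (fun p => u i p * psi p) by exact: bmfM.
have q2 : qfun T (fun p => v i p * psi p) by exact: bmfM.
rewrite (@eq_integral_QT _ _ _ _ (fun p => 2^-1 * (u i p * psi p + v i p * psi p))); last first.
  by move=> p _; ring.
rewrite integral_QTZ//; last exact: bmfD.
rewrite integral_QTD//; move: Hu Hv; rewrite !ler_norml => /andP[? ?] /andP[? ?].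
by apply/andP; split; lra.
Qed.

End midpoint_properties.

Section existence.
Context {R : realType} {N I : nat}.
Variables (T : R) (b : 'I_I -> (R * 'rV[R]_N) * 'rV[R]_I -> R)
  (r : 'I_I -> 'rV[R]_I -> R) (rho : 'I_I -> 'rV[R]_N -> R)
  (alpha : 'I_I -> R) (beta M C Cr : R).
Hypothesis data : system_data T b r rho alpha beta M C Cr.

Notation J := (@integral_torus R N).
Notation mu := (@QT_measure R N).
Notation X := (measurableTypeR R * 'rV[R]_N)%type.

Let T0 := data_T_gt0 data.
Let mQ := @measurable_QT R N T.
Let mC := @measurable_torus_cell R N.

Let trho j x : tfun (fun y => rho j (x - y)).
Proof. by apply: smooth_kernel_refl; [exact: (data_rho_smooth data)|exact: (data_rho_periodic data)]. Qed.

Lemma EFin_integral_QT (f : R * 'rV[R]_N -> R) : qfun T f ->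
  (\int[mu]_(p in QT N T) (f p)%:E)%E = (integral_QT T f)%:E.
Proof.
by move=> qf; rewrite /integral_QT /Rintegral fineK//;
   exact: (integrable_fin_num mQ (qfun_integrable (ltW T0) qf)).
Qed.

Lemma strong_limit (g : 'I_I -> 'rV[R]_N -> R) :
  (forall i, [/\ measurable_fun setT (g i), torus_periodic (g i), forall x, 0 <= g i x,
      (lebesgue_rV N).-integrable (torus_cell N) (EFin \o g i) &
      (lebesgue_rV N).-integrable (torus_cell N) (fun x => (g i x ^+ 2)%:E)]) ->
  exists (v : nat -> 'I_I -> R * 'rV[R]_N -> R) (z : 'I_I -> X -> R)
    (w : R -> 'rV[R]_N -> 'rV[R]_I) (B : 'I_I -> R),
  [/\ forall j, qfun T (fun p => w p.1 p.2 0 j),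
      forall n, admissible_limit T rho w B n.+1%:R^-1 (v n),
      forall i, [/\ measurable_fun setT (z i), forall p, 0 <= z i p,
        forall e, 0 < e -> exists n0, forall n, (n0 <= n)%N ->
          (\int[mu]_(p in QT N T) `|v n i p - z i p|%:E <= e%:E)%E &
        (\int[mu]_(p in QT N T) (z i p ^+ 2)%:E < +oo)%E] &
      forall i phi, test_function T phi ->
        integral_QT T (fun p => z i p * dual_operator b r w i phi p) =
        - J (fun x => g i x * phi (0, x))].
Proof.
move=> Hg; have T0' := ltW T0.
have [W [w [B [[W1 W2 W3 W4 W5] W6]]]] := approximating_sequence data Hg.
have WB n : energy T (W n) <= \sum_(i < I) B i by apply: ler_sum => i _; exact: W3.
have [v [Hv Hc]] := tail_midpoints_cauchy T0 W1 WB.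
have vadm n : admissible_limit T rho w B n.+1%:R^-1 (v n).
  apply: midpoint_admissible_limit (Hv n) => // _ [k [nk ->]]; split => //.
    by move=> t i tT; case: (W2 k t tT i).
  move=> t x j tT; apply: le_trans (W4 k t x j tT) _.
  by rewrite lef_pV2 ?posrE// ler_nat.
have qv n i : qfun T (v n i) by case: (vadm n).
have mv n i : measurable_fun (QT N T : set X) (v n i : X -> R) by case: (qv n i).
have v0 n i p : QT N T p -> 0 <= v n i p.
  case: p => t x [/= + _]; rewrite in_itv/= => tT.
  by case: (vadm n) => _ /(_ t i tT)[_ H] _ _; exact: H.
have l1c i e : 0 < e -> exists n0, forall n m, (n0 <= n)%N -> (n0 <= m)%N ->
    (\int[mu]_(p in QT N T) `|v n i p - v m i p|%:E <= e%:E)%E.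
  (* Balances [l1_of_l2]: [a * T = e / 2], and an energy of at most [e / 2 * a] contributes another
     [e / 2]. *)
  move=> e0; pose a := e / (2 * T).
  have a0 : 0 < a by rewrite divr_gt0// mulr_gt0.
  have ea0 : 0 < e / 2 * a by rewrite mulr_gt0// divr_gt0.
  have [n0 Hn0] := Hc _ ea0; exists n0 => n m n0n n0m.
  have qd : qfun T (fun p => v n i p - v m i p) by apply: bmfB; exact: qv.
  rewrite EFin_integral_QT; last exact: qfun_norm.
  rewrite lee_fin; apply: le_trans (l1_of_l2 T0 a0 qd) _.
  have H2 : integral_QT T (fun p => (v n i p - v m i p) ^+ 2) <= e / 2 * a.
    apply: le_trans (Hn0 n m n0n n0m).
    rewrite /energy (bigD1 i)//= lerDl sumr_ge0// => j _.
    by apply: integral_QT_ge0 => p _; exact: sqr_ge0.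
  have -> : a * T = e / 2 by rewrite /a; field; rewrite gt_eqF.
  rewrite [leRHS](splitr e) lerD2l mulrC ler_pdivrMr//.
have /choice[z Hz] i := @L1_complete _ X R mu (QT N T) (fun n => v n i) mQ
  (fun n => mv n i) (fun n => v0 n i) (l1c i).
exists v, z, w, B; split => // [i|i phi tphi].
  have [z1 z2 _ z4 z5] := Hz i; split => //.
  apply: le_lt_trans (ltry (B i)); apply: z5 => n.
  rewrite EFin_integral_QT; last exact: qfun_sqr.
  by rewrite lee_fin; case: (vadm n).
have [z1 z2 _ z4 z5] := Hz i.
have qpsi := qfun_dual_operator data W5 i tphi.
have [mpsi [D HD]] := qpsi.
have D0 : 0 <= `|D| by [].
have HD' p : QT N T p -> `|dual_operator b r w i phi p| <= `|D|.
  by move=> Qp; apply: le_trans (HD p Qp) (ler_norm _).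
have Iv n : mu.-integrable (QT N T) (EFin \o v n i) by exact: qfun_integrable.
have mzQ : measurable_fun (QT N T) (z i) by exact: measurable_funS z1.
have Iz : mu.-integrable (QT N T) (EFin \o z i).
  have [n0 Hn0] := z4 1 ltr01.
  have Id : mu.-integrable (QT N T) (EFin \o (fun p => v n0 i p - z i p)).
    apply/integrableP; split; first by apply/measurable_EFinP; exact: measurable_funB.
    exact: le_lt_trans (Hn0 n0 (leqnn _)) (ltry _).
  apply: eq_integrable (integrableB mQ (Iv n0) Id) => // p _ /=.
  by rewrite -EFinB; congr EFin; ring.
set psi := dual_operator b r w i phi in qpsi mpsi HD HD' *.
apply/eqP; rewrite -subr_eq0 opprK -normr_eq0 eq_le normr_ge0 andbT.
apply/ler_addgt0Pr => e e0; rewrite add0r.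
have e20 : 0 < e / 2 by rewrite divr_gt0.
have eD0 : 0 < e / 2 / (`|D| + 1) by rewrite divr_gt0// ltr_pwDr.
have [n1 H1] := W6 i phi _ tphi e20; have [n2 H2] := z4 _ eD0.
pose n := maxn n1 n2.
have A1 : `|integral_QT T (fun p => v n i p * psi p) + J (fun x => g i x * phi (0, x))| <= e / 2.
  apply: (proj2 (midpoint_weak (N := N) T0 qpsi _ _ (Hv n))) => _ [k [nk ->]] //.
  by apply: H1; apply: leq_trans nk; exact: leq_maxl.
have A2 : `|integral_QT T (fun p => v n i p * psi p) - integral_QT T (fun p => z i p * psi p)|
    <= `|D| * (e / 2 / (`|D| + 1)).
  by apply: norm_Rintegral_mul_le => //; apply: H2; exact: leq_maxr.
have A3 : `|D| * (e / 2 / (`|D| + 1)) <= e / 2.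
  by rewrite mulrCA ler_piMr ?(ltW e20)// ler_pdivrMr ?mul1r ?lerDl// ltr_pwDr.
have A4 := le_trans A2 A3.
move: A1 A4; rewrite !ler_norml => /andP[? ?] /andP[? ?]; apply/andP; split; lra.
Qed.

End existence.

(** * Identification of the convolutions *)

Section solution.
Context {R : realType} {N I : nat}.
Variables (T : R) (b : 'I_I -> (R * 'rV[R]_N) * 'rV[R]_I -> R)
  (r : 'I_I -> 'rV[R]_I -> R) (rho : 'I_I -> 'rV[R]_N -> R)
  (alpha : 'I_I -> R) (beta M C Cr : R).
Hypothesis data : system_data T b r rho alpha beta M C Cr.

Notation J := (@integral_torus R N).
Notation mu := (@QT_measure R N).
Notation X := (measurableTypeR R * 'rV[R]_N)%type.

Let T0 := data_T_gt0 data.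
Let mQ := @measurable_QT R N T.
Let mC := @measurable_torus_cell R N.
Let mT : measurable (`[0, T[%classic : set (measurableTypeR R)) := measurable_itv _.

Let trho j x : tfun (fun y => rho j (x - y)).
Proof. by apply: smooth_kernel_refl; [exact: (data_rho_smooth data)|exact: (data_rho_periodic data)]. Qed.

Let Cr0 (j : 'I_I) : 0 <= Cr.
Proof. by apply: le_trans (data_rho_le data j 0). Qed.

(* Strong convergence in L^1(Q_T) gives, for almost every time, indices along
   which the slices converge in L^1 of the torus, hence convergence of the
   convolutions at every point. *)
Lemma good_times (v : nat -> 'I_I -> R * 'rV[R]_N -> R) (z : 'I_I -> X -> R)
    (w : R -> 'rV[R]_N -> 'rV[R]_I) (B : 'I_I -> R) :
  (forall n, admissible_limit T rho w B n.+1%:R^-1 (v n)) ->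
  (forall i, [/\ measurable_fun setT (z i), forall p, 0 <= z i p &
     forall e, 0 < e -> exists n0, forall n, (n0 <= n)%N ->
       (\int[mu]_(p in QT N T) `|v n i p - z i p|%:E <= e%:E)%E]) ->
  exists A : set (measurableTypeR R), [/\ measurable A, A `<=` `[0, T[%classic,
    lebesgue_measure (`[0, T[%classic `\` A) = 0%E &
    forall t, A t -> forall x j, J (fun y => z j (t, y) * rho j (x - y)) = w t x 0 j].
Proof.
move=> vadm Hz.
(* The added [1 / n.+1] ties the index to the error: a small integral of [err n] over a slice forces
   [n] to be large, so that the same index makes the slice close to [z] and its convolution close to
   [w]. *)
pose err n (p : X) := \sum_(i < I) `|((v n i : X -> R) \_ (QT N T)) p - z i p| + n.+1%:R^-1.
have err0 n p : 0 <= err n p by rewrite addr_ge0// sumr_ge0.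
have mvQ n i : measurable_fun [set: X] ((v n i : X -> R) \_ (QT N T)).
  by apply/(measurable_restrictT _ _).1 => //; case: (vadm n) => /(_ i)[].
have mz i : measurable_fun [set: X] (z i) by case: (Hz i).
have mabs n i : measurable_fun [set: X] (fun p => `|((v n i : X -> R) \_ (QT N T)) p - z i p|).
  by apply: measurableT_comp => //; exact: measurable_funB.
have merr n : measurable_fun [set: X] (fun p => (err n p)%:E).
  apply/measurable_EFinP; apply: measurable_funD => //.
  exact: measurable_sum.
have err0E n p : (0 <= (err n p)%:E)%E by rewrite lee_fin.
pose E n (t : measurableTypeR R) := (\int[lebesgue_rV N]_(y in torus_cell N) (err n (t, y))%:E)%E.
have mE n : measurable_fun setT (E n).
  exact: (measurable_partial_integral (lebesgue_rV N) mC (merr n) (err0E n)).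
have E0 n t : (0 <= E n t)%E by apply: integral_ge0.
(* Infimum over all [n] of the slice errors. Its integral is below that of each [E n], hence zero,
   so [H] vanishes almost everywhere; the index is then chosen separately at each time. *)
pose H t := einfs (fun n => E n t) 0%N.
have mH : measurable_fun setT H by apply: measurable_fun_einfs.
have H0 t : (0 <= H t)%E.
  by apply: le_ereal_inf_tmp => _ [n _ <-]; exact: E0.
have HE n t : (H t <= E n t)%E by apply: ereal_inf_lbound; exists n.
have intE n : (\int[lebesgue_measure]_(t in `[0%R, T[) E n t =
    \int[mu]_(p in QT N T) (err n p)%:E)%E.
  by rewrite -(restricted_tonelli1 lebesgue_measure (lebesgue_rV N) mT mC (merr n) (err0E n)).
have small e : 0 < e -> exists n, (\int[mu]_(p in QT N T) (err n p)%:E <= e%:E)%E.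
  (* The [I] species contribute [a] each, and the term [1 / n.+1] contributes [a * T]. *)
  move=> e0; pose a := e / (I%:R + T + 1).
  have IT0 : 0 < I%:R + T + 1 :> R by rewrite ltr_wpDl// addr_ge0// ltW.
  have a0 : 0 < a by rewrite divr_gt0.
  have /choice[n_ Hn] (i : 'I_I) : exists n0, forall n, (n0 <= n)%N ->
      (\int[mu]_(p in QT N T) `|v n i p - z i p|%:E <= a%:E)%E.
    by case: (Hz i) => _ _ /(_ a a0).
  have [n1 _ Hn1] := near_infty_natSinv_lt (PosNum a0).
  pose n := (n1 + \sum_(i < I) n_ i)%N; exists n.
  rewrite (eq_integral (fun p : X => (\sum_(i < I) `|v n i p - z i p|%:E + (n.+1%:R^-1)%:E)%E)); last first.
    move=> p Qp; rewrite /err EFinD -sumEFin; congr (_ + _)%E.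
    by apply: eq_bigr => i _; rewrite patchE Qp.
  have mvz i : measurable_fun (QT N T) (fun p : X => (`|v n i p - z i p|)%:E).
    apply/measurable_EFinP; apply: measurableT_comp => //; apply: measurable_funB.
      by case: (vadm n) => /(_ i)[].
    exact: measurable_funS (mz i).
  rewrite ge0_integralD//; [|by move=> p _; apply: sume_ge0 => i _; rewrite lee_fin|
    by apply: emeasurable_sum => i; exact: mvz].
  rewrite ge0_integral_sum//.
  rewrite integral_cst//.
  have -> : mu (QT N T) = T%:E by rewrite QT_measure_strip ?subr0// ltW.
  apply: (@le_trans _ _ (\sum_(i < I) a%:E + (a * T)%:E)%E).
    apply: leeD.
      apply: lee_sum => i _; apply: Hn.
      by rewrite /n (bigD1 i)//= addnCA leq_addr.
    rewrite -EFinM lee_fin ler_wpM2r ?ltW//; apply: Hn1.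
    by rewrite /= /n leq_addr.
  rewrite sumEFin -EFinD lee_fin sumr_const card_ord -[_ *+ I]mulr_natr -mulrDr.
  by rewrite /a mulrAC ler_pdivrMr// ler_wpM2l ?(ltW e0)// lerDl.
have intH : (\int[lebesgue_measure]_(t in `[0%R, T[) H t)%E = 0%E.
  apply/eqP; rewrite eq_le; apply/andP; split; last by apply: integral_ge0.
  apply/lee_addgt0Pr => e e0; rewrite add0e; have [n Hn] := small e e0.
  apply: le_trans Hn; rewrite -intE; apply: ge0_le_integral => //.
  - exact: measurable_funS mH.
  - exact: measurable_funS (mE n).
pose A := `[0, T[%classic `&` H @^-1` [set 0%E].
have mHT : measurable_fun (`[0, T[%classic : set (measurableTypeR R)) H.
  exact: measurable_funS mH.
have mA : measurable A by apply: mHT => //; exact: emeasurable_set1.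
exists A; split => //.
- by move=> t [].
- have : (\int[lebesgue_measure]_(t in `[0%R, T[) `|H t|)%E = 0%E.
    by rewrite -[RHS]intH; apply: eq_integral => t _; rewrite gee0_abs.
  move=> /(ae_eq_integral_abs _ mT mHT)[Z [mZ Z0 HZ]].
  apply/eqP; rewrite eq_le measure_ge0 andbT -Z0 le_measure ?inE//.
    exact: measurableD.
  by move=> t [tT nAt]; apply: HZ => /= /(_ tT) Ht; apply: nAt; split.
move=> t [tT Ht] x j.
have tT' : 0 <= t < T by move: tT; rewrite /= in_itv.
have Einf e : 0 < e -> exists n, (E n t < e%:E)%E.
  move=> e0; have : (H t < e%:E)%E by rewrite Ht lte_fin.
  by move=> /ereal_inf_lt[_ [n _ <-]]; exists n.
have slice n e : (E n t < e%:E)%E ->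
    (\int[lebesgue_rV N]_(y in torus_cell N) `|v n j (t, y) - z j (t, y)|%:E <= e%:E)%E /\
    n.+1%:R^-1 <= e.
  move=> En.
  have merrt : measurable_fun (torus_cell N) (fun y => (err n (t, y))%:E).
    apply: measurable_funTS.
    exact: (measurableT_comp (merr n) (pair1_measurable _)).
  have mvt : measurable_fun (torus_cell N) (fun y => `|v n j (t, y) - z j (t, y)|).
    apply: measurableT_comp => //; apply: measurable_funB.
      by case: (vadm n) => _ /(_ t j tT')[[[mv _] _] _] _ _; exact: measurable_funS mv.
    apply: measurable_funTS.
    exact: (measurableT_comp (mz j) (pair1_measurable _)).
  split.
    apply: le_trans (ltW En); apply: ge0_le_integral => //.
    - exact/measurable_EFinP.
    - move=> y cy; rewrite lee_fin /err (bigD1 j)//= patchE mem_set; last by split.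
      by rewrite -addrA lerDl addr_ge0// sumr_ge0.
  have : (\int[lebesgue_rV N]_(y in torus_cell N) (n.+1%:R^-1)%:E <= E n t)%E.
    apply: ge0_le_integral => //.
    - by move=> y cy; rewrite lee_fin /err lerDr sumr_ge0.
  rewrite integral_cst//.
  have -> : ((n.+1%:R^-1)%:E * lebesgue_rV N (@torus_cell R N) = (n.+1%:R^-1)%:E :> \bar R)%E.
    by rewrite (@lebesgue_torus_cell R N) mule1.
  by move=> H1; rewrite -lee_fin; apply: le_trans H1 (ltW En).
have mzt : measurable_fun (torus_cell N) (fun y => z j (t, y)).
  apply: measurable_funTS.
  exact: (measurableT_comp (mz j) (pair1_measurable _)).
have Ivt n : (lebesgue_rV N).-integrable (torus_cell N) (EFin \o (fun y => v n j (t, y))).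
  by apply: tfun_integrable; case: (vadm n) => _ /(_ t j tT')[].
have Izt : (lebesgue_rV N).-integrable (torus_cell N) (EFin \o (fun y => z j (t, y))).
  have [n En] := Einf _ (ltr01 : 0 < 1 :> R); have [Hn _] := slice n 1 En.
  have Id : (lebesgue_rV N).-integrable (torus_cell N)
      (EFin \o (fun y => v n j (t, y) - z j (t, y))).
    apply/integrableP; split; last exact: le_lt_trans Hn (ltry _).
    apply/measurable_EFinP; apply: measurable_funB => //.
    by apply/measurable_EFinP; exact: measurable_int (Ivt n).
  apply: eq_integrable (integrableB mC (Ivt n) Id) => // y _ /=.
  by rewrite -EFinB; congr EFin; ring.
apply/eqP; rewrite -subr_eq0 -normr_eq0 eq_le normr_ge0 andbT.
apply/ler_addgt0Pr => e e0; rewrite add0r.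
have C1 : 0 < Cr + 1 by rewrite ltr_wpDl// (Cr0 j).
have eC0 : 0 < e / (Cr + 1) by rewrite divr_gt0.
have [n En] := Einf _ eC0; have [Hn1 Hn2] := slice n _ En.
have [_ _ _ /(_ t x j tT')] := vadm n; rewrite mxE => Hw.
have [[mr _] _] := trho j x.
have mrC : measurable_fun (torus_cell N) (fun y => rho j (x - y)) by exact: measurable_funS mr.
have := norm_Rintegral_mul_le mC (Ivt n) Izt mrC (Cr0 j)
  (fun y _ => data_rho_le data j (x - y)) Hn1.
rewrite -/(integral_torus _) -/(integral_torus _) => Hz'.
have Hw' := le_trans Hw Hn2.
have Ee : Cr * (e / (Cr + 1)) + e / (Cr + 1) = e by field; rewrite gt_eqF.
move: Hz' Hw'; rewrite !ler_norml => /andP[? ?] /andP[? ?]; apply/andP; split; lra.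
Qed.

End solution.

(** * Existence *)

Section existence.
Context {R : realType} {N I : nat}.
Variables (T : R) (b : 'I_I -> (R * 'rV[R]_N) * 'rV[R]_I -> R)
  (r : 'I_I -> 'rV[R]_I -> R) (rho : 'I_I -> 'rV[R]_N -> R)
  (alpha : 'I_I -> R) (beta M C Cr : R).
Hypothesis data : system_data T b r rho alpha beta M C Cr.

Notation J := (@integral_torus R N).
Notation mu := (@QT_measure R N).
Notation X := (measurableTypeR R * 'rV[R]_N)%type.

Let T0 := data_T_gt0 data.
Let mQ := @measurable_QT R N T.
Let mC := @measurable_torus_cell R N.
Let mT : measurable (`[0, T[%classic : set (measurableTypeR R)) := measurable_itv _.

Lemma QT_null_slices (A : set (measurableTypeR R)) : measurable A ->
  lebesgue_measure (`[0, T[%classic `\` A) = 0%E ->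
  {ae mu, forall p, QT N T p -> A p.1}.
Proof.
move=> mA A0; exists ((`[0, T[%classic `\` A) `*` torus_cell N); split.
- by apply: measurableX => //; exact: measurableD.
- rewrite -[LHS]/((lebesgue_measure \x lebesgue_rV N)%E
    ((`[0, T[%classic `\` A) `*` torus_cell N)) product_measure1E//; last exact: measurableD.
  by rewrite -[RHS](mul0e (lebesgue_rV N (@torus_cell R N))); congr (_ * _)%E.
- move=> [t x] /= H; have [[tT cx]|nQ] := pselect (QT N T (t, x)); last first.
    by exfalso; apply: H => /nQ.
  by split => //; split => // At; apply: H.
Qed.

Lemma system_existence (uin : 'I_I -> 'rV[R]_N -> R) :
  (forall i, Lp_torus 2 (uin i) /\
     {ae lebesgue_rV N, forall x, torus_cell N x -> 0 <= uin i x}) ->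
  exists u : 'I_I -> R * 'rV[R]_N -> R,
    (forall i, [/\ forall t, torus_periodic (fun x => u i (t, x)),
       Lp_QT T 2 (u i) & forall p, 0 <= u i p]) /\
    (forall i, weak_solution T
       (fun p => b i (p, \row_j space_conv (u j) (rho j) p))
       (fun p => r i (\row_j space_conv (u j) (rho j) p) * u i p)
       (uin i) (u i)).
Proof.
move=> Huin.
have /choice[g Hg] i := initial_data (Huin i).1 (Huin i).2.
have [v [z [w [B [qw vadm Hz weak]]]]] := strong_limit data (fun i => (Hg i).1).
have [A [mA AT nullA goodA]] := good_times data vadm
  (fun i => let: And4 h1 h2 h3 _ := Hz i in And3 h1 h2 h3).
(* [frac_part] makes the solution periodic on the whole space; the indicator of the good times gives
   every slice a convolution that is known exactly. *)
pose u i (p : X) : R := \1_A p.1 * z i (p.1, frac_part p.2).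
have mz i : measurable_fun [set: X] (z i) by case: (Hz i).
have z0 i p : 0 <= z i p by case: (Hz i).
have uE i (t : R) x : A t -> torus_cell N x -> u i (t, x) = z i (t, x).
  by move=> At cx; rewrite /u indicE mem_set// mul1r/= frac_id.
have uN i (t : R) x : ~ A t -> u i (t, x) = 0.
  by move=> At; rewrite /u indicE memNset// mul0r.
have u0 i p : 0 <= u i p by rewrite mulr_ge0// indicE.
have m1A : measurable_fun [set: X] (fun p : X => \1_A p.1 : R).
  rewrite (_ : (fun p => _) = \1_(fst @^-1` A : set X)); last first.
    by apply/funext => p; rewrite !indicE; congr (_%:R); apply/idP/idP; rewrite !inE.
  apply: measurable_indic; rewrite -[X in measurable X]setTI.
  by apply: (@measurable_fst _ _ (measurableTypeR R) 'rV[R]_N measurableT A); exact: mA.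
have mu_ i : measurable_fun [set: X] (u i).
  have mf : measurable_fun [set: X] (fun p : X => (p.1, frac_part p.2) : X).
    apply/measurable_fun_pairP; split; first exact: measurable_fst.
    exact: (measurableT_comp measurable_frac measurable_snd).
  apply: measurable_funM; first exact: m1A.
  exact: (measurableT_comp (mz i) mf).
have uz i p : QT N T p -> u i p <= z i p.
  move: p => [t x] [_ cx]; have [At|At] := pselect (A t); first by rewrite uE.
  by rewrite uN.
(* The convolution of [u]: [w] at good times, [0] elsewhere. As [cuE] holds at every point, the
   coefficients are rewritten as functions, and their measurability comes from that of [w]. *)
pose cu (t : R) x : 'rV[R]_I := (\1_A t : R) *: w t x.
have cuE p : \row_j space_conv (u j) (rho j) p = cu p.1 p.2.
  move: p => [t x]; apply/rowP => j; rewrite !mxE /space_conv/= indicE.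
  have [At|At] := pselect (A t).
    rewrite mem_set// mul1r -goodA//; apply: eq_Rintegral => y /set_mem cy.
    by rewrite uE.
  rewrite memNset// mul0r -[RHS](@integral_torus_cst R N 0).
  by apply: eq_integral_torus => y; rewrite uN// mul0r.
have qcu j : qfun T (fun p => cu p.1 p.2 0 j).
  rewrite (_ : (fun p => _) = fun p => (\1_A p.1 : R) * w p.1 p.2 0 j); last first.
    by apply/funext => p; rewrite mxE.
  apply: bmfM; last exact: qw.
  split; first exact: measurable_funS m1A.
  by exists 1 => p _; rewrite indicE; case: (_ \in _); rewrite ?normr1// normr0.
have iz2 i : mu.-integrable (QT N T) (fun p => (z i p ^+ 2)%:E).
  apply/integrableP; split.
    by apply/measurable_EFinP; apply: measurable_funX; exact: measurable_funS (mz i).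
  by case: (Hz i) => _ _ _; under eq_integral do rewrite -[(_ ^+ 2)%:E]gee0_abs ?lee_fin ?sqr_ge0//.
have iz i : mu.-integrable (QT N T) (EFin \o z i).
  have i1 : mu.-integrable (QT N T) (EFin \o (fun _ : X => 1 : R)).
    by apply: (@qfun_integrable R N T (ltW T0)); exact: bmf_cst.
  apply: le_integrable (integrableD mQ i1 (iz2 i)) => //.
    by apply/measurable_EFinP; exact: measurable_funS (mz i).
  move=> p _; change (`|z i p|%:E <= `|1 + z i p ^+ 2|%:E)%E; rewrite lee_fin.
  rewrite [leRHS]ger0_norm ?addr_ge0 ?sqr_ge0//.
  have : 0 <= (1 - `|z i p|) ^+ 2 by exact: sqr_ge0.
  by rewrite sqrrB real_normK ?num_real// => ?; have := normr_ge0 (z i p); lra.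
have muQ i : measurable_fun (QT N T) (u i) by exact: measurable_funS (mu_ i).
have iu i : mu.-integrable (QT N T) (EFin \o u i).
  apply: le_integrable (iz i) => //; first exact/measurable_EFinP.
  by move=> p Qp; rewrite lee_fin !ger0_norm// uz.
have u2 i : Lp_QT T 2 (u i).
  apply: Lp_on2 => //; case: (Hz i) => _ _ _ z2; apply: le_lt_trans z2.
  apply: ge0_le_integral => //.
  - by move=> p _; rewrite lee_fin sqr_ge0.
  - by apply/measurable_EFinP; exact: measurable_funX.
  - by apply/measurable_EFinP; apply: measurable_funX; exact: measurable_funS (mz i).
  - by move=> p Qp; rewrite lee_fin ler_sqr ?nnegrE// uz.
exists u; split.
  by move=> i; split => // t j x; rewrite /u/= frac_periodic.
move=> i.
have qb := qfun_coef data qcu i; have qr := qfun_rate data qcu i.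
rewrite (_ : (fun p => b i _) = fun p => b i (p, cu p.1 p.2)); last first.
  by apply/funext => p; rewrite cuE.
rewrite (_ : (fun p => r i _ * _) = fun p => r i (cu p.1 p.2) * u i p); last first.
  by apply/funext => p; rewrite cuE.
have ibu : mu.-integrable (QT N T) (EFin \o (fun p : X => u i p * b i (p, cu p.1 p.2))).
  exact: integrable_mul_bmf.
have iru : mu.-integrable (QT N T) (EFin \o (fun p : X => r i (cu p.1 p.2) * u i p)).
  rewrite (_ : (fun p => _) = fun p : X => u i p * r i (cu p.1 p.2)).
    exact: integrable_mul_bmf.
  by apply/funext => p; rewrite mulrC.
have [_ [uin1 uinE]] := Hg i.
split; split.
- exact/(Lp_on1 _ mQ _).2.
- exact: uin1.
- by case: qb.
- exact/(Lp_on1 _ mQ _).2.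
- exact/(Lp_on1 _ mQ _).2.
move=> phi tphi.
have qphi := qfun_iter_derive tphi.
have q1 : qfun T (fun p => time_derive phi p + b i (p, cu p.1 p.2) * laplacian phi p).
  apply: bmfD; first exact: (qphi [:: (1, 0)]).
  by apply: bmfM => //; exact: qfun_laplacian.
have i1 := integrable_mul_bmf mQ (iu i) q1.
have i2 := integrable_mul_bmf mQ iru (qphi [::]).
have := weak i phi tphi.
(* The operator frozen at [w] gives way to the one at [cu]: the two integrands differ only on the
   slices at bad times, a null set. *)
have -> : integral_QT T (fun p => z i p * dual_operator b r w i phi p) =
    integral_QT T (fun p => u i p * dual_operator b r cu i phi p).
  rewrite /integral_QT /Rintegral; congr fine; apply: ae_eq_integral => //.
  - by have := measurable_int _ (integrable_mul_bmf mQ (iz i) (qfun_dual_operator data qw i tphi)).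
  - by have := measurable_int _ (integrable_mul_bmf mQ (iu i) (qfun_dual_operator data qcu i tphi)).
  apply: filterS (QT_null_slices mA nullA) => -[t x] H Q.
  have At := H Q; have [_ cx] := Q.
  by rewrite uE// /dual_operator /cu/= indicE mem_set// scale1r.
rewrite uinE; last first.
  by apply: (test_function_tfun tphi); rewrite lexx ltW.
move=> E.
have -> : J (fun x => g i x * phi (0, x)) =
    - integral_QT T (fun p => u i p * dual_operator b r cu i phi p) by rewrite E opprK.
rewrite -[LHS]addr0 -[in LHS](subrr (integral_QT T (fun p => r i (cu p.1 p.2) * u i p * phi p))).
rewrite addrCA addrC -opprD -[in LHS]RintegralD//.
congr (- _ + _); apply: eq_integral_QT => p _; rewrite /dual_operator; ring.
Qed.

End existence.

Theorem theorem2 (R : realType) (N I : nat) (T : R)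
  (a : forall i : 'I_I, (R * 'rV[R]_N) * 'rV[R]_(I - i.+1) -> R)
  (r : 'I_I -> 'rV[R]_I -> R)
  (rho : 'I_I -> 'rV[R]_N -> R)
  (uin : 'I_I -> 'rV[R]_N -> R) :
  0 < T -> (1 <= N)%N -> (1 <= I)%N ->
  (forall i t y, 0 <= t <= T -> torus_periodic (fun x => a i ((t, x), y))) ->
  (forall i, {within QT_closure N T `*` setT, continuous (a i)}) ->
  (forall i, exists2 alpha, 0 < alpha & exists beta, forall p y,
     QT_closure N T p -> alpha <= a i (p, y) <= beta) ->
  (forall i, continuous (r i)) ->
  (forall i, exists M, forall x, r i x <= M) ->
  (forall i, exists C, forall x, `|r i x| <= C * (1 + \sum_(j < I) `|x 0 j|)) ->
  (forall i, [/\ smooth (rho i), torus_periodic (rho i),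
     forall x, 0 <= rho i x & integral_torus (rho i) = 1]) ->
  (forall i, [/\ torus_periodic (uin i), Lp_torus 2 (uin i) &
     {ae lebesgue_rV N, forall x, torus_cell N x -> 0 <= uin i x}]) ->
  exists u : 'I_I -> R * 'rV[R]_N -> R,
    (forall i, [/\ forall t, torus_periodic (fun x => u i (t, x)),
       Lp_QT T 2 (u i) &
       {ae QT_measure N, forall p, QT N T p -> 0 <= u i p}]) /\
    (forall i, weak_solution T
       (fun p => a i (p, \row_j space_conv (u (tail_ord i j)) (rho (tail_ord i j)) p))
       (fun p => r i (\row_j space_conv (u j) (rho j) p) * u i p)
       (uin i) (u i)).
Proof.
move=> T0 _ _ pa ca ba cr br ar Hrho Huin.
have /choice[alpha Ha] i : exists alpha : R, 0 < alpha /\ exists beta, forall p y,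
    QT_closure N T p -> alpha <= a i (p, y) <= beta.
  by have [c c0 Hc] := ba i; exists c.
have /choice[beta Hb] i := (Ha i).2.
have /choice[M HM] := br; have /choice[C HC] := ar.
have /choice[D HD] i : exists D, forall x, `|rho i x| <= D.
  have [sr pr _ _] := Hrho i.
  by have [D _ HD] := tfun_bounded (smooth_periodic_tfun sr pr); exists D.
have /choice[E HE] i : exists E, forall h x, 0 < h <= 1 -> `|lap h (rho i) x| <= E.
  have [sr pr _ _] := Hrho i.
  by have [E _ HE] := smooth_kernel_lap_bounded sr pr; exists E.
have le_sum (f : 'I_I -> R) i : f i <= \sum_(j < I) `|f j|.
  by apply: le_trans (ler_norm _) _; rewrite (bigD1 i)//= lerDl sumr_ge0.
(* Each [a i] is composed with the projection onto the components of index greater than [i], which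
   [tail_ord] enumerates. *)
pose b i (q : (R * 'rV[R]_N) * 'rV[R]_I) := a i (q.1, \row_j q.2 0 (tail_ord i j)).
have data : system_data T b r rho alpha (\sum_j `|beta j|) (\sum_j `|M j|)
    (\sum_j `|C j|) (\sum_j `| `|D j| + `|E j| |).
  split => //.
  - by move=> i t y tT j x; exact: (pa i t (\row_k y 0 (tail_ord i k)) tT j x).
  - move=> i; pose tail (y : 'rV[R]_I) : 'rV[R]_(I - i.+1) := \row_j y 0 (tail_ord i j).
    have ctail : continuous tail.
      move=> y; apply/(@cvg_ballP _ _ _ (nbhs y) (nbhs_filter y)) => e e0.
      apply: filterS (nbhsx_ballx y e e0) => y' [_ yy']; split=> // k l.
      by rewrite !mxE; exact: yy'.
    apply/(subspace_continuousP _ (b i)) => -[p y] [Qp _] S.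
    have /(subspace_continuousP _ _)/(_ (p, tail y) (conj Qp Logic.I)) ca' := ca i.
    have ch : continuous (fun q : (R * 'rV[R]_N) * 'rV[R]_I => (q.1, tail q.2)).
      move=> q; apply: (@cvg_pair _ _ _ (nbhs q) (nbhs q.1) (nbhs (tail q.2)) _ _ _
        fst (tail \o snd)); first exact: cvg_fst.
      by apply: (@continuous_comp _ _ _ snd tail); [exact: cvg_snd|exact: ctail].
    move=> /ca' /(ch (p, y)) H.
    suff : nbhs (p, y) [set q | (QT_closure N T `*` setT) q -> S (b i q)] by [].
    by apply: (@filterS _ _ (nbhs_filter (p, y)) _ _ _ H) => q Hq [Qq _]; exact: Hq.
  - by move=> i; case: (Ha i).
  - move=> i p y Qp; have /andP[h1 h2] := Hb i p (\row_j y 0 (tail_ord i j)) Qp.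
    by rewrite h1 (le_trans h2).
  - exact: sumr_ge0.
  - by move=> i x; apply: le_trans (HM i x) _.
  - move=> i x; apply: le_trans (HC i x) _.
    by rewrite ler_wpM2r// addr_ge0// sumr_ge0.
  - by move=> i; case: (Hrho i).
  - by move=> i; case: (Hrho i).
  - by move=> i; case: (Hrho i).
  - move=> i x; apply: le_trans (HD i x) _.
    apply: le_trans (le_sum (fun j => `|D j| + `|E j|) i).
    by apply: le_trans (ler_norm _) _; rewrite lerDl.
  - move=> i h x h01; apply: le_trans (HE i h x h01) _.
    apply: le_trans (le_sum (fun j => `|D j| + `|E j|) i).
    by apply: le_trans (ler_norm _) _; rewrite lerDr.
have [|u [Hu Hw]] := system_existence data (uin := uin).
  by move=> i; case: (Huin i).
exists u; split.
  by move=> i; case: (Hu i) => p1 p2 p3; split => //; apply: aeW => p _.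
move=> i; have := Hw i; rewrite /b.
rewrite (_ : (fun p => a i _) = fun p =>
  a i (p, \row_j space_conv (u (tail_ord i j)) (rho (tail_ord i j)) p))//.
apply/funext => p; congr (a i (_, _)); by apply/rowP => j; rewrite !mxE.
Qed.
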